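(* Let $n\ge 2$ and $I_n=\{1,\ldots,n\}$. The unitary equivalence classes of the nonzero irreducible representations of the $C^*$-algebras generated by $\mathcal{U}_n$-twisted isometries are parameterized by the unitary equivalence classes of the nonzero irreducible representations of the $2^n$ (twisted) noncommutative tori $\mathbb{T}_A$, with $A\subseteq I_n$.
   Context: All Hilbert spaces are complex and separable. A representation of a unital $C^*$-algebra $\mathcal{A}$ is a pair $(\mathcal{H},\pi)$ with $\pi:\mathcal{A}\to\mathcal{B}(\mathcal{H})$ a unital $*$-homomorphism. A closed subspace of $\mathcal{H}$ reduces $\pi$ if it reduces $\pi(a)$ for all $a\in\mathcal{A}$, and the representation is irreducible if its only reducing subspaces are the trivial ones, $\{0\}$ and $\mathcal{H}$. Two representations are unitarily equivalent if a unitary intertwines the images of the generators. $\mathcal{U}_n$-twisted isometry: let $\{U_{ij}\}_{1\le i<j\le n}$ be commuting unitaries on a Hilbert space $\mathcal{H}$ and put $U_{ji}:=U_{ij}^*$ for $i<j$. An $n$-tuple of isometries $V=(V_1,\ldots,V_n)$ on $\mathcal{H}$ is a $\mathcal{U}_n$-twisted isometry with respect to $\{U_{ij}\}_{i<j}$ if $V_i^*V_j=U_{ij}^*V_jV_i^*$ and $V_kU_{ij}=U_{ij}V_k$ for all $i,j,k\in\{1,\ldots,n\}$ with $i\neq j$. The $C^*$-algebra generated by $V$ is the $C^*$-algebra $C^*(V)$ generated by $V_1,\ldots,V_n$; it is unital, and it contains the $U_{ij}$ because $U_{ij}=V_i^*V_j^*V_iV_j$ for $i\neq j$. Twisted noncommutative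 torus: for $A\subseteq I_n$, with $A^c=I_n\setminus A$, $\mathbb{T}_A$ is the universal $C^*$-algebra generated by unitaries $\{\tilde U_i,\tilde U_{jk}: i\in A^c,\ 1\le j\neq k\le n\}$ satisfying $\tilde U_{kj}=\tilde U_{jk}^*$, $\tilde U_i\tilde U_{jk}=\tilde U_{jk}\tilde U_i$, $\tilde U_{i_1}\tilde U_{i_2}=\tilde U_{i_1i_2}\tilde U_{i_2}\tilde U_{i_1}$ and $\tilde U_{jk}\tilde U_{lm}=\tilde U_{lm}\tilde U_{jk}$ for all $i,i_1,i_2\in A^c$ with $i_1\neq i_2$, $1\le j\neq k\le n$ and $1\le l\neq m\le n$. *)

(* Defs.v *)
From HB Require Import structures.
From mathcomp Require Import all_boot all_order all_algebra.
From mathcomp Require Import complex.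
From mathcomp Require Import all_classical all_reals topology normedtype.
From mathcomp Require Import ring lra.
Set Implicit Arguments.
Unset Strict Implicit.
Unset Printing Implicit Defensive.
Import Order.TTheory GRing.Theory Num.Theory.
Import numFieldNormedType.Exports.
Local Open Scope classical_set_scope.
Local Open Scope ring_scope.

(* The library has no Hilbert spaces and no C*-algebras, so both are set up on
   top of complete normed modules over the complex field R[i], and the bounded
   operators on a Hilbert space are shown to form a C*-algebra.  The norms of
   normed modules over R[i] take values in R[i].  The inner product is linear
   in its first argument. *)

HB.mixin Record isHilbert (R : realType) H & CompleteNormedModule R[i] H := {
  inner : H -> H -> R[i];
  inner_linearl : forall z, linear_for *%R (inner ^~ z);
  innerC : forall x y, inner x y = (inner y x)^*;
  normr2E : forall x, `|x| ^+ 2 = inner x x;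
  separable_subproof : exists2 D : set H, countable D & dense D }.

#[short(type="hilbertType")]
HB.structure Definition Hilbert (R : realType) :=
  {H of CompleteNormedModule R[i] H & isHilbert R H}.

(* The ring operations are fields of this mixin because a structure inheriting
   from both the rings and the normed modules would need a join that the
   hierarchy (numDomainType) lacks.  The zero algebra is not excluded, so that
   bop H is a C*-algebra for every H. *)
HB.mixin Record isCStarAlgebra (R : realType) A
    & CompleteNormedModule R[i] A := {
  one : A;
  mul : A -> A -> A;
  star : A -> A;
  mulA : associative mul;
  mul1 : left_id one mul;
  mulx1 : right_id one mul;
  mul_linearl : forall y, linear (mul ^~ y);
  mul_linearr : forall x, linear (mul x);
  starD : forall x y : A, star (x + y) = star x + star y;
  starZ : forall (k : R[i]) (x : A), star (k *: x) = k^* *: star x;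
  starM : forall x y : A, star (mul x y) = mul (star y) (star x);
  starK : involutive star;
  norm_mul : forall x y : A, `|mul x y| <= `|x| * `|y|;
  norm_star_mul : forall x : A, `|mul (star x) x| = `|x| ^+ 2 }.

#[short(type="cstarType")]
HB.structure Definition CStarAlgebra (R : realType) :=
  {A of CompleteNormedModule R[i] A & isCStarAlgebra R A}.

Section InnerTheory.
Variables (R : realType) (H : hilbertType R).
Implicit Types (x y z : H) (k : R[i]).

Lemma innerDl x y z : inner (x + y) z = inner x z + inner y z.
Proof. by have := inner_linearl z 1 x y; rewrite scale1r mul1r. Qed.

Lemma innerZl k x z : inner (k *: x) z = k * inner x z.
Proof.
have h0 : inner 0 z = 0.
  by have := inner_linearl z (-1) 0 0; rewrite scaler0 addr0 mulN1r addNr.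
by have := inner_linearl z k x 0; rewrite addr0 h0 addr0.
Qed.

Lemma innerDr x y z : inner x (y + z) = inner x y + inner x z.
Proof. by rewrite innerC innerDl rmorphD/= -!innerC. Qed.

Lemma innerZr k x z : inner x (k *: z) = k^* * inner x z.
Proof. by rewrite innerC innerZl rmorphM/= -innerC. Qed.

Lemma innerNl x y : inner (- x) y = - inner x y.
Proof. by rewrite -scaleN1r innerZl mulN1r. Qed.

Lemma innerNr x y : inner x (- y) = - inner x y.
Proof. by rewrite innerC innerNl rmorphN/= -innerC. Qed.

Lemma innerBl x y z : inner (x - y) z = inner x z - inner y z.
Proof. by rewrite innerDl innerNl. Qed.

Lemma innerBr x y z : inner x (y - z) = inner x y - inner x z.
Proof. by rewrite innerDr innerNr. Qed.

Lemma inner0l x : inner 0 x = 0.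
Proof. by rewrite -[0]subr0 innerBl subrr. Qed.

Lemma inner_eq x y : (forall z, inner z x = inner z y) -> x = y.
Proof.
move=> h; apply/eqP; rewrite -subr_eq0 -normr_eq0 -sqrf_eq0 normr2E.
by rewrite innerBr h subrr.
Qed.

Lemma norm_proj x y : `|y| != 0 ->
  `|x - (inner x y / `|y| ^+ 2) *: y| ^+ 2 =
  `|x| ^+ 2 - `|inner x y| ^+ 2 / `|y| ^+ 2.
Proof.
move=> y0; have y20 : `|y| ^+ 2 != 0 by rewrite expf_neq0.
rewrite normr2E innerBl !innerBr !innerZl !innerZr -!normr2E.
have -> : (inner x y / `|y| ^+ 2)^* = inner y x / `|y| ^+ 2.
  rewrite rmorphM/= -innerC; congr (_ * _).
  by apply/CrealP; rewrite realV realX// realE normr_ge0.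
have -> : `|inner x y| ^+ 2 = inner x y * inner y x.
  by rewrite normCK [in RHS](innerC y).
rewrite divfK// [inner y x / _ * _]mulrC [inner x y * (_ / _)]mulrA.
by rewrite [_ / _ * inner y x]mulrAC subrr subr0.
Qed.

Lemma cauchy_schwarz x y : `|inner x y| <= `|x| * `|y|.
Proof.
have [y0|y0] := eqVneq `|y| 0.
  have -> : y = 0 by apply/eqP; rewrite -normr_eq0 y0.
  by rewrite innerC inner0l rmorph0 !normr0 mulr0.
have : 0 <= `|x| ^+ 2 - `|inner x y| ^+ 2 / `|y| ^+ 2.
  by rewrite -norm_proj// exprn_ge0.
rewrite subr_ge0 ler_pdivrMr ?exprn_gt0 ?lt_def ?y0 ?normr_ge0//.
by rewrite -exprMn ler_pXn2r// nnegrE ?mulr_ge0.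
Qed.

Lemma parallelogram x y :
  `|x - y| ^+ 2 = `|x| ^+ 2 *+ 2 + `|y| ^+ 2 *+ 2 - `|x + y| ^+ 2.
Proof.
rewrite !normr2E !(innerBl, innerBr, innerDl, innerDr) !mulr2n.
ring.
Qed.

End InnerTheory.

Section RealNorm.
Variables (R : realType) (V : normedModType R[i]).
Implicit Types x y : V.

Definition rnorm x : R := complex.Re `|x|.

Lemma rnormE x : `|x| = (rnorm x)%:C%C.
Proof. by rewrite /rnorm RRe_real// realE normr_ge0. Qed.

Lemma rnorm_ge0 x : 0 <= rnorm x.
Proof. by rewrite -ler0c -rnormE. Qed.

Lemma rnormD x y : rnorm (x + y) <= rnorm x + rnorm y.
Proof. by rewrite -lecR rmorphD/= -!rnormE ler_normD. Qed.

Lemma rnormB x y : rnorm (x - y) = rnorm (y - x).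
Proof. by rewrite /rnorm distrC. Qed.

Lemma rnorm_eq0 x : rnorm x = 0 -> x = 0.
Proof. by move=> h; apply/eqP; rewrite -normr_eq0 rnormE h. Qed.

End RealNorm.

Section Riesz.
Variables (R : realType) (H : hilbertType R).
Variables (f : H -> R[i]) (M : R).
Hypothesis flin : linear_for *%R f.
Hypothesis fM : forall x, `|f x| <= M%:C%C * `|x|.

Let f0 : f 0 = 0.
Proof.
by have := flin (-1) 0 0; rewrite scaler0 addr0 mulN1r addNr.
Qed.

Let fD x y : f (x + y) = f x + f y.
Proof. by have := flin 1 x y; rewrite scale1r mul1r. Qed.

Let fZ k x : f (k *: x) = k * f x.
Proof. by have := flin k x 0; rewrite addr0 f0 addr0. Qed.

Let fB x y : f (x - y) = f x - f y.
Proof. by rewrite fD -scaleN1r fZ mulN1r. Qed.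

Lemma riesz_min : (exists x, f x != 0) ->
  exists u, f u = 1 /\ forall x, f x = 1 -> rnorm u <= rnorm x.
Proof.
move=> [x0 fx0].
pose S := [set x | f x = 1].
have S0 : S ((f x0)^-1 *: x0) by rewrite /S /= fZ mulVf.
pose d := inf (@rnorm R H @` S).
have dlb x : S x -> d <= rnorm x.
  move=> Sx; apply: ge_inf; last by exists x.
  by exists 0 => _ [y _ <-]; exact: rnorm_ge0.
have d0 : 0 <= d.
  by apply: lb_le_inf; [exists (rnorm ((f x0)^-1 *: x0)); exists ((f x0)^-1 *: x0)|
    move=> _ [y _ <-]; exact: rnorm_ge0].
pose A (e : R) := [set x | S x /\ rnorm x < d + e].
have A0 e : 0 < e -> A e !=set0.
  move=> e0; have [|_ [x Sx <-] xe] := @inf_adherent R (@rnorm R H @` S) e e0.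
    by split; [exists (rnorm ((f x0)^-1 *: x0)); exists ((f x0)^-1 *: x0)|
     exists 0 => _ [y _ <-]; exact: rnorm_ge0].
  by exists x.
pose F := filter_from [set e | 0 < e] A.
have FF : ProperFilter F.
  apply: filter_from_proper => //; apply: filter_from_filter; first by exists 1 => /=.
  move=> i j /= i0 j0; exists (Num.min i j); first by rewrite lt_min i0.
  move=> x [Sx]; rewrite -ltrBlDl lt_min => /andP[xi xj].
  by split; split=> //; rewrite -ltrBlDl.
have key e x y : A e x -> A e y -> rnorm (x - y) ^+ 2 <= 8 * d * e + 4 * e ^+ 2.
  move=> [Sx xe] [Sy ye].
  have xy : 2 * d <= rnorm (x + y).
    have : d <= rnorm (2^-1 *: (x + y)).
      by apply: dlb; rewrite /S/= fZ fD Sx Sy -(natrD _ 1 1) mulVf// pnatr_eq0.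
    have -> : rnorm (2^-1 *: (x + y)) = 2^-1 * rnorm (x + y).
      apply: (@complexI R); rewrite -rnormE normrZ rmorphM/= -rnormE; congr (_ * _).
      by rewrite ger0_norm ?invr_ge0// fmorphV rmorph_nat.
    lra.
  have := parallelogram x y; rewrite !rnormE -!rmorphXn/= -!rmorphMn/= -!rmorphD/= -rmorphB.
  move/complexI => ->.
  have := rnorm_ge0 x; have := rnorm_ge0 y; rewrite !mulr2n; nra.
have Fc : cauchy F.
  apply/cauchy_ballP => e; rewrite ltcE /= => /andP[/eqP ei e0].
  have eE : e = (complex.Re e)%:C%C by case: e ei e0 => a b /= ->.
  pose r := complex.Re e; pose t := Num.min 1 (r ^+ 2 / (8 * d + 5)).
  have den : 0 < 8 * d + 5 by lra.
  have t0 : 0 < t by rewrite lt_min ltr01 divr_gt0// exprn_gt0.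
  have t1 : t <= 1 by rewrite ge_min lexx.
  have tr : t * (8 * d + 5) <= r ^+ 2 by rewrite -ler_pdivlMr// ge_min lexx orbT.
  exists (A t, A t) => /=; first by split; exists t.
  move=> [x y] /= [Ax Ay]; rewrite -ball_normE /ball_ /= rnormE eE ltcR.
  rewrite -(@ltr_pXn2r _ 2)// ?nnegrE ?rnorm_ge0 ?ltW//.
  have := key _ _ _ Ax Ay; rewrite -/r; nra.
have [u Fu] : exists u : H, F --> u by apply/cvg_ex; exact: (@cauchy_cvg H F FF Fc).
have near_u e : 0 < e -> forall t, 0 < t -> exists2 x, A t x & rnorm (u - x) < e.
  move=> e0 t t0.
  have FAt : F (A t) by exists t.
  have Fb : F (ball u (e%:C)%C).
    by apply: Fu; apply/nbhs_ballP; exists (e%:C)%C => //=; rewrite ltcR.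
  have [x [Ax]] := filter_ex (filterI FAt Fb).
  by rewrite -ball_normE /ball_/= rnormE ltcR => h; exists x.
exists u; split.
  apply/eqP; rewrite -subr_eq0 -normr_le0.
  have fr x : `|f x| = (complex.Re `|f x|)%:C%C by rewrite RRe_real// realE normr_ge0.
  have M0 : 0 <= Num.max M 0 by rewrite le_max lexx orbT.
  apply/ler_addgt0Pl => e; rewrite addr0 ltcE /= => /andP[/eqP ei e0].
  have eE : e = (complex.Re e)%:C%C by case: e ei e0 => a b /= ->.
  have [x [Sx _] xe] := near_u (complex.Re e / (Num.max M 0 + 1))
     (divr_gt0 e0 (ltr_wpDl M0 ltr01)) 1 ltr01.
  rewrite -Sx -fB (le_trans (fM _))// rnormE eE -rmorphM/= lecR.
  move: xe; rewrite ltr_pdivlMr; last lra.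
  have := rnorm_ge0 (u - x); have : M <= Num.max M 0 by rewrite le_max lexx.
  nra.
move=> x /dlb; apply: le_trans.
apply/ler_addgt0Pl => e e0.
have e20 : 0 < e / 2 by lra.
have [y [_ yd] uy] := near_u _ e20 _ e20.
have := rnormD (u - y) y; rewrite subrK; lra.
Qed.

Lemma riesz : exists z, forall x, f x = inner x z.
Proof.
have [h0|] := pselect (forall x, f x = 0).
  by exists 0 => x; rewrite h0 innerC inner0l rmorph0.
move=> /existsNP [x0 /eqP fx0].
have [u [fu umin]] := riesz_min (ex_intro _ x0 fx0).
have u0 : `|u| != 0.
  rewrite normr_eq0; apply/eqP => u0.
  by move: fu; rewrite u0 f0 => /esym/eqP; rewrite oner_eq0.
have orth h : f h = 0 -> inner h u = 0.
  move=> fh; have [h0|h0] := eqVneq `|h| 0.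
    by have /eqP := h0; rewrite normr_eq0 => /eqP ->; rewrite inner0l.
  have := umin (u - (inner u h / `|h| ^+ 2) *: h).
  rewrite fB fZ fh mulr0 subr0 fu => /(_ erefl).
  rewrite -lecR -!rnormE -(@ler_pXn2r _ 2)// ?nnegrE// norm_proj//.
  rewrite lerDl oppr_ge0 => hh.
  have hp : 0 < `|h| ^+ 2 by rewrite exprn_gt0// lt_def h0 normr_ge0.
  move: hh; rewrite pmulr_lle0 ?invr_gt0// => hh.
  have /eqP : `|inner u h| ^+ 2 = 0 by apply/eqP; rewrite eq_le hh exprn_ge0.
  by rewrite sqrf_eq0 normr_eq0 => /eqP uh; rewrite innerC uh rmorph0.
exists ((`|u| ^+ 2)^-1 *: u) => x.
have : inner (x - f x *: u) u = 0 by apply: orth; rewrite fB fZ fu mulr1 subrr.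
rewrite innerBl innerZl -normr2E => /eqP; rewrite subr_eq0 => /eqP xu.
rewrite innerZr xu.
have -> : ((`|u| ^+ 2)^-1)^* = (`|u| ^+ 2)^-1.
  by apply/CrealP; rewrite realV realX// realE normr_ge0.
by rewrite mulrC mulfK// expf_neq0.
Qed.
End Riesz.

Record bop (R : realType) (H : hilbertType R) := Bop {
  bop_fun :> H -> H;
  bop_linear : linear bop_fun;
  bop_bounded : exists M : R, forall x, `|bop_fun x| <= M%:C%C * `|x| }.

Section BopAlgebra.
Variables (R : realType) (H : hilbertType R).
Implicit Types (T S : bop H) (x y : H) (k : R[i]) (M : R).

Lemma bopP T S : T =1 S -> T = S.
Proof.
case: T S => [f fl fb] [g gl gb] /= /funext fg; move: fl fb gl gb; rewrite fg.
by move=> fl fb gl gb; congr Bop; exact: Prop_irrelevance.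
Qed.

HB.instance Definition _ := gen_eqMixin (bop H).
HB.instance Definition _ := gen_choiceMixin (bop H).

Lemma bopD T x y : T (x + y) = T x + T y.
Proof. by have := bop_linear T 1 x y; rewrite !scale1r. Qed.

Lemma bop0 T : T 0 = 0.
Proof. by have := bop_linear T (-1) 0 0; rewrite scaler0 addr0 scaleN1r addNr. Qed.

Lemma bopZ T k x : T (k *: x) = k *: T x.
Proof. by have := bop_linear T k x 0; rewrite bop0 !addr0. Qed.

Lemma bopB T x y : T (x - y) = T x - T y.
Proof. by rewrite bopD -scaleN1r bopZ scaleN1r. Qed.

Lemma bop_rbound T : exists M, 0 <= M /\ forall x, rnorm (T x) <= M * rnorm x.
Proof.
have [M TM] := bop_bounded T; exists (Num.max M 0); split.
  by rewrite le_max lexx orbT.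
move=> x; have := TM x; rewrite !rnormE -rmorphM/= lecR => /le_trans; apply.
by rewrite ler_wpM2r ?rnorm_ge0// le_max lexx.
Qed.

Fact scaled_bounded (f : H -> H) M : (forall x, rnorm (f x) <= M * rnorm x) ->
  exists M : R, forall x, `|f x| <= M%:C%C * `|x|.
Proof. by move=> fM; exists M => x; rewrite !rnormE -rmorphM/= lecR. Qed.

Fact bop_zero_linear : linear (fun _ : H => 0 : H).
Proof. by move=> k x y; rewrite scaler0 addr0. Qed.
Fact bop_zero_bounded : exists M : R, forall x, `|0 : H| <= M%:C%C * `|x|.
Proof. by exists 0 => x; rewrite normr0 mul0r. Qed.
Definition bop_zero := Bop bop_zero_linear bop_zero_bounded.

Fact bop_add_linear T S : linear (fun x => T x + S x).
Proof. by move=> k x y; rewrite !bop_linear scalerDr addrACA. Qed.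
Fact bop_add_bounded T S :
  exists M : R, forall x, `|T x + S x| <= M%:C%C * `|x|.
Proof.
have [M [_ TM]] := bop_rbound T; have [N [_ SN]] := bop_rbound S.
apply: (@scaled_bounded _ (M + N)) => x; rewrite (le_trans (rnormD _ _))//.
by rewrite mulrDl lerD.
Qed.
Definition bop_add T S := Bop (bop_add_linear T S) (bop_add_bounded T S).

Fact bop_scale_linear k T : linear (fun x => k *: T x).
Proof.
by move=> l x y; rewrite bop_linear scalerDr !scalerA [k * l]mulrC.
Qed.
Lemma rnormZ k x : rnorm (k *: x) = complex.Re `|k| * rnorm x.
Proof.
by apply: (@complexI R); rewrite -rnormE normrZ rmorphM/= -!rnormE.
Qed.
Fact bop_scale_bounded k T :
  exists M : R, forall x, `|k *: T x| <= M%:C%C * `|x|.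
Proof.
have [M [_ TM]] := bop_rbound T.
apply: (@scaled_bounded _ (complex.Re `|k| * M)) => x.
by rewrite rnormZ -mulrA ler_wpM2l// -ler0c RRe_real// realE normr_ge0.
Qed.
Definition bop_scale k T := Bop (bop_scale_linear k T) (bop_scale_bounded k T).

Fact bop_one_linear : linear (fun x : H => x).
Proof. by []. Qed.
Fact bop_one_bounded : exists M : R, forall x : H, `|x| <= M%:C%C * `|x|.
Proof. by exists 1 => x; rewrite mul1r. Qed.
Definition bop_one := Bop bop_one_linear bop_one_bounded.

Fact bop_mul_linear T S : linear (fun x => T (S x)).
Proof. by move=> k x y; rewrite !bop_linear. Qed.
Fact bop_mul_bounded T S :
  exists M : R, forall x, `|T (S x)| <= M%:C%C * `|x|.
Proof.
have [M [M0 TM]] := bop_rbound T; have [N [_ SN]] := bop_rbound S.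
apply: (@scaled_bounded _ (M * N)) => x; rewrite (le_trans (TM _))//.
by rewrite -mulrA ler_wpM2l.
Qed.
Definition bop_mul T S := Bop (bop_mul_linear T S) (bop_mul_bounded T S).

Fact bop_addA : associative bop_add.
Proof. by move=> T S U; apply: bopP => x /=; rewrite addrA. Qed.
Fact bop_addC : commutative bop_add.
Proof. by move=> T S; apply: bopP => x /=; rewrite addrC. Qed.
Fact bop_add0 : left_id bop_zero bop_add.
Proof. by move=> T; apply: bopP => x /=; rewrite add0r. Qed.
Fact bop_addN : left_inverse bop_zero (bop_scale (-1)) bop_add.
Proof. by move=> T; apply: bopP => x /=; rewrite scaleN1r addNr. Qed.

HB.instance Definition _ :=
  GRing.isZmodule.Build (bop H) bop_addA bop_addC bop_add0 bop_addN.

Lemma bop_addE T S x : (T + S) x = T x + S x. Proof. by []. Qed.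
Lemma bop_oppE T x : (- T) x = - T x. Proof. exact: scaleN1r. Qed.
Lemma bop_subE T S x : (T - S) x = T x - S x.
Proof. by rewrite bop_addE bop_oppE. Qed.
Lemma bop_zeroE x : (0 : bop H) x = 0. Proof. by []. Qed.

Fact bop_scaleA k l T : bop_scale k (bop_scale l T) = bop_scale (k * l) T.
Proof. by apply: bopP => x /=; rewrite scalerA. Qed.
Fact bop_scale1 : left_id 1 bop_scale.
Proof. by move=> T; apply: bopP => x /=; rewrite scale1r. Qed.
Fact bop_scaleDr : right_distributive bop_scale +%R.
Proof. by move=> k T S; apply: bopP => x /=; rewrite scalerDr. Qed.
Fact bop_scaleDl T : {morph bop_scale^~ T : k l / k + l}.
Proof. by move=> k l; apply: bopP => x /=; rewrite scalerDl. Qed.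

HB.instance Definition _ := GRing.Zmodule_isLmodule.Build R[i] (bop H)
  bop_scaleA bop_scale1 bop_scaleDr bop_scaleDl.

Lemma bop_scaleE k T x : (k *: T) x = k *: T x. Proof. by []. Qed.

Definition opnorm T : R := sup [set rnorm (T x) | x in [set x | rnorm x <= 1]].

Lemma rnorm0 : rnorm (0 : H) = 0.
Proof. by rewrite /rnorm normr0. Qed.

Lemma opnorm_ub T x : rnorm x <= 1 -> rnorm (T x) <= opnorm T.
Proof.
move=> x1; have [M [M0 TM]] := bop_rbound T; apply: ub_le_sup; last by exists x.
exists M => _ [y /= y1 <-]; apply: le_trans (TM y) _.
by rewrite ler_piMr.
Qed.

Lemma opnorm_ge0 T : 0 <= opnorm T.
Proof. by apply: le_trans (rnorm_ge0 (T 0)) (opnorm_ub _ _); rewrite rnorm0. Qed.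

Lemma opnorm_bound T x : rnorm (T x) <= opnorm T * rnorm x.
Proof.
have [x0|x0] := eqVneq (rnorm x) 0.
  by rewrite (rnorm_eq0 x0) bop0 rnorm0 mulr0.
have xp : 0 < rnorm x by rewrite lt_def x0 rnorm_ge0.
have e : rnorm (((rnorm x)^-1)%:C%C *: x) = 1.
  by rewrite rnormZ ger0_norm ?ler0c ?invr_ge0 ?ltW//= mulVf.
have := @opnorm_ub T (((rnorm x)^-1)%:C%C *: x).
rewrite e lexx => /(_ isT).
rewrite bopZ rnormZ ger0_norm ?ler0c ?invr_ge0 ?rnorm_ge0//=.
by rewrite ler_pdivrMl// mulrC.
Qed.

Lemma opnorm_le T M : 0 <= M -> (forall x, rnorm (T x) <= M * rnorm x) ->
  opnorm T <= M.
Proof.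
move=> M0 TM; apply: ge_sup; first by exists (rnorm (T 0)); exists 0; rewrite //= rnorm0.
by move=> _ [x /= x1 <-]; apply: le_trans (TM x) _; rewrite ler_piMr.
Qed.

Fact opnormD T S : (opnorm (T + S))%:C%C <= (opnorm T)%:C%C + (opnorm S)%:C%C.
Proof.
rewrite -rmorphD/= lecR; apply: opnorm_le; first by rewrite addr_ge0 ?opnorm_ge0.
by move=> x; rewrite (le_trans (rnormD _ _))// mulrDl lerD ?opnorm_bound.
Qed.

Let opnormZ_le k T : opnorm (k *: T) <= complex.Re `|k| * opnorm T.
Proof.
have k0 : 0 <= complex.Re `|k| by rewrite -ler0c RRe_real// realE normr_ge0.
apply: opnorm_le; first by rewrite mulr_ge0 ?opnorm_ge0.
by move=> x; rewrite rnormZ -mulrA ler_wpM2l ?opnorm_bound.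
Qed.

Fact opnormZ k T : (opnorm (k *: T))%:C%C = `|k| * (opnorm T)%:C%C.
Proof.
have kE : `|k| = (complex.Re `|k|)%:C%C by rewrite RRe_real// realE normr_ge0.
rewrite kE -rmorphM; congr (_%:C%C); apply/eqP; rewrite eq_le opnormZ_le andTb.
have [->|k0] := eqVneq k 0; first by rewrite normr0 mul0r opnorm_ge0.
have kp : 0 < complex.Re `|k| by rewrite -ltcR -kE normr_gt0.
have := opnormZ_le k^-1 (k *: T); rewrite scalerA mulVf// scale1r.
rewrite normfV {1}kE -fmorphV/= => h.
by rewrite -ler_pdivlMl.
Qed.

Fact opnorm_eq0 T : (opnorm T)%:C%C = 0 -> T = 0.
Proof.
move=> /(@complexI R) T0; apply: bopP => x; apply: rnorm_eq0; apply/eqP.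
by rewrite eq_le rnorm_ge0 andbT (le_trans (opnorm_bound T x))// T0 mul0r.
Qed.

HB.instance Definition _ := Lmodule_isNormed.Build R[i] (bop H)
  opnormD opnormZ opnorm_eq0.

Lemma bop_normE T : `|T| = (opnorm T)%:C%C.
Proof. by []. Qed.

Lemma bop_norm_bound T x : `|T x| <= `|T| * `|x|.
Proof. by rewrite bop_normE !rnormE -rmorphM/= lecR opnorm_bound. Qed.

Fact bop_cauchy_cvg (F : set_system (bop H)) :
  ProperFilter F -> cauchy F -> cvg F.
Proof.
move=> FF Fc.
have FA (e : R) : 0 < e -> exists2 A, F A &
    forall T S, A T -> A S -> opnorm (T - S) < e.
  move=> e0; have /cauchy_ballP/(_ (e%:C%C)) := Fc.
  rewrite ltcR => /(_ e0) [[A B] /= [FA FB] AB].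
  exists (A `&` B); first exact: filterI.
  move=> T S [AT _] [_ BS]; have /= := AB (T, S) (conj AT BS).
  by rewrite -ball_normE /ball_/= bop_normE ltcR.
have ev_cvg x : exists l : H, (fun T : bop H => T x) @ F --> l.
  apply/cvg_ex; apply: cauchy_cvg; apply/cauchy_ballP => e.
  rewrite ltcE /= => /andP[/eqP ei e0].
  have eE : e = (complex.Re e)%:C%C by case: e ei e0 => a b /= ->.
  have x1 : 0 < rnorm x + 1 by rewrite ltr_wpDl ?rnorm_ge0.
  have [A FAA AA] := FA _ (divr_gt0 e0 x1).
  exists ((fun T : bop H => T x) @` A, (fun T : bop H => T x) @` A) => /=.
    by split; apply: (@filterS _ F _ A) => // T AT; exists T.
  move=> [_ _] /= [[T AT <-] [S AS <-]].
  rewrite -ball_normE /ball_/= -bop_subE rnormE eE ltcR.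
  rewrite (le_lt_trans (opnorm_bound _ _))//.
  have := AA _ _ AT AS; rewrite ltr_pdivlMr//; have := rnorm_ge0 x.
  have := opnorm_ge0 (T - S); nra.
have [g gP] := choice ev_cvg.
have gnear x (e : R) : 0 < e -> F [set T | rnorm (g x - T x) < e].
  move=> e0; have : nbhs (g x) (ball (g x) e%:C%C).
    by apply/nbhs_ballP; exists e%:C%C => //=; rewrite ltcR.
  move=> /gP gF; have {}gF : F [set T | ball (g x) e%:C%C (T x)] := gF.
  apply: filterS gF => T.
  by rewrite /= -ball_normE /ball_/= rnormE ltcR.
have glin : linear g.
  move=> k x y; apply/eqP; rewrite -subr_eq0 -normr_le0.
  apply/ler_addgt0Pl => e; rewrite addr0 ltcE /= => /andP[/eqP ei e0].
  have eE : e = (complex.Re e)%:C%C by case: e ei e0 => a b /= ->.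
  set r := complex.Re e in eE e0; have k0 : 0 <= complex.Re `|k|.
    by rewrite -ler0c RRe_real// realE normr_ge0.
  set c := complex.Re `|k| in k0; have c2 : 0 < c + 2 by lra.
  have r0 := divr_gt0 e0 c2.
  have [T [[/= T1 T2] T3]] := filter_ex (filterI (filterI
    (gnear (k *: x + y) _ r0) (gnear x _ r0)) (gnear y _ r0)).
  rewrite eE rnormE lecR.
  have -> : g (k *: x + y) - (k *: g x + g y) =
      (g (k *: x + y) - T (k *: x + y)) + (k *: (T x - g x) + (T y - g y)).
    rewrite bop_linear scalerBr [X in _ = _ + X]addrACA -opprD addrA subrK.
    by [].
  rewrite (le_trans (rnormD _ _))//.
  have := rnormD (k *: (T x - g x)) (T y - g y).
  rewrite rnormZ (rnormB (T x)) (rnormB (T y)).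
  have : r / (c + 2) * (c + 2) = r by rewrite divfK// gt_eqF.
  have := rnorm_ge0 (g x - T x); rewrite -/c; nra.
have gclose A (e : R) : 0 < e -> F A ->
    (forall T S, A T -> A S -> opnorm (T - S) < e) ->
    forall T, A T -> forall x, rnorm (g x - T x) <= e * rnorm x.
  move=> e0 FAA AA T AT x; apply/ler_addgt0Pl => d d0.
  have [S [/= AS Sd]] := filter_ex (filterI FAA (gnear x _ d0)).
  have -> : g x - T x = (g x - S x) + (S - T) x by rewrite bop_subE addrA subrK.
  rewrite (le_trans (rnormD _ _))// lerD ?(ltW Sd)//.
  by rewrite (le_trans (opnorm_bound _ _))// ler_wpM2r ?rnorm_ge0// ltW ?AA.
have gbnd : exists M : R, forall x, `|g x| <= M%:C%C * `|x|.
  have [A FAA AA] := FA 1 ltr01; have [T AT] := filter_ex FAA.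
  apply: (@scaled_bounded _ (1 + opnorm T)) => x.
  rewrite -[g x](subrK (T x)) (le_trans (rnormD _ _))// mulrDl lerD ?opnorm_bound//.
  exact: gclose FAA AA _ AT x.
apply/cvg_ex; exists (Bop glin gbnd) => U /nbhs_ballP[e /=].
rewrite ltcE /= => /andP[/eqP ei e0].
have eE : e = (complex.Re e)%:C%C by case: e ei e0 => a b /= ->.
rewrite eE -ball_normE => sub.
have e20 : 0 < complex.Re e / 2 by lra.
have [A FAA AA] := FA _ e20.
apply: (@filterS _ F _ A) => // T AT; apply: sub; rewrite /ball_/= bop_normE ltcR.
have : opnorm (Bop glin gbnd - T) <= complex.Re e / 2.
  apply: opnorm_le; first exact: ltW.
  by move=> x; rewrite bop_subE /=; exact: gclose FAA AA _ AT x.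
lra.
Qed.

HB.instance Definition _ := Uniform_isComplete.Build (bop H) bop_cauchy_cvg.

Lemma bop_adj_ex T : exists S : bop H, forall x y, inner (T x) y = inner x (S y).
Proof.
have [M [M0 TM]] := bop_rbound T.
have /choice[g gP] y : exists z, forall x, inner (T x) y = inner x z.
  apply: (@riesz _ _ (fun x => inner (T x) y) (M * rnorm y)).
    by move=> k x z; rewrite bop_linear innerDl innerZl.
  move=> x; rewrite (le_trans (cauchy_schwarz _ _))// !rnormE -!rmorphM/= lecR.
  by rewrite mulrAC ler_wpM2r ?rnorm_ge0.
have glin : linear g.
  move=> k x y; apply: inner_eq => z.
  by rewrite -gP innerDr innerZr innerDr innerZr -!gP.
have gbnd : exists N : R, forall x, `|g x| <= N%:C%C * `|x|.
  apply: (@scaled_bounded _ M) => x.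
  have [gx0|gx0] := eqVneq (rnorm (g x)) 0; first by rewrite gx0 mulr_ge0 ?rnorm_ge0.
  have gp : 0 < rnorm (g x) by rewrite lt_def gx0 rnorm_ge0.
  have : `|g x| ^+ 2 <= `|T (g x)| * `|x|.
    rewrite normr2E -gP.
    have ir : inner (T (g x)) x = `|inner (T (g x)) x|.
      by rewrite ger0_norm// gP -normr2E exprn_ge0.
    by rewrite ir cauchy_schwarz.
  rewrite !rnormE -rmorphXn -rmorphM/= lecR.
  have := TM (g x); have := rnorm_ge0 x; nra.
by exists (Bop glin gbnd) => x y; rewrite gP.
Qed.

Definition bop_star T : bop H := projT1 (cid (bop_adj_ex T)).

Lemma bop_starP T x y : inner (T x) y = inner x (bop_star T y).
Proof. by rewrite /bop_star; case: cid. Qed.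

Lemma bop_star_eq T S : (forall x y, inner (T x) y = inner x (S y)) ->
  bop_star T = S.
Proof. by move=> TS; apply: bopP => y; apply: inner_eq => x; rewrite -bop_starP TS. Qed.

Fact bop_starD T S : bop_star (T + S) = bop_star T + bop_star S.
Proof.
by apply: bop_star_eq => x y; rewrite !bop_addE innerDl innerDr !bop_starP.
Qed.

Fact bop_starZ k T : bop_star (k *: T) = k^* *: bop_star T.
Proof.
by apply: bop_star_eq => x y; rewrite !bop_scaleE innerZl innerZr conjCK bop_starP.
Qed.

Fact bop_starM T S : bop_star (bop_mul T S) = bop_mul (bop_star S) (bop_star T).
Proof. by apply: bop_star_eq => x y /=; rewrite !bop_starP. Qed.

Fact bop_starK : involutive bop_star.
Proof.
by move=> T; apply: bop_star_eq => x y; rewrite innerC -bop_starP -innerC.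
Qed.

Fact bop_mulA : associative bop_mul.
Proof. by move=> T S U; exact: bopP. Qed.
Fact bop_mul1 : left_id bop_one bop_mul.
Proof. by move=> T; exact: bopP. Qed.
Fact bop_mulx1 : right_id bop_one bop_mul.
Proof. by move=> T; exact: bopP. Qed.
Fact bop_mul_linearl S : linear (bop_mul ^~ S).
Proof. by move=> k T U; exact: bopP. Qed.
Fact bop_mul_linearr T : linear (bop_mul T).
Proof. by move=> k S U; apply: bopP => x; rewrite /= bop_linear. Qed.

Fact bop_norm_mul T S : `|bop_mul T S| <= `|T| * `|S|.
Proof.
rewrite !bop_normE -rmorphM/= lecR; apply: opnorm_le.
  by rewrite mulr_ge0 ?opnorm_ge0.
move=> x; rewrite (le_trans (opnorm_bound T (S x)))// -mulrA.
by rewrite ler_wpM2l ?opnorm_ge0 ?opnorm_bound.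
Qed.

Let star_mul_ge T : opnorm T ^+ 2 <= opnorm (bop_mul (bop_star T) T).
Proof.
set S := bop_mul _ _; rewrite -(sqr_sqrtr (opnorm_ge0 S)).
rewrite ler_pXn2r ?nnegrE ?opnorm_ge0 ?sqrtr_ge0//.
apply: opnorm_le; first exact: sqrtr_ge0.
move=> x; rewrite -(@ler_pXn2r _ 2)// ?nnegrE ?mulr_ge0 ?rnorm_ge0 ?sqrtr_ge0//.
rewrite exprMn sqr_sqrtr ?opnorm_ge0// -lecR rmorphXn/= -rnormE normr2E.
have -> : inner (T x) (T x) = `|inner (S x) x|.
  have e : inner (S x) x = inner (T x) (T x) by rewrite innerC -bop_starP -innerC.
  by rewrite e ger0_norm// -normr2E exprn_ge0.
rewrite (le_trans (cauchy_schwarz _ _))// !rnormE -rmorphM/= lecR expr2 mulrA.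
by rewrite ler_wpM2r ?rnorm_ge0//; exact: (opnorm_bound S).
Qed.

Let opnorm_star T : opnorm T <= opnorm (bop_star T).
Proof.
have [T0|T0] := eqVneq (opnorm T) 0; first by rewrite T0 opnorm_ge0.
have Tp : 0 < opnorm T by rewrite lt_def T0 opnorm_ge0.
have := bop_norm_mul (bop_star T) T; rewrite !bop_normE -rmorphM/= lecR.
by move=> /(le_trans (star_mul_ge T)); rewrite expr2 ler_pM2r.
Qed.

Fact bop_norm_star_mul T : `|bop_mul (bop_star T) T| = `|T| ^+ 2.
Proof.
apply/eqP; rewrite eq_le (le_trans (bop_norm_mul _ _))/=; last first.
  rewrite expr2 ler_wpM2r// !bop_normE lecR.
  by rewrite (le_trans (opnorm_star _))// bop_starK.
by rewrite !bop_normE -rmorphXn/= lecR star_mul_ge.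
Qed.

HB.instance Definition _ := isCStarAlgebra.Build R (bop H)
  bop_mulA bop_mul1 bop_mulx1 bop_mul_linearl bop_mul_linearr
  bop_starD bop_starZ bop_starM bop_starK bop_norm_mul bop_norm_star_mul.

End BopAlgebra.

Section CStarNotions.
Variables (R : realType) (A : cstarType R).
Implicit Types (x y : A) (S G : set A).

Definition is_isometry x := mul (star x) x = one.

Definition is_unitary x := mul (star x) x = one /\ mul x (star x) = one.

Definition commutes x y := mul x y = mul y x.

Record cstar_subalgebra S : Prop := CStarSubalgebra {
  csub_closed : closed S;
  csub_one : S one;
  csub_linear : forall (k : R[i]) x y, S x -> S y -> S (k *: x + y);
  csub_mul : forall x y, S x -> S y -> S (mul x y);
  csub_star : forall x, S x -> S (star x) }.

Definition cstar_generated G : set A := smallest cstar_subalgebra G.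

End CStarNotions.

(* Unital *-homomorphisms from the C*-subalgebra S of A to B.  They are encoded
   by functions on all of A, whose values outside S are irrelevant. *)
Record star_hom (R : realType) (A B : cstarType R) (S : set A) (f : A -> B)
    : Prop := StarHom {
  hom_one : f one = one;
  hom_linear : forall (k : R[i]) x y, S x -> S y ->
    f (k *: x + y) = k *: f x + f y;
  hom_mul : forall x y, S x -> S y -> f (mul x y) = mul (f x) (f y);
  hom_star : forall x, S x -> f (star x) = star (f x) }.

Section HilbertNotions.
Variable (R : realType).
Implicit Types H K : hilbertType R.

Definition closed_subspace H (M : set H) :=
  [/\ closed M, M 0 & forall (k : R[i]) x y, M x -> M y -> M (k *: x + y)].

Definition reduces H (M : set H) (T : bop H) :=
  forall x, M x -> M (T x) /\ M (star T x).

Definition irreducible (A : cstarType R) (S : set A) H (pi : A -> bop H) :=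
  forall M : set H, closed_subspace M -> (forall a, S a -> reduces M (pi a)) ->
    M = [set 0] \/ M = setT.

Definition isometric_map H K (J : H -> K) :=
  linear J /\ forall x y, inner (J x) (J y) = inner x y.

Definition unitary_map H K (Z : H -> K) :=
  isometric_map Z /\ range Z = setT.

Definition intertwines H K (Z : H -> K) (T : bop H) (T' : bop K) :=
  forall x, Z (T x) = T' (Z x).

(* Pure isometries: the ranges of the powers of T intersect in 0. *)
Definition is_shift H (T : bop H) :=
  is_isometry T /\ \bigcap_(m in [set: nat]) range (iter m T) = [set 0].

Record irrep (A : cstarType R) (S : set A) : Type := Irrep {
  irrep_space : hilbertType R;
  irrep_map :> A -> bop irrep_space;
  irrep_hom : star_hom S irrep_map;
  irrep_nonzero : exists x : irrep_space, x != 0;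
  irrep_irreducible : irreducible S irrep_map }.

End HilbertNotions.

(* The family U_ij (i < j) is extended to i <> j by U_ji = U_ij^*; the diagonal
   entries of U are unconstrained and never used. *)
Record twisted_isometry (R : realType) (n : nat) (H : hilbertType R)
    (U : 'I_n -> 'I_n -> bop H) (V : 'I_n -> bop H) : Prop := TwistedIsometry {
  twist_unitary : forall i j, i != j -> is_unitary (U i j);
  twist_star : forall i j, i != j -> U j i = star (U i j);
  twist_commute : forall i j k l, i != j -> k != l ->
    commutes (U i j) (U k l);
  twist_isometry : forall i, is_isometry (V i);
  twist_rel : forall i j, i != j ->
    mul (star (V i)) (V j) = mul (star (U i j)) (mul (V j) (star (V i)));
  twist_central : forall i j k, i != j -> commutes (V k) (U i j) }.

(* A nonzero irreducible representation of C*(V), for some twisted isometry V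
   on some Hilbert space. *)
Record twisted_irrep (R : realType) (n : nat) : Type := TwistedIrrep {
  tw_space : hilbertType R;
  tw_U : 'I_n -> 'I_n -> bop tw_space;
  tw_V : 'I_n -> bop tw_space;
  tw_twisted : twisted_isometry tw_U tw_V;
  tw_irrep : irrep (cstar_generated (range tw_V)) }.

Definition twisted_equiv (R : realType) (n : nat) (p q : twisted_irrep R n) :=
  exists2 Z : irrep_space (tw_irrep p) -> irrep_space (tw_irrep q),
    unitary_map Z &
    forall i, intertwines Z (tw_irrep p (tw_V p i)) (tw_irrep q (tw_V q i)).

(* Only the values u i with i \notin A and w j k with j != k matter. *)
Record torus_relations (R : realType) (n : nat) (A : {set 'I_n})
    (B : cstarType R) (u : 'I_n -> B) (w : 'I_n -> 'I_n -> B)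
    : Prop := TorusRelations {
  torus_u_unitary : forall i, i \notin A -> is_unitary (u i);
  torus_w_unitary : forall j k, j != k -> is_unitary (w j k);
  torus_w_star : forall j k, j != k -> w k j = star (w j k);
  torus_u_w : forall i j k, i \notin A -> j != k -> commutes (u i) (w j k);
  torus_u_u : forall i1 i2, i1 \notin A -> i2 \notin A -> i1 != i2 ->
    mul (u i1) (u i2) = mul (w i1 i2) (mul (u i2) (u i1));
  torus_w_w : forall j k l m, j != k -> l != m -> commutes (w j k) (w l m) }.

(* The models of the universal C*-algebra T_A; any two of them are isomorphic
   by an isomorphism preserving the generators. *)
Record twisted_torus (R : realType) (n : nat) (A : {set 'I_n}) : Type :=
    TwistedTorus {
  torus_alg :> cstarType R;
  torus_u : 'I_n -> torus_alg;
  torus_w : 'I_n -> 'I_n -> torus_alg;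
  torus_rel : torus_relations A torus_u torus_w;
  torus_generated :
    cstar_generated ([set torus_u i | i in [set i | i \notin A]] `|`
      [set torus_w jk.1 jk.2 | jk in [set jk | jk.1 != jk.2]]) = setT;
  torus_universal : forall (B : cstarType R) (u : 'I_n -> B)
      (w : 'I_n -> 'I_n -> B), torus_relations A u w ->
    exists f : torus_alg -> B, [/\ star_hom setT f,
      forall i, i \notin A -> f (torus_u i) = u i &
      forall j k, j != k -> f (torus_w j k) = w j k] }.

Section Parametrization.
Variables (R : realType) (n : nat).
Variable T : forall A : {set 'I_n}, twisted_torus R A.

(* A nonzero irreducible representation of one of the 2^n tori. *)
Record torus_irrep : Type := TorusIrrep {
  ti_set : {set 'I_n};
  ti_irrep : irrep [set: T ti_set] }.

Definition torus_equiv (p q : torus_irrep) :=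
  ti_set p = ti_set q /\
  exists Z : irrep_space (ti_irrep p) -> irrep_space (ti_irrep q),
    [/\ unitary_map Z,
      forall i, i \notin ti_set p ->
        intertwines Z (ti_irrep p (torus_u (T (ti_set p)) i))
                      (ti_irrep q (torus_u (T (ti_set q)) i)) &
      forall j k, j != k ->
        intertwines Z (ti_irrep p (torus_w (T (ti_set p)) j k))
                      (ti_irrep q (torus_w (T (ti_set q)) j k))].

Definition wandering_space (H : hilbertType R) (A : {set 'I_n})
  (V : 'I_n -> bop H) : set H := [set x | forall i, i \in A -> star (V i) x = 0].

(* The correspondence given by the Wold decomposition of pi(V): the pi(V_i)
   with i in A are shifts, the other ones are unitaries, and the restrictions
   of pi(V_i), i \notin A, and pi(U_jk) to the wandering subspace of
   (pi(V_i))_{i in A} are unitarily equivalent, through J, to the images of the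
   generators of T_A. *)
Definition wandering_data (p : twisted_irrep R n) (q : torus_irrep) :=
  let V i := tw_irrep p (tw_V p i) in
  let U j k := tw_irrep p (tw_U p j k) in
  let A := ti_set q in
  [/\ forall i, i \in A -> is_shift (V i),
    forall i, i \notin A -> is_unitary (V i) &
    exists J : irrep_space (ti_irrep q) -> irrep_space (tw_irrep p),
    [/\ isometric_map J, range J = wandering_space A V,
      forall i, i \notin A -> intertwines J (ti_irrep q (torus_u (T A) i)) (V i) &
      forall j k, j != k ->
        intertwines J (ti_irrep q (torus_w (T A) j k)) (U j k)]].

End Parametrization.

(* The set of equivalence classes.  The types of representations are too large
   for the universe of "set", whence the predicates. *)
Definition class_set (X : Type) (e : X -> X -> Prop) : Type :=
  {C : X -> Prop | exists x, C = e x}.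

Definition class_of (X : Type) (e : X -> X -> Prop) (x : X) : class_set e :=
  exist (fun C => exists x, C = e x) (e x) (ex_intro (fun y => e x = e y) x erefl).

(* Main.v *)
From HB Require Import structures.
From mathcomp Require Import all_boot all_order all_algebra.
From mathcomp Require Import complex.
From mathcomp Require Import all_classical all_reals topology normedtype.
From mathcomp Require Import ring lra.
Require Import Defs.
Import Order.TTheory GRing.Theory Num.Theory.
Import numFieldNormedType.Exports.
Local Open Scope classical_set_scope.
Local Open Scope ring_scope.
Set Implicit Arguments.
Unset Strict Implicit.
Unset Printing Implicit Defensive.

(** The theorem rests on a Wold decomposition.  Let V be a twisted isometry in an
    irreducible representation.  The relations let V_j and V_j^* pass through V_i
    up to a unitary that commutes with them, so the intersection of the
    ranges of the powers of V_i reduces all the V_j; hence every V_i is a shift or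
    a unitary (shift_or_unitary).  Let A be the set of the i such that V_i is a
    shift, and W the intersection of the kernels of the V_i^*, i in A.  It is
    nonzero (wandering_nonzero) and invariant under the U_jk and the unitaries V_i,
    i not in A, which satisfy on W the relations of the torus T_A; so T_A acts on W
    (torus_of_twisted).

    The inner products between vectors V_i1 ... V_ir w, with w in W and all indices
    in A, are computed from the relations and the action on W.  Two consequences
    follow.  A reducing subspace of W generates a reducing subspace of the whole
    space, so T_A acts irreducibly on W (wandering_irreducible).  A unitary between
    two wandering spaces extends to a unitary between the whole spaces, so the
    action on W determines the representation (unitary_extension).

    Conversely, let T_A act irreducibly on K.  Replacing K with the square summable
    sequences in K adjoins a shift to the system, whose wandering space is K, and
    the unitaries and the shifts already there remain such (ext_system, ext_unitary,
    ext_shift).  Doing so once for each element of A gives a twisted isometry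
    (dilation_exists), which is irreducible because every nonzero reducing subspace
    contains K (dilation_irreducible).

    In both directions reducing subspaces are only tested on generators.  This is
    legitimate because representations of C*-algebras are continuous (hom_bound),
    which follows from the existence of square roots of 1 - h for small selfadjoint
    h (sqrt_sub). *)

(** * Approximation, limits and completeness *)

Section Sequences.
Variables (R : realType) (V : normedModType R[i]).
Implicit Types (x y l : V) (u : nat -> V).

Definition seq_cauchy u := forall e : R, 0 < e ->
  exists N, forall m n, (N <= m)%N -> (N <= n)%N -> rnorm (u m - u n) < e.

Definition seq_limit u l := forall e : R, 0 < e ->
  exists N, forall n, (N <= n)%N -> rnorm (l - u n) < e.

Lemma rnorm_zero : rnorm (0 : V) = 0.
Proof. by rewrite /rnorm normr0. Qed.

Lemma rnormN x : rnorm (- x) = rnorm x.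
Proof. by rewrite /rnorm normrN. Qed.

Lemma gt0_complexE (e : R[i]) : 0 < e ->
  0 < complex.Re e /\ e = (complex.Re e)%:C%C.
Proof. by case: e => a b; rewrite ltcE /= => /andP[/eqP -> ?]. Qed.

(** Norms take their values in R[i]; closedness is used below through this
    criterion, which is stated with real numbers. *)
Lemma closed_approx (M : set V) : closed M <->
  forall x, (forall e : R, 0 < e -> exists2 y, M y & rnorm (x - y) < e) -> M x.
Proof.
split=> [cM x xM|h x xM].
  apply: cM => B /nbhs_ballP[e /= /gt0_complexE[e0 eE]].
  have [y My xy] := xM _ e0.
  move=> sub; exists y; split=> //; apply: sub.
  by rewrite -ball_normE /ball_/= rnormE eE ltcR.
apply: h => e e0.
have [|y [My]] := xM (ball x e%:C%C).
  by apply/nbhs_ballP; exists e%:C%C => //=; rewrite ltcR.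
by rewrite -ball_normE /ball_/= rnormE ltcR; exists y.
Qed.

Lemma inv_natP (e : R) : 0 < e -> exists N : nat, N.+1%:R^-1 < e.
Proof.
move=> e0; exists (Num.truncn e^-1).
rewrite invf_plt ?posrE//; exact: truncnS_gt.
Qed.

(** Sets of the filter of diameter less than 1 / (k + 1) contain the terms of a
    Cauchy sequence, whose limit is the limit of the filter.  Completeness of the
    spaces built below is thereby checked on sequences. *)
Lemma seq_complete_cvg :
    (forall u, seq_cauchy u -> exists l, seq_limit u l) ->
  forall F : set_system V, ProperFilter F -> cauchy F -> cvg F.
Proof.
move=> hc F FF Fc.
have FA (k : nat) : exists A : set V, F A /\
    forall x y, A x -> A y -> rnorm (x - y) < k.+1%:R^-1.
  have /cauchy_ballP/(_ (k.+1%:R^-1)%:C%C) := Fc.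
  rewrite ltcR invr_gt0 ltr0n => /(_ isT) [[A B] /= [FA FB] AB].
  exists (A `&` B); split; first exact: filterI.
  move=> x y [Ax _] [_ By]; have /= := AB (x, y) (conj Ax By).
  by rewrite -ball_normE /ball_/= rnormE ltcR.
have [A AP] := choice FA.
have FB n : F [set x | forall k, (k <= n)%N -> A k x].
  elim: n => [|n IH].
    by apply: filterS (AP 0%N).1 => x Ax k; rewrite leqn0 => /eqP ->.
  apply: filterS (filterI IH (AP n.+1).1) => x [h Ax] k.
  by rewrite leq_eqVlt => /orP[/eqP ->|/h].
have /choice[u uP] n : exists x, forall k, (k <= n)%N -> A k x.
  exact: filter_ex (FB n).
have uc m n N : (N <= m)%N -> (N <= n)%N -> rnorm (u m - u n) < N.+1%:R^-1.
  by move=> Nm Nn; apply: (AP N).2; exact: uP.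
have [l ul] : exists l, seq_limit u l.
  apply: hc => e /inv_natP[N Ne]; exists N => m n Nm Nn.
  exact: lt_trans (uc _ _ _ Nm Nn) Ne.
apply/cvg_ex; exists l => B /nbhs_ballP[e /= /gt0_complexE[e0 eE]] sub.
have e20 : 0 < complex.Re e / 2 by lra.
have [N Ne] := inv_natP e20; have [M Me] := ul _ e20.
apply: filterS (AP N).1 => x Ax; apply: sub.
rewrite -ball_normE /ball_/= rnormE eE ltcR.
have := rnormD (l - u (maxn M N)) (u (maxn M N) - x).
rewrite addrA subrK; have := Me _ (leq_maxl M N).
have := lt_trans ((AP N).2 _ _ (uP _ _ (leq_maxr M N)) Ax) Ne.
move=> h1 h2 /le_lt_trans; apply.
by rewrite (splitr (complex.Re e)) ltrD.
Qed.
End Sequences.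

Lemma complete_seq (R : realType) (V : completeNormedModType R[i]) (u : nat -> V) :
  seq_cauchy u -> exists l, seq_limit u l.
Proof.
move=> uc.
have : cauchy (u @ \oo).
  apply/cauchy_ballP => e /gt0_complexE[e0 eE].
  have [N NP] := uc _ e0.
  exists (u @` [set n | (N <= n)%N], u @` [set n | (N <= n)%N]).
    by split; exists N => // n /= Nn; exists n.
  move=> [_ _] /= [[m Nm <-] [k Nk <-]].
  by rewrite -ball_normE /ball_/= rnormE eE ltcR; exact: NP.
move/cauchy_cvg/cvg_ex => [l ul]; exists l => e e0.
have [|N _ NP] := ul (ball l e%:C%C).
  by apply/nbhs_ballP; exists e%:C%C => //=; rewrite ltcR.
exists N => k Nk; have := NP k Nk.
by rewrite /= -ball_normE /ball_/= rnormE ltcR.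
Qed.

(** * Closed subspaces as Hilbert spaces, and projections *)

Section Subspace.
Variables (R : realType) (H : hilbertType R) (M : set H).
Hypothesis cM : closed_subspace M.

Lemma subspace_closed : closed M. Proof. by case: cM. Qed.
Lemma subspace0 : M 0. Proof. by case: cM. Qed.
Lemma subspaceL k x y : M x -> M y -> M (k *: x + y).
Proof. by case: cM => _ _; apply. Qed.
Lemma subspaceD x y : M x -> M y -> M (x + y).
Proof. by rewrite -{2}(scale1r x); exact: subspaceL. Qed.
Lemma subspaceZ k x : M x -> M (k *: x).
Proof. by move=> Mx; rewrite -[_ *: _]addr0; apply: subspaceL => //; exact: subspace0. Qed.
Lemma subspaceN x : M x -> M (- x).
Proof. by rewrite -scaleN1r; exact: subspaceZ. Qed.
Lemma subspaceB x y : M x -> M y -> M (x - y).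
Proof. by move=> Mx My; apply: subspaceD => //; exact: subspaceN. Qed.

(** The proof that M is a closed subspace is a parameter of the type: the
    Hilbert structure can then be inferred from the type alone. *)
Record subspace_of (c : closed_subspace M) :=
  SubPoint { sub_elt :> H; sub_valP : M sub_elt }.
Local Notation subspace := (subspace_of cM).
Local Notation sub_val := (@sub_elt cM).
Local Notation Subspace := (@SubPoint cM _).

Lemma sub_val_inj : injective sub_val.
Proof.
case=> x Mx [y My] /= xy; subst y.
by rewrite (Prop_irrelevance Mx My).
Qed.

HB.instance Definition _ := gen_eqMixin subspace.
HB.instance Definition _ := gen_choiceMixin subspace.

Definition sub_zero := Subspace subspace0.
Definition sub_add (x y : subspace) := Subspace (subspaceD (sub_valP x) (sub_valP y)).
Definition sub_opp (x : subspace) := Subspace (subspaceN (sub_valP x)).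
Definition sub_scale k (x : subspace) := Subspace (subspaceZ k (sub_valP x)).

Fact sub_addA : associative sub_add.
Proof. by move=> x y z; apply: sub_val_inj; rewrite /= addrA. Qed.
Fact sub_addC : commutative sub_add.
Proof. by move=> x y; apply: sub_val_inj; rewrite /= addrC. Qed.
Fact sub_add0 : left_id sub_zero sub_add.
Proof. by move=> x; apply: sub_val_inj; rewrite /= add0r. Qed.
Fact sub_addN : left_inverse sub_zero sub_opp sub_add.
Proof. by move=> x; apply: sub_val_inj; rewrite /= addNr. Qed.

HB.instance Definition _ :=
  GRing.isZmodule.Build subspace sub_addA sub_addC sub_add0 sub_addN.

Fact sub_scaleA k l x : sub_scale k (sub_scale l x) = sub_scale (k * l) x.
Proof. by apply: sub_val_inj; rewrite /= scalerA. Qed.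
Fact sub_scale1 : left_id 1 sub_scale.
Proof. by move=> x; apply: sub_val_inj; rewrite /= scale1r. Qed.
Fact sub_scaleDr : right_distributive sub_scale +%R.
Proof. by move=> k x y; apply: sub_val_inj; rewrite /= scalerDr. Qed.
Fact sub_scaleDl x : {morph sub_scale^~ x : k l / k + l}.
Proof. by move=> k l; apply: sub_val_inj; rewrite /= scalerDl. Qed.

HB.instance Definition _ := GRing.Zmodule_isLmodule.Build R[i] subspace
  sub_scaleA sub_scale1 sub_scaleDr sub_scaleDl.

Definition sub_norm (x : subspace) : R[i] := `|sub_val x|.

Fact sub_normD x y : sub_norm (x + y) <= sub_norm x + sub_norm y.
Proof. exact: ler_normD. Qed.
Fact sub_normZ k x : sub_norm (k *: x) = `|k| * sub_norm x.
Proof. exact: normrZ. Qed.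
Fact sub_norm_eq0 x : sub_norm x = 0 -> x = 0.
Proof. by move=> /normr0_eq0 x0; apply: sub_val_inj. Qed.

HB.instance Definition _ := Lmodule_isNormed.Build R[i] subspace
  sub_normD sub_normZ sub_norm_eq0.

Lemma sub_rnorm (x : subspace) : rnorm x = rnorm (sub_val x).
Proof. by []. Qed.

Fact sub_cauchy_cvg (F : set_system subspace) :
  ProperFilter F -> cauchy F -> cvg F.
Proof.
apply: seq_complete_cvg => u uc.
have [l ul] : exists l, seq_limit (sub_val \o u) l by apply: complete_seq.
have Ml : M l.
  have := subspace_closed; rewrite closed_approx; apply => e /ul[N NP].
  by exists (sub_val (u N)); [exact: sub_valP|exact: NP].
by exists (Subspace Ml).
Qed.

HB.instance Definition _ := Uniform_isComplete.Build subspace sub_cauchy_cvg.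

Definition sub_inner (x y : subspace) := inner (sub_val x) (sub_val y).

Fact sub_inner_linearl z : linear_for *%R (sub_inner ^~ z).
Proof. by move=> k x y; rewrite /sub_inner innerDl innerZl. Qed.
Fact sub_innerC x y : sub_inner x y = (sub_inner y x)^*.
Proof. exact: innerC. Qed.
Fact sub_normr2E (x : subspace) : `|x| ^+ 2 = sub_inner x x.
Proof. exact: normr2E. Qed.

(** A dense set of H may miss M.  To a point d of it and to an integer k is
    attached some point of M at distance less than 1 / (k + 1) of d, if there is
    one; these points are dense in M. *)
Fact sub_separable : exists2 D : set subspace, countable D & dense D.
Proof.
have [D cD dD] := @separable_subproof R H.
have /choice[g gP] (dk : H * nat) : exists x : subspace,
    forall y : subspace, rnorm (dk.1 - sub_val y) < dk.2.+1%:R^-1 ->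
      rnorm (dk.1 - sub_val x) < dk.2.+1%:R^-1.
  have [[y ?]|h] := pselect (exists y : subspace, rnorm (dk.1 - sub_val y) < dk.2.+1%:R^-1).
    by exists y.
  by exists 0 => y ?; case: h; exists y.
exists (g @` (D `*` [set: nat])).
  apply: (@sub_countable _ _ _ (D `*` [set: nat])); first exact: card_image_le.
  by apply: countableX => //; exact: countableP.
move=> O [x Ox] oO.
have /nbhs_ballP[e /= /gt0_complexE[e0 eE] sub] : nbhs x O by exact: open_nbhs_nbhs.
have e20 : 0 < complex.Re e / 2 by lra.
have [N Ne] := inv_natP e20.
have [||d [/= xd Dd]] := dD (ball (sub_val x) (N.+1%:R^-1)%:C%C).
- by exists (sub_val x); apply: ballxx; rewrite ltcR invr_gt0.
- by apply: ball_open; rewrite ltcR invr_gt0.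
move: xd; rewrite -ball_normE /ball_/= rnormE ltcR => xd.
exists (g (d, N)); split; last by exists (d, N).
apply: sub; rewrite -ball_normE /ball_/= rnormE eE ltcR sub_rnorm/=.
have := gP (d, N) x; rewrite /= rnormB => /(_ xd) dg.
rewrite (_ : _ - _ = (sub_val x - d) + (d - sub_val (g (d, N)))); last first.
  by rewrite addrA subrK.
rewrite (le_lt_trans (rnormD _ _))// (splitr (complex.Re e)).
by rewrite ltrD// (lt_trans _ Ne).
Qed.

HB.instance Definition _ := isHilbert.Build R subspace
  sub_inner_linearl sub_innerC sub_normr2E sub_separable.

(** Riesz representation inside the Hilbert space M of the functional
    z |-> <z, x>. *)
Lemma projection_ex x : exists2 y, M y & forall z, M z -> inner (x - y) z = 0.
Proof.
pose f (z : subspace) := inner (sub_val z) x.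
have flin : linear_for *%R f by move=> k y z; rewrite /f innerDl innerZl.
have fM (z : subspace) : `|f z| <= (rnorm x)%:C%C * `|z|.
  by rewrite -rnormE mulrC; exact: cauchy_schwarz.
have [y fy] := riesz flin fM.
exists (sub_val y); first exact: sub_valP.
move=> z Mz; rewrite innerC innerBr.
by have := fy (Subspace Mz); rewrite /f/= => ->; rewrite subrr rmorph0.
Qed.

End Subspace.

(** * Automatic continuity of representations *)

Section CStarBasics.
Variables (R : realType) (A : cstarType R).
Implicit Types (x y z : A) (k : R[i]).

Lemma cmulDl x y z : mul (x + y) z = mul x z + mul y z.
Proof. by have := mul_linearl z 1 x y; rewrite !scale1r. Qed.

Lemma cmulDr x y z : mul x (y + z) = mul x y + mul x z.
Proof. by have := mul_linearr x 1 y z; rewrite !scale1r. Qed.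

Lemma cmulNl x y : mul (- x) y = - mul x y.
Proof.
have h0 : mul 0 y = 0.
  by have := cmulDl 0 0 y; rewrite addr0 => /(canLR (addKr _)) <-; rewrite addNr.
by apply/eqP; rewrite -addr_eq0 -cmulDl addNr h0.
Qed.

Lemma cmulNr x y : mul x (- y) = - mul x y.
Proof.
have h0 : mul x 0 = 0.
  by have := cmulDr x 0 0; rewrite addr0 => /(canLR (addKr _)) <-; rewrite addNr.
by apply/eqP; rewrite -addr_eq0 -cmulDr addNr h0.
Qed.

Lemma cstar0 : star (0 : A) = 0.
Proof. by apply: (addrI (star 0)); rewrite -starD !addr0. Qed.

Lemma cstarN x : star (- x) = - star x.
Proof. by rewrite -scaleN1r starZ rmorphN rmorph1 scaleN1r. Qed.

Lemma cstar_one : star one = one :> A.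
Proof. by rewrite -[LHS]mul1 -{1}(starK one) -starM mul1 starK. Qed.

Lemma rnormD_cstar x y : rnorm (x + y : A) <= rnorm x + rnorm y.
Proof. exact: rnormD. Qed.

Lemma rnormB_cstar x y : rnorm (x - y : A) = rnorm (y - x : A).
Proof. exact: rnormB. Qed.

Lemma rnormN_cstar x : rnorm (- x : A) = rnorm x.
Proof. exact: rnormN. Qed.

Lemma rnorm_mul x y : rnorm (mul x y) <= rnorm x * rnorm y.
Proof. by rewrite -lecR rmorphM/= -!rnormE norm_mul. Qed.

Lemma rnorm_starmul x : rnorm (mul (star x) x) = rnorm x ^+ 2.
Proof. by apply: (@complexI R); rewrite rmorphXn/= -!rnormE norm_star_mul. Qed.

Lemma rnorm_star x : rnorm (star x) = rnorm x.
Proof.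
suff h y : rnorm y <= rnorm (star y).
  by apply/eqP; rewrite eq_le h -{2}(starK x) h.
have [->|y0] := eqVneq (rnorm y) 0; first exact: rnorm_ge0.
have y1 : 0 < rnorm y by rewrite lt_def y0 rnorm_ge0.
rewrite -(ler_pM2r y1) -expr2 -rnorm_starmul; exact: rnorm_mul.
Qed.

Section SquareRoot.
Variables (S : set A) (h : A).
Hypotheses (Ssub : cstar_subalgebra S) (Sh : S h).
Hypotheses (hstar : star h = h) (hle : rnorm h <= 3 / 4).

Let step c : A := 2^-1 *: (h + mul c c).

Let half (x : A) : rnorm (2^-1 *: x) = 2^-1 * rnorm x.
Proof.
apply: (@complexI R); rewrite rmorphM/= -!rnormE normrZ; congr (_ * _).
by rewrite ger0_norm ?invr_ge0// fmorphV/= rmorph_nat.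
Qed.

Let stepB c d : rnorm c <= 2^-1 -> rnorm d <= 2^-1 ->
  rnorm (step c - step d) <= 2^-1 * rnorm (c - d).
Proof.
move=> c1 d1; rewrite /step -scalerBr half ler_pM2l ?invr_gt0//.
rewrite opprD addrACA subrr add0r.
have -> : mul c c - mul d d = mul (c - d) c + mul d (c - d).
  by rewrite cmulDl cmulDr cmulNl cmulNr addrA subrK.
have := rnormD_cstar (mul (c - d) c) (mul d (c - d)).
have := rnorm_mul (c - d) c; have := rnorm_mul d (c - d).
have := rnorm_ge0 (c - d); nra.
Qed.

Let step_le c : rnorm c <= 2^-1 -> rnorm (step c) <= 2^-1.
Proof.
move=> c1; rewrite /step half; have := rnormD_cstar h (mul c c).
have := rnorm_mul c c; have c0 := rnorm_ge0 c; have := ler_pM c0 c0 c1 c1.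
move: hle; lra.
Qed.

(** The element c = 1 - b solves b ^ 2 = 1 - h when it is a fixed point of
    c |-> (h + c ^ 2) / 2.  This map sends the ball of radius 1/2 to itself and
    halves the distances there, and it preserves S and selfadjointness. *)
Lemma sqrt_sub : exists b, [/\ S b, star b = b & mul b b = one - h].
Proof.
pose c n := iter n step 0.
have S0 : S 0.
  have := csub_linear Ssub (-1) (csub_one Ssub) (csub_one Ssub).
  by rewrite scaleN1r addNr.
have cS n : S (c n).
  elim: n => [|n IH] //=; rewrite /step.
  rewrite -[_ *: _]addr0; apply: csub_linear => //.
  by rewrite -[h]scale1r; apply: csub_linear => //; apply: csub_mul.
have cstar n : star (c n) = c n.
  elim: n => [|n IH]; first exact: cstar0.
  rewrite /= -/(c n) /step starZ starD starM hstar IH; congr (_ *: _).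
  by rewrite fmorphV/= rmorph_nat.
have cle n : rnorm (c n) <= 2^-1.
  elim: n => [|n IH]; last exact: step_le.
  by rewrite rnorm_zero invr_ge0.
have cc N m n : (N <= m)%N -> (N <= n)%N -> rnorm (c m - c n) <= 2^-1 ^+ N.
  elim: N m n => [|N IH] m n.
    rewrite expr0 => _ _; have := rnormD_cstar (c m) (- c n).
    rewrite rnormN_cstar; have := cle m; have := cle n; lra.
  case: m n => [|m] [|n]// Nm Nn; rewrite exprS.
  apply: le_trans (stepB (cle _) (cle _)) _.
  by rewrite ler_pM2l ?invr_gt0// IH.
have geo (e : R) : 0 < e -> exists N, 2^-1 ^+ N < e.
  move=> /inv_natP[N Ne]; exists N.+1; apply: lt_trans Ne.
  rewrite exprVn ltf_pV2 ?posrE ?exprn_gt0// -natrX ltr_nat.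
  exact: ltn_expl.
have [l cl] : exists l, seq_limit c l.
  apply: complete_seq => e /geo[N Ne]; exists N => m n Nm Nn.
  exact: le_lt_trans (cc _ _ _ Nm Nn) Ne.
have lS : S l.
  have := csub_closed Ssub; rewrite closed_approx; apply => e /cl[N NP].
  by exists (c N) => //; exact: NP.
have small x : (forall e : R, 0 < e -> rnorm x <= e) -> x = 0.
  move=> hx; apply: rnorm_eq0; apply/eqP; rewrite eq_le rnorm_ge0 andbT.
  by apply/ler_addgt0Pl => e e0; rewrite addr0 hx.
have lstar : star l = l.
  apply/eqP; rewrite -subr_eq0; apply/eqP; apply: small => e e0.
  have e20 : 0 < e / 2 by lra.
  have [N NP] := cl _ e20; have := NP N (leqnn _).
  have -> : star l - l = star (l - c N) - (l - c N).
    by rewrite starD cstarN cstar opprB addrA subrK.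
  by have := rnormD_cstar (star (l - c N)) (- (l - c N)); rewrite rnormN_cstar rnorm_star; lra.
have lle : rnorm l <= 2^-1.
  apply/ler_addgt0Pl => e e0; have [N NP] := cl _ e0; have := NP N (leqnn _).
  have := rnormD_cstar (l - c N) (c N); rewrite subrK; have := cle N; lra.
have lfix : l = step l.
  apply/eqP; rewrite -subr_eq0; apply/eqP; apply: small => e e0.
  have e20 : 0 < e / 2 by lra.
  have [N NP] := cl _ e20; have h1 := NP N (leqnn _); have h2 := NP N.+1 (leqnSn _).
  have -> : l - step l = (l - c N.+1) + (step (c N) - step l).
    by rewrite /= -/(c N) addrA subrK.
  have := rnormD_cstar (l - c N.+1) (step (c N) - step l).
  have := stepB (cle N) lle; rewrite (rnormB_cstar (c N)); have := rnorm_ge0 (l - c N); lra.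
have hl : mul l l = 2 *: l - h.
  rewrite [in RHS]lfix /step scalerA divff ?pnatr_eq0// scale1r.
  by rewrite addrAC subrr add0r.
exists (one - l); split.
- by rewrite -(scaleN1r l) addrC; apply: csub_linear => //; exact: csub_one.
- by rewrite starD cstarN lstar cstar_one.
- rewrite cmulDl mul1 cmulNl cmulDr mulx1 cmulNr hl opprB scaler_nat mulr2n.
  by rewrite (addrAC (l + l)) addrK addrA subrK.
Qed.
End SquareRoot.
End CStarBasics.

Section AutomaticContinuity.
Variables (R : realType) (A : cstarType R) (S : set A) (K : hilbertType R).
Variable f : A -> bop K.
Hypotheses (Ssub : cstar_subalgebra S) (fhom : star_hom S f).

Lemma csub0 : S 0.
Proof.
have := csub_linear Ssub (-1) (csub_one Ssub) (csub_one Ssub).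
by rewrite scaleN1r addNr.
Qed.

Lemma csubZ k a : S a -> S (k *: a).
Proof. by move=> Sa; rewrite -[_ *: _]addr0; apply: csub_linear Sa csub0. Qed.

Lemma csubB a b : S a -> S b -> S (a - b).
Proof. by move=> Sa Sb; rewrite -scaleN1r addrC; apply: csub_linear. Qed.

Lemma homB a b : S a -> S b -> f (a - b) = f a - f b.
Proof.
move=> Sa Sb; rewrite -scaleN1r addrC (hom_linear fhom)// scaleN1r addrC.
by [].
Qed.

Lemma homZ k a : S a -> f (k *: a) = k *: f a.
Proof.
move=> Sa; have f0 : f 0 = 0 by rewrite -(subrr a) homB// subrr.
by rewrite -[k *: a]addr0 (hom_linear fhom) ?f0 ?addr0//; exact: csub0.
Qed.

(** The element h = a^* a has norm at most 1/4, so 1 - h = b ^ 2 with b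
    selfadjoint, and |x|^2 - |f a x|^2 = <f (1 - h) x, x> = |f b x|^2 >= 0. *)
Lemma hom_contract a x : S a -> rnorm a <= 2^-1 -> rnorm (f a x) <= rnorm x.
Proof.
move=> Sa a1; pose h := mul (star a) a.
have Ss : S (star a) by exact: csub_star.
have Sh : S h by exact: csub_mul.
have hs : star h = h by rewrite starM starK.
have hle : rnorm h <= 3 / 4 by rewrite rnorm_starmul; have := rnorm_ge0 a; nra.
have [b [Sb bs bb]] := sqrt_sub Ssub Sh hs hle.
have e1 : inner (f h x) x = inner (f a x) (f a x).
  by rewrite (hom_mul fhom)// (hom_star fhom)// [LHS]innerC -bop_starP -innerC.
have e2 : inner (f (mul b b) x) x = inner (f b x) (f b x).
  rewrite (hom_mul fhom)//= bop_starP; congr inner.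
  have -> : bop_star (f b) = star (f b) by [].
  by rewrite -(hom_star fhom)// bs.
have : 0 <= inner (f b x) (f b x) by rewrite -normr2E exprn_ge0.
rewrite -e2 bb homB//; last exact: csub_one.
rewrite bop_subE innerBl (hom_one fhom) e1 -!normr2E subr_ge0.
rewrite ler_pXn2r ?nnegrE// !rnormE lecR; exact.
Qed.

(** Representations are continuous: this is the previous bound, rescaled.  The
    constant 2 comes from the radius 1/2 and could be improved to 1. *)
Lemma hom_bound a x : S a -> rnorm (f a x) <= 2 * rnorm a * rnorm x.
Proof.
move=> Sa; have [a0|a0] := eqVneq (rnorm a) 0.
  rewrite (rnorm_eq0 a0) (_ : f 0 = 0); last by rewrite -(subrr a) homB// subrr.
  by rewrite bop_zeroE !rnorm_zero mulr0 mul0r.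
have a1 : 0 < rnorm a by rewrite lt_def a0 rnorm_ge0.
pose k := ((2 * rnorm a)^-1)%:C%C : R[i].
have a2 : 0 < 2 * rnorm a by lra.
have kE : complex.Re `|k| = (2 * rnorm a)^-1.
  by rewrite ger0_norm// ler0c invr_ge0 ltW.
have ka : rnorm (k *: a) = 2^-1.
  apply: (@complexI R); rewrite -rnormE normrZ rnormE ger0_norm ?ler0c ?invr_ge0 ?ltW//.
  by rewrite -rmorphM/=; congr (_%:C%C); rewrite invfM -mulrA mulVf// mulr1.
have := @hom_contract (k *: a) x (csubZ _ Sa); rewrite ka lexx => /(_ isT).
by rewrite homZ// bop_scaleE rnormZ kE ler_pdivrMl.
Qed.

End AutomaticContinuity.

Section Generation.
Variables (R : realType) (A : cstarType R) (G : set A) (K : hilbertType R).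

Lemma generated_subalgebra : cstar_subalgebra (cstar_generated G).
Proof.
split.
- by apply: closed_bigI => B [? _]; exact: csub_closed.
- by move=> B [? _]; exact: csub_one.
- move=> k x y Sx Sy B [cB GB].
  by apply: (csub_linear cB k); [exact: Sx|exact: Sy].
- by move=> x y Sx Sy B [cB GB]; apply: (csub_mul cB); [exact: Sx|exact: Sy].
- by move=> x Sx B [cB GB]; apply: (csub_star cB); exact: Sx.
Qed.

Lemma generated_in a : G a -> cstar_generated G a.
Proof. by move=> Ga B [_]; apply. Qed.

(** Reducing subspaces are tested on generators, since the elements whose image
    M reduces form a C*-subalgebra.  It is closed because f is continuous. *)
Lemma generated_reduces (f : A -> bop K) (M : set K) :
    star_hom (cstar_generated G) f -> closed_subspace M ->
    (forall a, G a -> reduces M (f a)) ->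
  forall a, cstar_generated G a -> reduces M (f a).
Proof.
move=> fhom cM Gred.
have Ssub := generated_subalgebra.
set S := cstar_generated G in fhom Ssub *.
suff : S `<=` [set a | S a /\ reduces M (f a)] by move=> h a /h[].
apply: smallest_sub; last by move=> a Ga; split; [exact: generated_in|exact: Gred].
split.
- apply/closed_approx => a aP.
  have Sa : S a.
    have := csub_closed Ssub; rewrite closed_approx; apply => e /aP[b [Sb _] ab].
    by exists b.
  split=> // x Mx; have Mcl := subspace_closed cM; rewrite closed_approx in Mcl.
  have key (g : A -> bop K) :
      (forall b, S b -> rnorm (g a x - g b x) <= 2 * rnorm (a - b) * rnorm x) ->
      (forall b, S b -> reduces M (f b) -> M (g b x)) -> M (g a x).
    move=> gle gM; apply: Mcl => e e0.
    have x0 : 0 < 2 * rnorm x + 1 by have := rnorm_ge0 x; lra.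
    have [b [Sb bred]] := aP _ (divr_gt0 e0 x0).
    rewrite ltr_pdivlMr// => ab; exists (g b x); first exact: gM.
    apply: le_lt_trans (gle _ Sb) _; have := rnorm_ge0 (a - b).
    have := rnorm_ge0 x; nra.
  split.
    apply: (key f) => b Sb; last by move=> /(_ _ Mx)[].
    by rewrite -bop_subE -(homB fhom)//; apply: (hom_bound Ssub) => //; exact: (csubB Ssub).
  apply: (key (fun b => star (f b))) => b Sb; last by move=> /(_ _ Mx)[].
  rewrite -!(hom_star fhom)// -bop_subE -(homB fhom)//; try exact: (csub_star Ssub).
  rewrite -(rnorm_star (a - b)) starD cstarN.
  apply: (hom_bound Ssub) => //; apply: (csubB Ssub) => //; exact: (csub_star Ssub).
- split; first exact: (csub_one Ssub).
  by rewrite (hom_one fhom) => x Mx; split=> //; rewrite cstar_one.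
- move=> k a b [Sa ra] [Sb rb]; split; first exact: (csub_linear Ssub k).
  rewrite (hom_linear fhom k)// => x Mx; have [ax ax'] := ra _ Mx.
  have [bx bx'] := rb _ Mx; split; first exact: (subspaceL cM).
  by rewrite starD starZ; exact: (subspaceL cM).
- move=> a b [Sa ra] [Sb rb]; split; first exact: (csub_mul Ssub).
  rewrite (hom_mul fhom)// => x Mx; split.
    exact: (ra _ (rb _ Mx).1).1.
  by rewrite starM; exact: (rb _ (ra _ Mx).2).2.
- move=> a [Sa ra]; split; first exact: (csub_star Ssub).
  by rewrite (hom_star fhom)// => x Mx; rewrite starK; have [] := ra _ Mx.
Qed.
End Generation.

(** * Systems of twisted isometries *)

Section ClosedSubspaces.
Variables (R : realType) (H K : hilbertType R).
Implicit Types (M : set H) (T : bop H).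

Lemma rnormD_hilbert (x y : H) : rnorm (x + y : H) <= rnorm x + rnorm y.
Proof. exact: rnormD. Qed.

Lemma closed_subspace_zero : closed_subspace [set (0 : H)].
Proof.
split=> //; last by move=> k x y /= -> ->; rewrite scaler0 addr0.
apply/closed_approx => x xP; apply: rnorm_eq0; apply/eqP.
rewrite eq_le rnorm_ge0 andbT; apply/ler_addgt0Pl => e /xP[y /= ->].
by rewrite subr0 addr0 => /ltW.
Qed.

Lemma closed_subspace_forall (I : Type) (F : I -> set H) :
  (forall i, closed_subspace (F i)) -> closed_subspace [set x | forall i, F i x].
Proof.
move=> cF; split.
- apply/closed_approx => x xP i; have := subspace_closed (cF i).
  by rewrite closed_approx; apply => e /xP[y Fy xy]; exists y.
- by move=> i; exact: subspace0 (cF i).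
- by move=> k x y Fx Fy i; exact: (subspaceL (cF i)).
Qed.

Lemma closed_subspace_imply (P : Prop) M :
  (P -> closed_subspace M) -> closed_subspace [set x | P -> M x].
Proof.
move=> cM; split.
- apply/closed_approx => x xP p; have := subspace_closed (cM p).
  by rewrite closed_approx; apply => e /xP[y Fy xy]; exists y => //; exact: Fy.
- by move=> p; exact: subspace0 (cM p).
- by move=> k x y Fx Fy p; apply: (subspaceL (cM p)); [exact: Fx|exact: Fy].
Qed.

Lemma closed_subspace_preimage_lipschitz (f : H -> K) (C : R) (M : set K) :
    linear f -> (forall x, rnorm (f x) <= C * rnorm x) ->
  closed_subspace M -> closed_subspace [set x | M (f x)].
Proof.
move=> fl fC cM.
have f0 : f 0 = 0 by have := fl (-1) 0 0; rewrite scaler0 addr0 scaleN1r addNr.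
have fB x y : f (x - y) = f x - f y.
  have := fl 1 x (- y); rewrite !scale1r => ->; congr (_ + _).
  by have := fl (-1) y 0; rewrite !scaleN1r f0 !addr0.
split.
- apply/closed_approx => x xP /=; have := subspace_closed cM; rewrite closed_approx.
  apply => e e0; pose D := Num.max C 0.
  have D0 : 0 <= D by rewrite le_max lexx orbT.
  have CD : C <= D by rewrite le_max lexx.
  have [y /= My xy] := xP _ (divr_gt0 e0 (ltr_wpDl D0 ltr01)).
  exists (f y) => //; rewrite -fB; apply: le_lt_trans (fC _) _.
  move: xy; rewrite ltr_pdivlMr; last by lra.
  by have := rnorm_ge0 (x - y); nra.
- by rewrite /= f0; exact: subspace0.
- by move=> k x y /= Mx My; rewrite fl; exact: (subspaceL cM).
Qed.

End ClosedSubspaces.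

Section ClosedSubspacesOps.
Variables (R : realType) (H : hilbertType R).
Implicit Types (M : set H) (T S : bop H).

Lemma closed_subspace_preimage T M : closed_subspace M -> closed_subspace [set x | M (T x)].
Proof. exact: (closed_subspace_preimage_lipschitz (bop_linear T) (opnorm_bound T)). Qed.

Lemma closed_subspace_kernel T : closed_subspace [set x | T x = 0].
Proof. by apply: (@closed_subspace_preimage T [set 0]); exact: closed_subspace_zero. Qed.

Lemma closed_subspace_equalizer T S : closed_subspace [set x | T x = S x].
Proof.
rewrite (_ : [set x | _] = [set x | (T - S) x = 0]); first exact: closed_subspace_kernel.
apply/seteqP; split=> x /=; rewrite scaleN1r; first by move=> ->; rewrite subrr.
by move=> /eqP; rewrite subr_eq0 => /eqP.
Qed.

Lemma closed_subspace_perp (S : set H) : closed_subspace [set x | forall a, S a -> inner x a = 0].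
Proof.
apply: closed_subspace_forall => a; apply: closed_subspace_imply => _; split.
- apply/closed_approx => x xP /=; apply/eqP; rewrite -normr_le0.
  apply/ler_addgt0Pl => e; rewrite addr0 => /gt0_complexE[e0 eE].
  have a1 : 0 < rnorm a + 1 by have := rnorm_ge0 a; lra.
  have [y /= ya] := xP _ (divr_gt0 e0 a1).
  rewrite ltr_pdivlMr// => xy.
  rewrite -[X in inner X a](subrK y) innerDl ya addr0.
  apply: le_trans (cauchy_schwarz _ _) _; rewrite !rnormE -rmorphM/= eE lecR.
  have := rnorm_ge0 (x - y); lra.
- by rewrite /= inner0l.
- by move=> k x y /= x0 y0; rewrite innerDl innerZl x0 y0 mulr0 addr0.
Qed.

Lemma inner_starl T x y : inner (T x) y = inner x (star T y).
Proof. exact: bop_starP. Qed.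

Lemma inner_starr T x y : inner x (T y) = inner (star T x) y.
Proof. by rewrite innerC inner_starl -innerC. Qed.

Lemma inner_perpC (x y : H) : inner x y = 0 -> inner y x = 0.
Proof. by move=> h; rewrite innerC h rmorph0. Qed.

Lemma inner_self_eq0 (x : H) : inner x x = 0 -> x = 0.
Proof.
by rewrite -normr2E => /eqP; rewrite sqrf_eq0 normr_eq0 => /eqP.
Qed.

Lemma perp_complement (L M : set H) : closed_subspace M -> closed_subspace L ->
    M `<=` L -> (forall x, L x -> (forall z, M z -> inner x z = 0) -> x = 0) ->
  M = L.
Proof.
move=> cM cL ML h; apply/seteqP; split=> // x Lx.
have [y My yP] := projection_ex cM x.
have /eqP : x - y = 0 by apply: h => //; apply: (subspaceB cL) => //; exact: ML.
by rewrite subr_eq0 => /eqP ->.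
Qed.

Lemma isometryP T : is_isometry T -> forall x, star T (T x) = x.
Proof. by move=> h x; rewrite -[star T (T x)]/((mul (star T) T : bop H) x) h. Qed.

Lemma unitaryP T : is_unitary T ->
  (forall x, star T (T x) = x) /\ (forall x, T (star T x) = x).
Proof.
move=> [h1 h2]; split; first exact: isometryP.
by move=> x; rewrite -[T _]/((mul T (star T) : bop H) x) h2.
Qed.

Lemma unitary_intro T : (forall x, star T (T x) = x) ->
  (forall x, T (star T x) = x) -> is_unitary T.
Proof. by move=> h1 h2; split; apply: bopP => x; [exact: h1|exact: h2]. Qed.

Lemma isometry_inner T : is_isometry T -> forall x y, inner (T x) (T y) = inner x y.
Proof. by move=> h x y; rewrite inner_starl isometryP. Qed.

Lemma isometry_range_iter T m : is_isometry T ->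
  range (iter m T) = [set x | iter m T (iter m (star T) x) = x].
Proof.
move=> hT; apply/seteqP; split=> [_ [y _ <-]|x /= <-]; last by exists (iter m (star T) x).
move=> /=; congr (iter m T _); elim: m y => [|m IH] y //.
by rewrite iterSr [iter m.+1 T y]/= isometryP.
Qed.

Lemma iter_bop T m : exists S : bop H, S =1 iter m T.
Proof.
elim: m => [|m [S SE]]; first by exists (bop_one H).
by exists (bop_mul T S) => x /=; rewrite SE.
Qed.

Lemma unitary_part_closed T : is_isometry T ->
  closed_subspace (\bigcap_(m in [set: nat]) range (iter m T)).
Proof.
move=> hT.
rewrite (_ : bigcap _ _ = [set x | forall m, iter m T (iter m (star T) x) = x]).
  apply: closed_subspace_forall => m; have [S SE] := iter_bop T m.
  have [S' SE'] := iter_bop (star T) m.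
  change (closed_subspace [set x | iter m T (iter m (star T) x) = x]).
  rewrite (_ : [set x | _] = [set x | bop_mul S S' x = bop_one H x]).
    exact: closed_subspace_equalizer.
  by apply/seteqP; split=> x /=; rewrite SE SE'.
apply/seteqP; split=> x /= h m; first by have := h m I; rewrite isometry_range_iter.
by move=> _; rewrite isometry_range_iter //; exact: h.
Qed.

End ClosedSubspacesOps.

Section TwistedSystem.
Variables (R : realType) (n : nat) (H : hilbertType R).

(** The isometries are indexed by D only, so that shifts can be adjoined to a
    system one at a time; a twisted isometry is the case where D is full. *)
Record twisted_system (D : {set 'I_n}) (U : 'I_n -> 'I_n -> bop H)
    (V : 'I_n -> bop H) : Prop := TwistedSystem {
  ts_unitary : forall i j, i != j -> is_unitary (U i j);
  ts_star : forall i j, i != j -> U j i = star (U i j);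
  ts_commute : forall i j k l, i != j -> k != l -> commutes (U i j) (U k l);
  ts_isometry : forall i, i \in D -> is_isometry (V i);
  ts_rel : forall i j, i \in D -> j \in D -> i != j ->
    mul (star (V i)) (V j) = mul (star (U i j)) (mul (V j) (star (V i)));
  ts_central : forall i j k, k \in D -> i != j -> commutes (V k) (U i j) }.

Variables (D : {set 'I_n}) (U : 'I_n -> 'I_n -> bop H) (V : 'I_n -> bop H).
Hypothesis ts : twisted_system D U V.
Implicit Types (x y : H) (i j k l : 'I_n).

Lemma VsV i x : i \in D -> star (V i) (V i x) = x.
Proof. by move=> iD; exact: isometryP (ts_isometry ts iD) x. Qed.

Lemma UsU i j x : i != j -> star (U i j) (U i j x) = x.
Proof. by move=> ij; have [h _] := unitaryP (ts_unitary ts ij). Qed.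

Lemma UUs i j x : i != j -> U i j (star (U i j) x) = x.
Proof. by move=> ij; have [_ h] := unitaryP (ts_unitary ts ij). Qed.

Lemma Ustar i j x : i != j -> star (U i j) x = U j i x.
Proof. by move=> ij; rewrite (ts_star ts ij). Qed.

Lemma UU i j k l x : i != j -> k != l -> U i j (U k l x) = U k l (U i j x).
Proof.
move=> ij kl; have /(congr1 (fun T : bop H => T x)) := ts_commute ts ij kl.
by [].
Qed.

Lemma UV i j k x : k \in D -> i != j -> U i j (V k x) = V k (U i j x).
Proof.
move=> kD ij; have /(congr1 (fun T : bop H => T x)) := ts_central ts kD ij.
by move=> /= <-.
Qed.

(** U i j ^* is U j i, which commutes with V k: take adjoints. *)
Lemma UVs i j k x : k \in D -> i != j -> U i j (star (V k) x) = star (V k) (U i j x).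
Proof.
move=> kD ij; have ji : j != i by rewrite eq_sym.
apply: inner_eq => z; rewrite -inner_starl -[LHS]/(inner z (U i j (star (V k) x))).
have e w y : inner w (U i j y) = inner (U j i w) y.
  by rewrite inner_starr Ustar.
by rewrite !e -inner_starl UV.
Qed.

Lemma VsVj i j x : i \in D -> j \in D -> i != j ->
  star (V i) (V j x) = U j i (V j (star (V i) x)).
Proof.
move=> iD jD ij; rewrite -(Ustar _ ij).
by have /(congr1 (fun T : bop H => T x)) := ts_rel ts iD jD ij.
Qed.

(** Both sides are isometric functions of x, and their inner product is <x, x>:
    the square of the norm of their difference is therefore 0. *)
Lemma VV i j x : i \in D -> j \in D -> i != j -> V i (V j x) = U i j (V j (V i x)).
Proof.
move=> iD jD ij; have ji : j != i by rewrite eq_sym.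
have n1 y z : inner (V i (V j y)) (V i (V j z)) = inner y z.
  by rewrite !inner_starl !VsV.
have n2 y z : inner (U i j (V j (V i y))) (U i j (V j (V i z))) = inner y z.
  by rewrite inner_starl UsU// !inner_starl !VsV.
have n3 y z : inner (V i (V j y)) (U i j (V j (V i z))) = inner y z.
  rewrite inner_starl -UVs// VsVj// VsV// -(Ustar _ ij) UUs// inner_starl VsV//.
apply/eqP; rewrite -subr_eq0; apply/eqP; apply: inner_self_eq0.
rewrite innerBl !innerBr n1 n2 n3 (innerC (U i j _)) n3 -innerC subrr.
by rewrite ?subrr ?subr0 ?oppr0 ?addr0.
Qed.

Lemma VsVs i j x : i \in D -> j \in D -> i != j ->
  star (V i) (star (V j) x) = U i j (star (V j) (star (V i) x)).
Proof.
move=> iD jD ij; have ji : j != i by rewrite eq_sym.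
apply: inner_eq => z; rewrite -!inner_starl.
have e w y : inner w (U i j y) = inner (U j i w) y by rewrite inner_starr Ustar.
by rewrite e -!inner_starl -!UV// -VV.
Qed.

(** For i <> k both V i and its adjoint pass through V k up to a unitary which
    commutes with V k, hence they preserve the range of every power of V k. *)
Lemma unitary_part_reduces k : k \in D -> forall i, i \in D ->
  reduces (\bigcap_(m in [set: nat]) range (iter m (V k))) (V i).
Proof.
move=> kD i iD; have [->|ik] := eqVneq i k.
  move=> x h; split=> m _.
    by have [y _ <-] := h m I; exists (V k y) => //; rewrite -iterSr.
  by have [y _ <-] := h m.+1 I; exists y => //=; rewrite VsV.
have ki : k != i by rewrite eq_sym.
have key (f : H -> H) a b : a != b ->
    (forall x, f (V k x) = U a b (V k (f x))) -> 
    forall m x, range (iter m (V k)) x -> range (iter m (V k)) (f x).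
  move=> ab fP m _ [y _ <-].
  elim: m y => [|m IH] y; first by exists (f y).
  have [z _ zE] := IH y; exists (U a b z) => //=.
  rewrite fP -zE UV//; congr (V k _).
  by elim: (m) => [|p IHp] //=; rewrite UV// IHp.
move=> x h; split=> m _; have hm := h m I.
  by apply: (key (V i) i k) hm => // y; rewrite VV.
by apply: (key (star (V i)) k i) hm => // y; rewrite VsVj.
Qed.

(** If V V^* fixed V^*^m x for every m, then x = V^m V^*^m x would lie in the
    range of every power of the shift V. *)
Lemma shift_defect i x : i \in D -> is_shift (V i) -> x != 0 ->
  exists m, iter m (star (V i)) x != V i (star (V i) (iter m (star (V i)) x)).
Proof.
move=> iD [_ sh] /eqP x0; apply: contrapT => h; apply: x0.
have {}h m : iter m (star (V i)) x = V i (iter m.+1 (star (V i)) x).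
  apply: contrapT => /eqP h'; apply: h; by exists m.
suff : (\bigcap_(m in [set: nat]) range (iter m (V i))) x by rewrite sh.
move=> m _; exists (iter m (star (V i)) x) => //.
by elim: m => [|m IH] //; rewrite iterSr -h.
Qed.

(** The indices j of A are treated in turn: a nonzero vector is replaced with its
    image by (1 - V j V j^* ) V j^*^m, where m is such that this image is nonzero.
    This kills it under V j^*, and the kernels reached before are preserved,
    since V i^* commutes with V j and V j^* up to unitaries when i <> j. *)
Lemma wandering_nonzero (A : {set 'I_n}) (M : set H) x :
    A \subset D -> (forall i, i \in A -> is_shift (V i)) ->
    (forall y z, M y -> M z -> M (y - z)) ->
    (forall i, i \in A -> reduces M (V i)) -> M x -> x != 0 ->
  exists y, [/\ M y, y != 0 & forall i, i \in A -> star (V i) y = 0].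
Proof.
move=> AD sh MB Mred Mx x0.
suff h (s : seq 'I_n) : {subset s <= A} ->
    exists y, [/\ M y, y != 0 & forall i, i \in s -> star (V i) y = 0].
  have [|y [My y0 yP]] := h (enum A); first by move=> i; rewrite mem_enum.
  by exists y; split=> // i iA; apply: yP; rewrite mem_enum.
elim: s => [|j s IH] sA; first by exists x.
have [|y [My y0 yP]] := IH; first by move=> i si; apply: sA; rewrite inE si orbT.
have [js|js] := boolP (j \in s).
  by exists y; split=> // i; rewrite inE => /orP[/eqP ->|]; exact: yP.
have jA : j \in A by apply: sA; rewrite inE eqxx.
have jD := fintype.subsetP AD _ jA.
have [m] := shift_defect jD (sh _ jA) y0.
set z := iter m _ y => zP.
have Mz : M z by rewrite /z; elim: (m) => [|p Mp] //=; exact: (Mred _ jA _ Mp).2.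
have zs i : i \in s -> star (V i) z = 0.
  move=> si; rewrite /z; have iD : i \in D.
    by apply: (fintype.subsetP AD); apply: sA; rewrite inE si orbT.
  have ij : i != j by apply: contraNneq js => <-.
  elim: (m) => [|p IHp] /=; first exact: yP.
  by rewrite VsVs// IHp !bop0.
exists (z - V j (star (V j) z)); split.
- by apply: MB => //; exact: (Mred _ jA _ (Mred _ jA _ Mz).2).1.
- by rewrite subr_eq0.
- move=> i; rewrite inE => /orP[/eqP ->|si].
    by rewrite bopB VsV// subrr.
  have iD : i \in D.
    by apply: (fintype.subsetP AD); apply: sA; rewrite inE si orbT.
  have ij : i != j by apply: contraNneq js => <-.
  by rewrite bopB zs// VsVj// VsVs// zs// !bop0 subrr.
Qed.

End TwistedSystem.

(** * The wandering subspace of an irreducible system *)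

Lemma in_setTfor n (i : 'I_n) : i \in finset.setTfor _.
Proof. by rewrite finset.in_setT. Qed.
#[local] Hint Resolve in_setTfor : core.

Section Generated.
Variables (R : realType) (n : nat) (H H' : hilbertType R).
Variables (A : {set 'I_n}).
Variables (U : 'I_n -> 'I_n -> bop H) (V : 'I_n -> bop H).
Variables (U' : 'I_n -> 'I_n -> bop H') (V' : 'I_n -> bop H').
Hypotheses (ts : twisted_system (finset.setTfor _) U V) (ts' : twisted_system (finset.setTfor _) U' V').

(** The pairs V i1 ... V ir x and V' i1 ... V' ir x', with all indices in A and
    L x x'.  When L relates vectors killed by the adjoints of the V i, i \in A,
    the pair of zeros makes this set of pairs stable under the adjoints too.
    With V' = V and L diagonal it serves for one system; with L given by a unitary
    between wandering spaces it serves to compare two systems. *)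
Inductive gen (L : H -> H' -> Prop) : H -> H' -> Prop :=
| gen_zero : gen L 0 0
| gen_base x x' : L x x' -> gen L x x'
| gen_step j x x' : j \in A -> gen L x x' -> gen L (V j x) (V' j x').

Variable L : H -> H' -> Prop.
Hypothesis Lwander : forall x x', L x x' -> forall i, i \in A ->
  star (V i) x = 0 /\ star (V' i) x' = 0.
Hypothesis LU : forall x x' i j, i != j -> L x x' -> L (U i j x) (U' i j x').
Hypothesis LV : forall x x' i, i \notin A -> L x x' ->
  L (V i x) (V' i x') /\ L (star (V i) x) (star (V' i) x').

Local Notation g := (gen L).

Lemma gen_U x x' i j : i != j -> g x x' -> g (U i j x) (U' i j x').
Proof.
move=> ij; elim=> [|{}x {}x' Lx|k {}x {}x' kA _ IH].
- by rewrite !bop0; exact: gen_zero.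
- exact/gen_base/LU.
- by rewrite (UV ts)// (UV ts')//; exact: gen_step.
Qed.

Lemma gen_V x x' i : g x x' -> g (V i x) (V' i x').
Proof.
move=> gx; have [iA|iA] := boolP (i \in A); first exact: gen_step.
elim: gx => [|{}x {}x' Lx|k {}x {}x' kA _ IH].
- by rewrite !bop0; exact: gen_zero.
- by apply: gen_base; have [] := LV iA Lx.
- have ik : i != k by apply: contraNneq iA => ->.
  rewrite (VV ts)// (VV ts')//; apply: gen_U => //; exact: gen_step.
Qed.

(** The adjoint of V i moves to the right through the V k with k <> i, up to
    unitaries, until it meets V i, with which it cancels, or the vector of L. *)
Lemma gen_Vs x x' i : g x x' -> g (star (V i) x) (star (V' i) x').
Proof.
elim=> [|{}x {}x' Lx|k {}x {}x' kA gx IH].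
- by rewrite !bop0; exact: gen_zero.
- have [iA|iA] := boolP (i \in A).
    by have [-> ->] := Lwander Lx iA; exact: gen_zero.
  by apply: gen_base; have [] := LV iA Lx.
- have [->|ik] := eqVneq i k; first by rewrite (VsV ts)// (VsV ts').
  have ki : k != i by rewrite eq_sym.
  by rewrite (VsVj ts)// (VsVj ts')//; apply: gen_U => //; exact: gen_step.
Qed.

End Generated.

Section Compression.
Variables (R : realType) (n : nat) (H : hilbertType R).
Variables (A : {set 'I_n}).
Variables (U : 'I_n -> 'I_n -> bop H) (V : 'I_n -> bop H).
Hypothesis ts : twisted_system (finset.setTfor _) U V.

Definition jointly_irreducible (n : nat) (V : 'I_n -> bop H) :=
  forall M : set H, closed_subspace M -> (forall i, reduces M (V i)) ->
    M = [set 0] \/ M = setT.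

Lemma wandering_closed : closed_subspace (wandering_space A V).
Proof. by apply: closed_subspace_forall => i; apply: closed_subspace_imply => _; exact: closed_subspace_kernel. Qed.

Lemma wandering_V i x : i \notin A -> wandering_space A V x ->
  wandering_space A V (V i x) /\ wandering_space A V (star (V i) x).
Proof.
move=> iA Wx; split=> k kA; have ki : k != i by apply: contraNneq iA => <-.
  by rewrite (VsVj ts)// Wx// !bop0.
by rewrite (VsVs ts)// Wx// !bop0.
Qed.

Lemma wandering_U i j x : i != j -> wandering_space A V x ->
  wandering_space A V (U i j x).
Proof. by move=> ij Wx k kA; rewrite -(UVs ts)// Wx// bop0. Qed.

Hypothesis irr : jointly_irreducible V.

(** Let N be the orthogonal complement of all V i1 ... V ir w, with w in W and
    orthogonal to M, where W is the wandering space.  It reduces every V i, so it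
    is 0 or the whole space.  As it contains M, the first case gives M = 0; as w
    itself is orthogonal to N, the second case gives w = 0, that is M = W. *)
Lemma wandering_irreducible (M : set H) : closed_subspace M ->
    M `<=` wandering_space A V ->
    (forall i, i \notin A -> reduces M (V i)) ->
    (forall i j, i != j -> forall x, M x -> M (U i j x)) ->
  M = [set 0] \/ M = wandering_space A V.
Proof.
move=> cM MW MV MU.
pose L x x' := x = x' /\ (wandering_space A V x /\ forall z, M z -> inner x z = 0).
have perp_inv (T : bop H) x : (forall z, M z -> M (star T z)) ->
    (forall z, M z -> inner x z = 0) -> forall z, M z -> inner (T x) z = 0.
  by move=> TM xM z Mz; rewrite inner_starl xM//; exact: TM.
pose g a := gen A V V L a a.
have g2 x x' : gen A V V L x x' -> x = x'.
  by elim=> // [y y' []//|j y y' _ _ ->].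
have Lw x x' : L x x' -> forall i, i \in A -> star (V i) x = 0 /\ star (V i) x' = 0.
  by move=> [<- [Wx _]] i iA; rewrite Wx.
have LU x x' i j : i != j -> L x x' -> L (U i j x) (U i j x').
  move=> ij [<- [Wx xM]]; split=> //; split; first exact: wandering_U.
  by apply: perp_inv => // z Mz; rewrite (Ustar ts)//; apply: MU; rewrite // eq_sym.
have LV x x' i : i \notin A -> L x x' ->
    L (V i x) (V i x') /\ L (star (V i) x) (star (V i) x').
  move=> iA [<- [Wx xM]]; have [W1 W2] := wandering_V iA Wx.
  split; split=> //; split=> //; apply: perp_inv => // z Mz.
    by have [] := MV _ iA _ Mz.
  by rewrite starK; have [] := MV _ iA _ Mz.
pose N := [set x | forall a, g a -> inner x a = 0].
have cN : closed_subspace N by exact: closed_subspace_perp.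
have Nred i : reduces N (V i).
  move=> x Nx; split=> a ga.
    rewrite inner_starl; apply: Nx; exact: (gen_Vs ts ts Lw LU LV).
  rewrite inner_starl starK; apply: Nx; exact: (gen_V ts ts LU LV).
have MN : M `<=` N.
  move=> x Mx a; rewrite /g => ga.
  have : forall b b', gen A V V L b b' -> inner x b = 0.
    move=> b b'; case=> [|y y' [_ [_ yM]]|j y y' jA _].
    - by rewrite innerC inner0l rmorph0.
    - by apply: inner_perpC; exact: yM.
    - by rewrite inner_starr (MW _ Mx)// inner0l.
  by apply; exact: ga.
have [N0|NT] := irr cN Nred.
  left; apply/seteqP; split=> [x /MN|x ->]; first by rewrite N0.
  exact: subspace0 cM.
right; apply: perp_complement => //; first exact: wandering_closed.
move=> x Wx xM; apply: inner_self_eq0.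
have : N x by rewrite NT.
by apply; apply: gen_base.
Qed.

Lemma wandering_neq0 : (forall i, i \in A -> is_shift (V i)) ->
  (exists x : H, x != 0) -> exists2 x, wandering_space A V x & x != 0.
Proof.
move=> sh [x x0].
have [||||||y [_ y0 Wy]] := wandering_nonzero (M := setT) (A := A) (x := x) ts => //.
by exists y.
Qed.

(** The intersection of the ranges of the powers of V i reduces all the V j.  If
    it is 0 then V i is a shift, and if it is everything then V i is onto. *)
Lemma shift_or_unitary i : is_shift (V i) \/ is_unitary (V i).
Proof.
have iso := ts_isometry ts (in_setTfor i).
have [h|h] := irr (unitary_part_closed iso)
  (fun j => unitary_part_reduces ts (in_setTfor i) (in_setTfor j)).
  by left.
right; apply: unitary_intro => x; first exact: isometryP.
have : (\bigcap_(m in [set: nat]) range (iter m (V i))) x by rewrite h.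
by move=> /(_ 1%N I) [y _ <-] /=; rewrite isometryP.
Qed.

End Compression.

Lemma shift_not_unitary (R : realType) (H : hilbertType R) (T : bop H) :
  (exists x : H, x != 0) -> is_shift T -> ~ is_unitary T.
Proof.
move=> [x /eqP x0] [_ sh] /unitaryP[_ TTs]; apply: x0.
suff : (\bigcap_(m in [set: nat]) range (iter m T)) x by rewrite sh.
move=> m _; exists (iter m (star T) x) => //.
elim: m => [|m IH] //; by rewrite iterSr [iter m.+1 (star T) x]/= TTs.
Qed.

Section IsometricRelation.
Variables (R : realType) (H H' : hilbertType R).
Variable G : H -> H' -> Prop.

(** The orthogonal complement of G for the indefinite form
    <x, a> - <x', a'> on pairs of vectors.  It is a closed linear relation, and
    it is invariant under a pair of operators (T, T') when G is invariant under
    the pair of their adjoints. *)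
Definition rel_perp x x' := forall a a', G a a' -> inner x a = inner x' a'.

Lemma rel_perpL k x x' y y' : rel_perp x x' -> rel_perp y y' ->
  rel_perp (k *: x + y) (k *: x' + y').
Proof.
by move=> px py a a' Ga; rewrite !innerDl !innerZl (px _ _ Ga) (py _ _ Ga).
Qed.

Lemma rel_perp0 : rel_perp 0 0.
Proof. by move=> a a' _; rewrite !inner0l. Qed.

Hypothesis iso : forall x x' y y', rel_perp x x' -> rel_perp y y' ->
  inner x y = inner x' y'.

Lemma rel_perpB x x' y y' : rel_perp x x' -> rel_perp y y' ->
  rel_perp (x - y) (x' - y').
Proof.
by move=> px py; rewrite addrC (addrC x') -(scaleN1r y) -(scaleN1r y'); exact: rel_perpL.
Qed.

Lemma rel_perp_norm x x' : rel_perp x x' -> rnorm x = rnorm x'.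
Proof.
move=> px; apply/eqP; rewrite -(@eqrXn2 _ 2)// ?rnorm_ge0//; apply/eqP.
by apply: (@complexI R); rewrite !rmorphXn/= -!rnormE !normr2E; exact: iso.
Qed.

(** If x is a limit of vectors of the domain, the vectors related to them form a
    Cauchy sequence, because the relation preserves norms; x is related to its
    limit. *)
Lemma rel_perp_dom : closed_subspace [set x | exists x', rel_perp x x'].
Proof.
split.
- apply/closed_approx => x xP.
  have /choice[u uP] (k : nat) : exists yy : H * H',
      rel_perp yy.1 yy.2 /\ rnorm (x - yy.1) < k.+1%:R^-1.
    have [|y [y' py] xy] := xP (k.+1%:R^-1); first by rewrite invr_gt0.
    by exists (y, y').
  have small (e : R) : 0 < e -> exists N, forall m, (N <= m)%N -> rnorm (x - (u m).1) < e.
    move=> /inv_natP[N Ne]; exists N => m Nm; apply: lt_le_trans (uP m).2 _.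
    apply: le_trans (ltW Ne); rewrite lef_pV2 ?posrE// ler_nat.
    by rewrite ltnS.
  have [l ul] : exists l, seq_limit (fun k => (u k).2) l.
    apply: complete_seq => e e0; have e20 : 0 < e / 2 by lra.
    have [N NP] := small _ e20; exists N => m k Nm Nk.
    rewrite -(rel_perp_norm (rel_perpB (uP m).1 (uP k).1)).
    have -> : (u m).1 - (u k).1 = (x - (u k).1) - (x - (u m).1).
      by rewrite opprB [RHS]addrC addrA subrK.
    have := rnormD_hilbert (x - (u k).1) (- (x - (u m).1)).
    rewrite rnormN (splitr e) => /le_lt_trans; apply.
    by apply: ltrD; exact: NP.
  exists l => a a' Ga; apply/eqP; rewrite -subr_eq0 -normr_le0.
  apply/ler_addgt0Pl => e; rewrite addr0 => /gt0_complexE[e0 eE].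
  have c0 : 0 < rnorm a + rnorm a' + 1.
    by have := rnorm_ge0 a; have := rnorm_ge0 a'; lra.
  have d0 := divr_gt0 e0 c0.
  have [N NP] := small _ d0; have [N' NP'] := ul _ d0.
  pose m := maxn N N'.
  have h1 := NP m (leq_maxl _ _); have h2 := NP' m (leq_maxr _ _).
  have -> : inner x a - inner l a' = inner (x - (u m).1) a - inner (l - (u m).2) a'.
    by rewrite !innerBl (((uP m).1) _ _ Ga) opprB addrA subrK.
  apply: le_trans (ler_normB _ _) _.
  apply: le_trans (lerD (cauchy_schwarz _ _) (cauchy_schwarz _ _)) _.
  rewrite !rnormE -!rmorphM -rmorphD/= eE lecR.
  set d := complex.Re e / _ in h1 h2 d0.
  have -> : complex.Re e = d * (rnorm a + rnorm a' + 1) by rewrite divfK ?gt_eqF.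
  have := ler_wpM2r (rnorm_ge0 a) (ltW h1).
  have := ler_wpM2r (rnorm_ge0 a') (ltW h2).
  rewrite !mulrDr mulr1 => k1 k2.
  by apply: le_trans (lerD k2 k1) _; rewrite lerDl ltW.
- by exists 0; exact: rel_perp0.
- by move=> k x y [x' px] [y' py]; exists (k *: x' + y'); exact: rel_perpL.
Qed.

End IsometricRelation.

Section Reconstruction.
Variables (R : realType) (n : nat) (H H' : hilbertType R).
Variables (A : {set 'I_n}).
Variables (U : 'I_n -> 'I_n -> bop H) (V : 'I_n -> bop H).
Variables (U' : 'I_n -> 'I_n -> bop H') (V' : 'I_n -> bop H').
Hypotheses (ts : twisted_system (finset.setTfor _) U V) (ts' : twisted_system (finset.setTfor _) U' V').
Hypotheses (irr : jointly_irreducible V) (irr' : jointly_irreducible V').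
Variable L : H -> H' -> Prop.
Hypothesis Lwander : forall x x', L x x' -> forall i, i \in A ->
  star (V i) x = 0 /\ star (V' i) x' = 0.
Hypothesis LU : forall x x' i j, i != j -> L x x' -> L (U i j x) (U' i j x').
Hypothesis LV : forall x x' i, i \notin A -> L x x' ->
  L (V i x) (V' i x') /\ L (star (V i) x) (star (V' i) x').
Hypothesis Linner : forall x x' y y', L x x' -> L y y' -> inner x y = inner x' y'.
Hypothesis Lneq0 : exists x x', [/\ L x x', x != 0 & x' != 0].

Let g := gen A V V' L.
Let G := rel_perp g.
Let G1 := rel_perp G.

(** Generated pairs have equal inner products: factors V j are moved to the
    other side as adjoints, until both vectors come from L, where inner products
    agree, or some V j^* is applied to a vector of L and gives 0. *)
Lemma gen_sub_perp x x' : g x x' -> G x x'.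
Proof.
elim=> [|{}x {}x' Lx|j {}x {}x' jA gx IH] a a' ga.
- by rewrite !inner0l.
- case: ga => [|y y' Ly|j y y' jA _]; last 1 first.
  + by have [h h'] := Lwander Lx jA; rewrite !inner_starr h h' !inner0l.
  + by rewrite [LHS]innerC [RHS]innerC !inner0l.
  + exact: Linner.
- by rewrite !inner_starl; apply: IH; exact: (gen_Vs ts ts').
Qed.

Let rel_sym (X X' : hilbertType R) (P : X -> X' -> Prop) x x' a a' :
  rel_perp P x x' -> P a a' -> inner a x = inner a' x'.
Proof. by move=> h /h e; rewrite innerC e -innerC. Qed.

Let G1G x x' : G1 x x' -> G x x'.
Proof. by move=> h a a' /gen_sub_perp; exact: h. Qed.

Let G1iso x x' y y' : G1 x x' -> G1 y y' -> inner x y = inner x' y'.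
Proof. by move=> hx /G1G; exact: hx. Qed.

Let gG1 x x' : g x x' -> G1 x x'.
Proof. by move=> gx a a' Ga; exact: rel_sym Ga gx. Qed.

Let GV x x' i : G x x' -> G (V i x) (V' i x') /\ G (star (V i) x) (star (V' i) x').
Proof.
move=> Gx; split=> a a' ga.
  by rewrite !inner_starl; apply: Gx; exact: (gen_Vs ts ts').
by rewrite !inner_starl !starK; apply: Gx; exact: (gen_V ts ts').
Qed.

Let G1V x x' i : G1 x x' -> G1 (V i x) (V' i x') /\ G1 (star (V i) x) (star (V' i) x').
Proof.
move=> Gx; split=> a a' /(GV i) [G1a G2a]; first by rewrite !inner_starl; exact: Gx.
by rewrite !inner_starl !starK; exact: Gx.
Qed.

Let G1dom x : exists x', G1 x x'.
Proof.
have cD := rel_perp_dom G1iso.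
have red i : reduces [set x | exists x', G1 x x'] (V i).
  by move=> y [y' /(G1V i)[h1 h2]]; split; [exists (V' i y')|exists (star (V' i) y')].
have [D0|DT] := irr cD red; last first.
  by have : [set x | exists x', rel_perp G x x'] x by rewrite DT.
have [y [y' [Ly y0 _]]] := Lneq0.
have : [set x | exists x', rel_perp G x x'] y by exists y'; exact/gG1/gen_base.
by rewrite D0 /= => /eqP; rewrite (negPf y0).
Qed.

Let flip (x' : H') (x : H) := G x x'.

Let flipE x' x : rel_perp flip x' x <-> G1 x x'.
Proof. by split=> h a a' Ga; apply/esym; exact: h Ga. Qed.

Let G1ran x' : exists x, G1 x x'.
Proof.
suff : exists x, rel_perp flip x' x by move=> [x /flipE]; exists x.
have fiso x1 x1' y y' : rel_perp flip x1' x1 -> rel_perp flip y' y ->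
    inner x1' y' = inner x1 y.
  by move=> /flipE h1 /flipE h2; apply/esym; exact: G1iso.
have cD := rel_perp_dom (fun x x' y y' => @fiso x' x y' y).
have red i : reduces [set x' | exists x, rel_perp flip x' x] (V' i).
  move=> y' [y /flipE/(G1V i)[h1 h2]].
  by split; [exists (V i y)|exists (star (V i) y)]; apply/flipE.
have [D0|DT] := irr' cD red; last first.
  by have : [set x' | exists x, rel_perp flip x' x] x' by rewrite DT.
have [y [y' [Ly _ y0]]] := Lneq0.
have : [set x' | exists x, rel_perp flip x' x] y'.
  by exists y; apply/flipE/gG1/gen_base.
by rewrite D0 /= => /eqP; rewrite (negPf y0).
Qed.

(** Let G be the complement of the generated pairs and G1 that of G.  Then G1 is
    contained in G, so it preserves inner products; it contains L and is stable
    under the V i and their adjoints.  Its domain and its range are nonzero closed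
    reducing subspaces, hence everything: G1 is the graph of a unitary. *)
Lemma unitary_extension : exists2 Z : H -> H',
  unitary_map Z & forall i, intertwines Z (V i) (V' i).
Proof.
have [Z ZP] := choice G1dom.
have uniq x y y' : G1 x y -> G1 x y' -> y = y'.
  move=> h h'; apply/eqP; rewrite -subr_eq0; apply/eqP; apply: inner_self_eq0.
  have := rel_perpB h h'; rewrite subrr => h0.
  by rewrite -(G1iso h0 h0) inner0l.
exists Z; last first.
  by move=> i x; apply: (uniq (V i x)) => //; have [] := G1V i (ZP x).
split; first split.
- by move=> k x y; apply: (uniq (k *: x + y)) => //; apply: rel_perpL; exact: ZP.
- by move=> x y; rewrite (G1iso (ZP x) (ZP y)).
- apply/seteqP; split=> // x' _; have [x Gx] := G1ran x'.
  by exists x => //; exact: (uniq x).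
Qed.

End Reconstruction.

(** * From twisted isometries to tori *)

Section Restriction.
Variables (R : realType) (H : hilbertType R) (M : set H).
Variable cM : closed_subspace M.
Local Notation K := (subspace_of cM).
Implicit Types T S : bop H.

Definition stable T := forall x, M x -> M (T x).

Definition restr_fun T (hT : stable T) (x : K) : K :=
  SubPoint cM (hT _ (sub_valP x)).

Fact restr_linear T (hT : stable T) : linear (restr_fun hT).
Proof. by move=> k x y; apply: sub_val_inj; rewrite /= bop_linear. Qed.

Fact restr_bounded T (hT : stable T) :
  exists N : R, forall x, `|restr_fun hT x| <= N%:C%C * `|x|.
Proof. by have [N NP] := bop_bounded T; exists N => x; exact: NP. Qed.

(** Totalized so that families of restrictions can be formed without carrying
    invariance proofs in their indices. *)
Definition restr T : bop K :=
  if pselect (stable T) is left hT then Bop (restr_linear hT) (restr_bounded hT)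
  else 0.

Lemma restrE T (x : K) : stable T -> sub_elt (restr T x) = T (sub_elt x).
Proof. by move=> hT; rewrite /restr; case: pselect. Qed.

Lemma restr_star T : stable T -> stable (star T) -> star (restr T) = restr (star T).
Proof.
move=> hT hT'; apply: bop_star_eq => x y.
rewrite -[LHS]/(inner (sub_elt (restr T x)) (sub_elt y)).
rewrite -[RHS]/(inner (sub_elt x) (sub_elt (restr (star T) y))).
by rewrite !restrE// -inner_starl.
Qed.

Lemma restr_unitary T : stable T -> stable (star T) -> is_unitary T ->
  is_unitary (restr T).
Proof.
move=> hT hT' /unitaryP[h1 h2].
by apply: unitary_intro => x; apply: sub_val_inj; rewrite restr_star// !restrE.
Qed.

(** M being closed, a limit of points of N lies in M, where N is closed. *)
Lemma subspace_image_closed (N : set K) : closed_subspace N ->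
  closed_subspace [set x | exists2 y : K, N y & sub_elt y = x].
Proof.
move=> cN; split.
- apply/closed_approx => x xP.
  have Mx : M x.
    have := subspace_closed cM; rewrite closed_approx; apply => e /xP[_ [y _ <-] xy].
    by exists (sub_elt y) => //; exact: sub_valP.
  exists (SubPoint cM Mx) => //; have := subspace_closed cN; rewrite closed_approx.
  by apply => e /xP[_ [y Ny <-] xy]; exists y.
- by exists 0 => //; exact: subspace0 cN.
- move=> k _ _ [x Nx <-] [y Ny <-]; exists (k *: x + y) => //; exact: (subspaceL cN).
Qed.

Lemma range_sub_elt : range (@sub_elt R H M cM) = M.
Proof.
apply/seteqP; split=> [_ [x _ <-]|x Mx]; first exact: sub_valP.
by exists (SubPoint cM Mx).
Qed.

End Restriction.

Section Isometries.
Variables (R : realType).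

Lemma isometric_inj (H K : hilbertType R) (J : H -> K) : isometric_map J -> injective J.
Proof.
move=> [Jl Ji] x y Jxy; apply/eqP; rewrite -subr_eq0; apply/eqP.
apply: inner_self_eq0; rewrite innerBl !innerBr -!Ji Jxy.
by rewrite !subrr.
Qed.

Lemma isometric_comp (H K L : hilbertType R) (J : H -> K) (J' : K -> L) :
  isometric_map J -> isometric_map J' -> isometric_map (J' \o J).
Proof.
move=> [Jl Ji] [Jl' Ji']; split=> [k x y|x y] /=; first by rewrite Jl Jl'.
by rewrite Ji' Ji.
Qed.

Lemma isometric_factor (H H' K : hilbertType R) (J : H -> K) (J' : H' -> K) :
    isometric_map J -> isometric_map J' -> range J `<=` range J' ->
  exists2 Z : H -> H', isometric_map Z & forall x, J' (Z x) = J x.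
Proof.
move=> iJ iJ' sub.
have /choice[Z ZP] x : exists y, J' y = J x.
  by have [|y _ <-] := sub (J x); [exists x|exists y].
exists Z => //; split=> [k x y|x y].
  by apply: (isometric_inj iJ'); rewrite iJ'.1 !ZP iJ.1.
by rewrite -iJ'.2 !ZP iJ.2.
Qed.

Lemma unitary_factor (H H' K : hilbertType R) (J : H -> K) (J' : H' -> K) :
    isometric_map J -> isometric_map J' -> range J = range J' ->
  exists2 Z : H -> H', unitary_map Z & forall x, J' (Z x) = J x.
Proof.
move=> iJ iJ' e.
have [|Z iZ ZP] := isometric_factor iJ iJ'; first by rewrite e.
exists Z => //; split=> //; apply/seteqP; split=> // y _.
have : range J (J' y) by rewrite e; exists y.
by move=> [x _ xy]; exists x => //; apply: (isometric_inj iJ'); rewrite ZP.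
Qed.

Lemma unitary_inverse (H K : hilbertType R) (Z : H -> K) : unitary_map Z ->
  exists2 Y : K -> H, unitary_map Y & (cancel Y Z /\ cancel Z Y).
Proof.
move=> [iZ rZ].
have iid : isometric_map (fun x : K => x) by [].
have [|Y uY YP] := unitary_factor iid iZ.
  by rewrite rZ; apply/seteqP; split=> // x _; exists x.
exists Y => //; split=> // x; exact/(isometric_inj iZ)/YP.
Qed.

Lemma unitary_comp (H K L : hilbertType R) (Z : H -> K) (Y : K -> L) :
  unitary_map Z -> unitary_map Y -> unitary_map (Y \o Z).
Proof.
move=> [iZ rZ] [iY rY]; split; first exact: isometric_comp.
apply/seteqP; split=> // z _.
have [y _ <-] : range Y z by rewrite rY.
have [x _ <-] : range Z y by rewrite rZ.
by exists x.
Qed.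

Lemma intertwines_inverse (H K : hilbertType R) (Z : H -> K) (Y : K -> H) T T' :
  cancel Y Z -> cancel Z Y -> intertwines Z T T' -> intertwines Y T' T.
Proof. by move=> YZ ZY h x; apply: (can_inj ZY); rewrite h !YZ. Qed.

Lemma intertwines_star (H K : hilbertType R) (Z : H -> K) (T : bop H) (T' : bop K) :
  unitary_map Z -> intertwines Z T T' -> intertwines Z (star T) (star T').
Proof.
move=> [iZ rZ] h x; apply: inner_eq => z.
have [y _ <-] : range Z z by rewrite rZ.
by rewrite -inner_starl -h !iZ.2 -inner_starl.
Qed.

Lemma intertwines_mul (H K : hilbertType R) (Z : H -> K) (T S : bop H) (T' S' : bop K) :
  intertwines Z T T' -> intertwines Z S S' -> intertwines Z (mul T S) (mul T' S').
Proof. by move=> h h' x; rewrite -[LHS]/(Z (T (S x))) h h'. Qed.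

Lemma intertwines_unitary (H K : hilbertType R) (Z : H -> K) (T : bop H) (T' : bop K) :
  unitary_map Z -> intertwines Z T T' -> is_unitary T -> is_unitary T'.
Proof.
move=> uZ h /unitaryP[h1 h2]; have hs := intertwines_star uZ h.
have sZ y : exists x, Z x = y.
  have [x _ <-] : range Z y by rewrite uZ.2.
  by exists x.
by apply: unitary_intro => y; have [x <-] := sZ y; [rewrite -h -hs h1|rewrite -hs -h h2].
Qed.

Lemma intertwines_shift (H K : hilbertType R) (Z : H -> K) (T : bop H) (T' : bop K) :
  unitary_map Z -> intertwines Z T T' -> is_shift T -> is_shift T'.
Proof.
move=> uZ h [iT sT]; have hs := intertwines_star uZ h.
have sZ y : exists x, Z x = y.
  have [x _ <-] : range Z y by rewrite uZ.2.
  by exists x.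
split.
  apply: bopP => y; have [x <-] := sZ y.
  by rewrite -[LHS]/(star T' (T' (Z x))) -h -hs isometryP.
have hm m x : Z (iter m T x) = iter m T' (Z x).
  by elim: m => [|m IH] //=; rewrite h IH.
have Z0 : Z 0 = 0 by apply: inner_self_eq0; rewrite uZ.1.2 inner0l.
apply/seteqP; split=> [y yP|_ ->] /=.
  have [x xy] := sZ y; rewrite -xy.
  suff : (\bigcap_(m in [set: nat]) range (iter m T)) x by rewrite sT => ->.
  move=> m _; have [y' _] := yP m I; have [x' <-] := sZ y'.
  by rewrite -xy -hm => /(isometric_inj uZ.1) <-; exists x'.
by move=> m _; exists 0 => //; elim: m => [|m IH] //=; rewrite IH bop0.
Qed.

End Isometries.

Section IrreducibleRepresentations.
Variables (R : realType) (n : nat).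

Lemma twisted_isometry_system (H : hilbertType R) (U : 'I_n -> 'I_n -> bop H) V :
  twisted_isometry U V -> twisted_system (finset.setTfor _) U V.
Proof.
move=> h; split; first exact: twist_unitary h.
- exact: twist_star h.
- exact: twist_commute h.
- by move=> i _; exact: twist_isometry h i.
- by move=> i j _ _; exact: (twist_rel h).
- by move=> i j k _; exact: (twist_central h).
Qed.

(** The U i j belong to the C*-algebra generated by the V i, which is what makes
    a representation of that algebra determine its values on them. *)
Lemma twisted_UE (H : hilbertType R) (U : 'I_n -> 'I_n -> bop H) V i j :
    twisted_system (finset.setTfor _) U V -> i != j ->
  U i j = mul (star (V i)) (mul (star (V j)) (mul (V i) (V j))).
Proof.
move=> ts ij; have ji : j != i by rewrite eq_sym.
apply: bopP => x.
rewrite -[RHS]/(star (V i) (star (V j) (V i (V j x)))).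
by rewrite (VsVj ts)// (VsV ts)// -(UVs ts)// (VsV ts).
Qed.

Variable p : twisted_irrep R n.
Local Notation V := (fun i => tw_irrep p (tw_V p i)).
Local Notation U := (fun i j => tw_irrep p (tw_U p i j)).

Let S : set (bop (tw_space p)) := cstar_generated (range (tw_V p)).

Let Ssub : cstar_subalgebra S. Proof. exact: generated_subalgebra. Qed.

Let SV i : S (tw_V p i). Proof. by apply: generated_in; exists i. Qed.

Let SU i j : i != j -> S (tw_U p i j).
Proof.
move=> ij; rewrite (twisted_UE (twisted_isometry_system (tw_twisted p)) ij).
have Ss k : S (star (tw_V p k)) by exact: (csub_star Ssub).
by apply: (csub_mul Ssub) => //; apply: (csub_mul Ssub) => //; exact: (csub_mul Ssub).
Qed.

Lemma irrep_UE i j : i != j ->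
  U i j = mul (star (V i)) (mul (star (V j)) (mul (V i) (V j))).
Proof.
move=> ij; have fh := irrep_hom (tw_irrep p).
have Ss k : S (star (tw_V p k)) by exact: (csub_star Ssub).
have e := twisted_UE (twisted_isometry_system (tw_twisted p)) ij.
have SM a b : S a -> S b -> S (mul a b) by exact: (csub_mul Ssub).
rewrite [in LHS]e !(hom_mul fh) ?(hom_star fh); try done;
  repeat first [exact: SV|exact: Ss|refine (SM _ _ _ _)].
Qed.

Lemma irrep_system : twisted_system (finset.setTfor _) U V.
Proof.
have fh := irrep_hom (tw_irrep p); have h := tw_twisted p.
have SUs i j : i != j -> S (star (tw_U p i j)).
  by move=> ij; apply: (csub_star Ssub); exact: SU.
have Ss k : S (star (tw_V p k)) by exact: (csub_star Ssub).
have SM a b : S a -> S b -> S (mul a b) by exact: (csub_mul Ssub).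
split.
- move=> i j ij; have [u1 u2] := twist_unitary h ij; have Sij := SU ij.
  split; cbv beta; rewrite -(hom_star fh Sij) -(hom_mul fh) ?u1 ?u2 ?(hom_one fh)//;
    exact: SUs.
- by move=> i j ij; rewrite (twist_star h ij) (hom_star fh (SU ij)).
- move=> i j k l ij kl; rewrite /commutes -(hom_mul fh (SU ij) (SU kl)).
  by rewrite -(hom_mul fh (SU kl) (SU ij)) (twist_commute h ij kl).
- move=> i _; rewrite /is_isometry -(hom_star fh (SV i)).
  by rewrite -(hom_mul fh (Ss i) (SV i)) (twist_isometry h) (hom_one fh).
- move=> i j _ _ ij; rewrite -(hom_star fh (SV i)) -(hom_star fh (SU ij)).
  rewrite -(hom_mul fh (Ss i) (SV j)) -(hom_mul fh (SV j) (Ss i)).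
  by rewrite -(hom_mul fh (SUs _ _ ij) (SM _ _ (SV j) (Ss i))) (twist_rel h ij).
- move=> i j k _ ij; rewrite /commutes -(hom_mul fh (SV k) (SU ij)).
  by rewrite -(hom_mul fh (SU ij) (SV k)) (twist_central h k ij).
Qed.

Lemma irrep_joint : jointly_irreducible V.
Proof.
move=> M cM Mred; apply: (irrep_irreducible cM) => a Sa.
apply: (generated_reduces (irrep_hom (tw_irrep p)) cM) => // _ [i _ <-].
exact: Mred.
Qed.

Lemma torus_reduces (A : {set 'I_n}) (TA : twisted_torus R A) (K : hilbertType R)
    (f : TA -> bop K) (M : set K) : star_hom setT f -> closed_subspace M ->
    (forall i, i \notin A -> reduces M (f (torus_u TA i))) ->
    (forall j k, j != k -> reduces M (f (torus_w TA j k))) ->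
  forall a, reduces M (f a).
Proof.
move=> fh cM ru rw a; rewrite -(torus_generated TA) in fh.
apply: (generated_reduces fh cM).
  by move=> _ [[i /= iA <-]|[[j k] /= jk <-]]; [exact: ru|exact: rw].
by rewrite (torus_generated TA).
Qed.

End IrreducibleRepresentations.

Section Correspondence.
Variables (R : realType) (n : nat).
Variable T : forall A : {set 'I_n}, twisted_torus R A.

(** Let A be the set of the i such that V i is a shift.  The U i j, and the V i with
    i not in A, which are unitary, satisfy the relations of the torus of A on the
    wandering space; universality turns them into a representation. *)
Lemma torus_of_twisted (p : twisted_irrep R n) :
  exists q : torus_irrep T, wandering_data p q.
Proof.
pose V i := tw_irrep p (tw_V p i); pose U i j := tw_irrep p (tw_U p i j).
have ts : twisted_system (finset.setTfor _) U V := irrep_system p.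
have irr : jointly_irreducible V := @irrep_joint R n p.
pose A := [set i | `[< is_shift (V i) >]]%SET.
have shA i : i \in A -> is_shift (V i) by rewrite inE => /asboolP.
have unA i : i \notin A -> is_unitary (V i).
  move=> iA; have [sh|//] := shift_or_unitary ts irr i.
  by case/negP: iA; rewrite inE; apply/asboolP.
pose W := wandering_space A V; have cW : closed_subspace W by exact: wandering_closed.
pose K := subspace_of cW.
have sV i : i \notin A -> stable W (V i).
  by move=> iA x Wx; have [] := wandering_V ts iA Wx.
have sVs i : i \notin A -> stable W (star (V i)).
  by move=> iA x Wx; have [] := wandering_V ts iA Wx.
have sU i j : i != j -> stable W (U i j).
  by move=> ij x; exact: (wandering_U ts ij).
have sUs i j : i != j -> stable W (star (U i j)).
  by move=> ij x Wx; rewrite (Ustar ts)//; apply: sU; rewrite // eq_sym.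
have eV i x : i \notin A -> sub_elt (restr cW (V i) x) = V i (sub_elt x).
  by move=> iA; apply: restrE; exact: sV.
have eU i j x : i != j -> sub_elt (restr cW (U i j) x) = U i j (sub_elt x).
  by move=> ij; apply: restrE; exact: sU.
have rel : torus_relations A (fun i => restr cW (V i)) (fun i j => restr cW (U i j)).
  split.
  - by move=> i iA; apply: restr_unitary; [exact: sV|exact: sVs|exact: unA].
  - by move=> j k jk; apply: restr_unitary; [exact: sU|exact: sUs|exact: ts_unitary ts _ _ jk].
  - move=> j k jk; rewrite restr_star ?(ts_star ts jk)//; [exact: sU|exact: sUs].
  - move=> i j k iA jk; apply: bopP => x; apply: sub_val_inj => /=.
    by rewrite eV// eU// eU// eV// (UV ts).
  - move=> i j iA jA ij; apply: bopP => x; apply: sub_val_inj => /=.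
    by rewrite (eV i)// (eV j)// (eU i j)// (eV j)// (eV i)// (VV ts).
  - move=> j k l m jk lm; apply: bopP => x; apply: sub_val_inj => /=.
    by rewrite (eU j k)// (eU l m)// (eU l m)// (eU j k)// (UU ts).
have [f [fh fu fw]] := torus_universal (T A) rel.
have K0 : exists x : K, x != 0.
  have [x Wx x0] := wandering_neq0 ts shA (irrep_nonzero (tw_irrep p)).
  exists (SubPoint cW Wx); apply: contraNneq x0 => e.
  by rewrite -[x]/(sub_elt (SubPoint cW Wx)) e.
have Kirr : irreducible [set: T A] f.
  move=> M cM Mred.
  have [|||e|e] := wandering_irreducible ts irr (subspace_image_closed cM) (A := A).
  - by move=> _ [y _ <-]; exact: sub_valP.
  - move=> i iA _ [y My <-]; have [|h1 h2] := Mred (torus_u (T A) i) _ _ My; first by [].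
    rewrite fu// in h1 h2; split.
      by exists (restr cW (V i) y) => //; rewrite eV.
    exists (star (restr cW (V i)) y) => //.
    by rewrite (restr_star cW (sV i iA) (sVs i iA)); apply: restrE; exact: sVs.
  - move=> i j ij _ [y My <-]; have [|h1 _] := Mred (torus_w (T A) i j) _ _ My; first by [].
    rewrite fw// in h1.
    by exists (restr cW (U i j) y) => //; rewrite eU.
  - left; apply/seteqP; split=> [y My|_ ->]; last exact: subspace0 cM.
    apply: sub_val_inj; have : [set x | exists2 y, M y & sub_elt y = x] (sub_elt y) by exists y.
    by rewrite e.
  - right; apply/seteqP; split=> // y _.
    move/seteqP: e => [_ e].
    by have [z Mz /sub_val_inj <-] := e _ (sub_valP y).
exists (TorusIrrep (Irrep fh K0 Kirr)); split=> //.
exists (@sub_elt _ _ _ cW); split=> //=.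
- exact: range_sub_elt.
- by move=> i iA x /=; rewrite fu// restrE//; exact: sV.
- by move=> j k jk x /=; rewrite fw// restrE//; exact: sU.
Qed.

(** An operator on a nonzero space is not both a shift and a unitary. *)
Lemma wandering_set_unique (p : twisted_irrep R n) (q q' : torus_irrep T) :
  wandering_data p q -> wandering_data p q' -> ti_set q = ti_set q'.
Proof.
move=> [sq uq _] [sq' uq' _]; apply/setP => i.
have x0 := irrep_nonzero (tw_irrep p).
apply/idP/idP => h; apply: contraT => h'.
  by case: (shift_not_unitary x0 (sq _ h) (uq' _ h')).
by case: (shift_not_unitary x0 (sq' _ h) (uq _ h')).
Qed.

Lemma wandering_data_functional (p : twisted_irrep R n) (q q' : torus_irrep T) :
  wandering_data p q -> wandering_data p q' -> torus_equiv q q'.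
Proof.
move=> d d'; have e := wandering_set_unique d d'.
case: q q' e d d' => [A q] [A' q'] /= e; subst A'.
move=> [_ _ [J [iJ rJ Ju Jw]]] [_ _ [J' [iJ' rJ' Ju' Jw']]] /=.
have [|Z uZ ZP] := unitary_factor iJ iJ'; first by rewrite rJ rJ'.
split=> //; exists Z; split=> //=.
- move=> i iA x; apply: (isometric_inj iJ').
  by rewrite ZP (Ju _ iA) (Ju' _ iA) ZP.
- move=> j k jk x; apply: (isometric_inj iJ').
  by rewrite ZP (Jw _ _ jk) (Jw' _ _ jk) ZP.
Qed.

(** The two wandering spaces are identified through the space of the torus
    representation, and the identification extends to the whole spaces. *)
Lemma wandering_data_injective (p p' : twisted_irrep R n) (q : torus_irrep T) :
  wandering_data p q -> wandering_data p' q -> twisted_equiv p p'.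
Proof.
case: q => A q [shp unp [J [iJ rJ Ju Jw]]] [shp' unp' [J' [iJ' rJ' Ju' Jw']]] /=.
rewrite /= in shp unp J iJ rJ Ju Jw shp' unp' J' iJ' rJ' Ju' Jw'.
have ts := irrep_system p; have irr := @irrep_joint R n p.
have ts' := irrep_system p'; have irr' := @irrep_joint R n p'.
pose L x x' := exists2 z, J z = x & J' z = x'.
have JW z : wandering_space A (fun i => tw_irrep p (tw_V p i)) (J z).
  by rewrite -rJ; exists z.
have JW' z : wandering_space A (fun i => tw_irrep p' (tw_V p' i)) (J' z).
  by rewrite -rJ'; exists z.
(* The isometries J and J' are not onto, but they intertwine the adjoints of
   unitaries with the adjoints of unitaries. *)
have adj (K : hilbertType R) (I : irrep_space q -> K) (X : bop (irrep_space q))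
    (Y : bop K) : is_unitary X -> is_unitary Y -> intertwines I X Y ->
    intertwines I (star X) (star Y).
  move=> /unitaryP[_ X2] /unitaryP[Y1 _] h z.
  by rewrite -{2}(X2 z) h Y1.
have uu i : i \notin A -> is_unitary (q (torus_u (T A) i)).
  move=> iA; have [h1 h2] := torus_u_unitary (torus_rel (T A)) iA.
  have fh := irrep_hom q.
  by split; rewrite -(hom_star fh)// -(hom_mul fh)// ?h1 ?h2 (hom_one fh).
apply: (@unitary_extension R n _ _ A _ _ _ _ ts ts' irr irr' L).
- by move=> _ _ [z <- <-] i iA; rewrite JW// JW'.
- move=> _ _ i j ij [z <- <-]; exists (q (torus_w (T A) i j) z); [exact: Jw|exact: Jw'].
- move=> _ _ i iA [z <- <-]; split.
    by exists (q (torus_u (T A) i) z); [exact: Ju|exact: Ju'].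
  exists (star (q (torus_u (T A) i)) z).
    by apply: adj; [exact: uu|exact: unp|exact: Ju].
  by apply: adj; [exact: uu|exact: unp'|exact: Ju'].
- by move=> _ _ _ _ [z <- <-] [y <- <-]; rewrite iJ.2 iJ'.2.
- have [z z0] := irrep_nonzero q; exists (J z), (J' z); split; first by exists z.
    apply: contraNneq z0 => e; apply/eqP/inner_self_eq0.
    by rewrite -iJ.2 e inner0l.
  apply: contraNneq z0 => e; apply/eqP/inner_self_eq0.
  by rewrite -iJ'.2 e inner0l.
Qed.

Lemma twisted_equiv_refl (p : twisted_irrep R n) : twisted_equiv p p.
Proof.
exists id => //; split=> //; apply/seteqP; split=> // x _; by exists x.
Qed.

Lemma twisted_equiv_sym (p q : twisted_irrep R n) :
  twisted_equiv p q -> twisted_equiv q p.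
Proof.
move=> [Z uZ ZP]; have [Y uY [YZ ZY]] := unitary_inverse uZ.
by exists Y => // i; apply: intertwines_inverse (ZP i).
Qed.

Lemma twisted_equiv_trans (p q r : twisted_irrep R n) :
  twisted_equiv p q -> twisted_equiv q r -> twisted_equiv p r.
Proof.
move=> [Z uZ ZP] [Y uY YP]; exists (Y \o Z); first exact: unitary_comp.
by move=> i x; rewrite /= ZP YP.
Qed.

Lemma torus_equiv_refl (p : torus_irrep T) : torus_equiv p p.
Proof.
split=> //; exists id; split=> //; split=> //; apply/seteqP.
by split=> // x _; exists x.
Qed.

Lemma torus_equiv_sym (p q : torus_irrep T) : torus_equiv p q -> torus_equiv q p.
Proof.
case: p q => [A p] [A' q] [/= e]; subst A' => -[Z [uZ Zu Zw]].
have [Y uY [YZ ZY]] := unitary_inverse uZ.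
split=> //; exists Y; split=> //= [i iA|j k jk].
  exact: intertwines_inverse (Zu i iA).
exact: intertwines_inverse (Zw j k jk).
Qed.

Lemma torus_equiv_trans (p q r : torus_irrep T) :
  torus_equiv p q -> torus_equiv q r -> torus_equiv p r.
Proof.
case: p q r => [A p] [A' q] [A'' r] [/= e]; subst A' => -[Z [uZ Zu Zw]].
move=> [/= e]; subst A'' => -[Y [uY Yu Yw]].
split=> //; exists (Y \o Z); split=> /= [|i iA x|j k jk x].
- exact: unitary_comp.
- by rewrite /= Zu// Yu.
- by rewrite /= Zw// Yw.
Qed.

Lemma wandering_data_equiv (p p' : twisted_irrep R n) (q q' : torus_irrep T) :
    twisted_equiv p p' -> torus_equiv q q' -> wandering_data p q ->
  wandering_data p' q'.
Proof.
case: q q' => [A q] [A' q'] [Z uZ ZP] [/= e]; subst A'.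
move=> [Y [uY Yu Yw]] [/= sh un [J [iJ rJ Ju Jw]]].
have [Y' uY' [Y'Y YY']] := unitary_inverse uY.
have ZU i j : i != j -> intertwines Z (tw_irrep p (tw_U p i j)) (tw_irrep p' (tw_U p' i j)).
  move=> ij; rewrite irrep_UE// irrep_UE//.
  by do ![apply: intertwines_mul|apply: (intertwines_star uZ)|exact: ZP].
split=> /=.
- by move=> i iA; apply: (intertwines_shift uZ (ZP i)); exact: sh.
- by move=> i iA; apply: (intertwines_unitary uZ (ZP i)); exact: un.
exists (Z \o (J \o Y')); split.
- by apply: isometric_comp uZ.1; apply: isometric_comp uY'.1 iJ.
- apply/seteqP; split=> [_ [y _ <-] i iA /=|x Wx].
    rewrite -(intertwines_star uZ (ZP i)).
    have : wandering_space A (fun i => tw_irrep p (tw_V p i)) (J (Y' y)).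
      by rewrite -rJ; exists (Y' y).
    by move=> ->//; apply: inner_self_eq0; rewrite uZ.1.2 inner0l.
  have [z _ zx] : range Z x by rewrite uZ.2.
  have : wandering_space A (fun i => tw_irrep p (tw_V p i)) z.
    move=> i iA; apply: (isometric_inj uZ.1).
    rewrite (intertwines_star uZ (ZP i)) zx Wx//.
    by apply/esym/inner_self_eq0; rewrite uZ.1.2 inner0l.
  by rewrite -rJ => -[y _ yz]; exists (Y y) => //=; rewrite YY' yz.
- move=> i iA x /=.
  by rewrite (intertwines_inverse Y'Y YY' (Yu i iA)) (Ju i iA) ZP.
- move=> j k jk x /=.
  by rewrite (intertwines_inverse Y'Y YY' (Yw j k jk)) (Jw j k jk) ZU.
Qed.

End Correspondence.

(** * Complex limits and positive definite forms *)

Section Limits.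
Variables (R : realType) (V : normedModType R[i]).
Implicit Types (u v : nat -> V) (l m : V).

Lemma seq_limit_unique u l m : seq_limit u l -> seq_limit u m -> l = m.
Proof.
move=> ul um; apply/eqP; rewrite -subr_eq0; apply/eqP; apply: rnorm_eq0.
apply/eqP; rewrite eq_le rnorm_ge0 andbT; apply/ler_addgt0Pl => e e0.
rewrite addr0; have e20 : 0 < e / 2 by lra.
have [N NP] := ul _ e20; have [N' NP'] := um _ e20.
have h1 := NP _ (leq_maxl N N'); have h2 := NP' _ (leq_maxr N N').
set k := maxn N N' in h1 h2.
have -> : l - m = (l - u k) - (m - u k) by rewrite opprB addrA subrK.
apply: le_trans (rnormD _ _) _; rewrite rnormN (splitr e).
by apply: lerD; exact: ltW.
Qed.

Lemma seq_limit_linear (c : R[i]) u v l m : seq_limit u l -> seq_limit v m ->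
  seq_limit (fun n => c *: u n + v n) (c *: l + m).
Proof.
move=> ul vm e e0; pose C := complex.Re `|c|.
have C0 : 0 <= C by rewrite -ler0c RRe_real// realE normr_ge0.
have C1 : 0 < C + 1 by lra.
have d0 := divr_gt0 e0 C1.
have [N NP] := ul _ d0; have [N' NP'] := vm _ d0.
exists (maxn N N') => n; rewrite geq_max => /andP[/NP h1 /NP' h2].
have -> : c *: l + m - (c *: u n + v n) = c *: (l - u n) + (m - v n).
  by rewrite scalerBr opprD addrACA.
apply: le_lt_trans (rnormD _ _) _.
have -> : rnorm (c *: (l - u n)) = C * rnorm (l - u n).
  by apply: (@complexI R); rewrite -rnormE normrZ rmorphM/= -!rnormE /C RRe_real// realE normr_ge0.
have -> : e = C * (e / (C + 1)) + e / (C + 1).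
  by rewrite -[X in _ + X]mul1r -mulrDl mulrCA divff ?mulr1// gt_eqF.
by apply: ler_ltD => //; apply: ler_wpM2l => //; exact: ltW.
Qed.

Lemma seq_limit_shift u l : seq_limit (fun n => u n.+1) l -> seq_limit u l.
Proof. by move=> ul e /ul[N NP]; exists N.+1 => -[|n]// /NP. Qed.

Lemma eq_seq_limit u v l : u =1 v -> seq_limit u l -> seq_limit v l.
Proof. by move=> uv ul e /ul[N NP]; exists N => n /NP; rewrite uv. Qed.

End Limits.

Section ComplexLimits.
Variable R : realType.
Local Notation C := (R[i]^o).

Lemma rnormC_le (z : C) : rnorm z <= `|complex.Re z| + `|complex.Im z|.
Proof.
case: z => a b /=; rewrite /rnorm normc_def/= -(ler_pXn2r (n := 2))//; last 2 first.
- by rewrite nnegrE sqrtr_ge0.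
- by rewrite nnegrE addr_ge0.
rewrite sqr_sqrtr ?addr_ge0 ?sqr_ge0// sqrrD !real_normK ?num_real//.
by have := mulr_ge0 (normr_ge0 a) (normr_ge0 b); rewrite mulr2n; lra.
Qed.

Lemma Re_le_rnorm (z : C) : `|complex.Re z| <= rnorm z.
Proof.
case: z => a b /=; rewrite /rnorm normc_def/= -sqrtr_sqr ler_sqrt ?addr_ge0 ?sqr_ge0//.
by rewrite lerDl sqr_ge0.
Qed.

Lemma Im_le_rnorm (z : C) : `|complex.Im z| <= rnorm z.
Proof.
case: z => a b /=; rewrite /rnorm normc_def/= -sqrtr_sqr ler_sqrt ?addr_ge0 ?sqr_ge0//.
by rewrite lerDr sqr_ge0.
Qed.

Lemma real_complete (u : nat -> R) :
  (forall e : R, 0 < e -> exists N, forall m n, (N <= m)%N -> (N <= n)%N ->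
     `|u m - u n| < e) ->
  exists l, forall e : R, 0 < e -> exists N, forall n, (N <= n)%N -> `|l - u n| < e.
Proof.
move=> uc; have : cauchy (u @ \oo).
  apply/cauchy_ballP => e e0; have [N NP] := uc _ e0.
  exists (u @` [set n | (N <= n)%N], u @` [set n | (N <= n)%N]).
    by split; exists N => // n /= Nn; exists n.
  by move=> [_ _] /= [[m Nm <-] [k Nk <-]]; exact: NP.
move/cauchy_cvg/cvg_ex => [l ul]; exists l => e e0.
have [|N _ NP] := ul (ball l e); first by apply/nbhs_ballP; exists e.
by exists N => k Nk; have := NP k Nk.
Qed.

Lemma complex_complete (u : nat -> C) : seq_cauchy u -> exists l, seq_limit u l.
Proof.
move=> uc.
have [|a aP] := real_complete (u := fun n => complex.Re (u n)).
  move=> e /uc[N NP]; exists N => m n Nm Nn; apply: le_lt_trans (NP m n Nm Nn).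
  by apply: le_trans (Re_le_rnorm _); case: (u m); case: (u n).
have [|b bP] := real_complete (u := fun n => complex.Im (u n)).
  move=> e /uc[N NP]; exists N => m n Nm Nn; apply: le_lt_trans (NP m n Nm Nn).
  by apply: le_trans (Im_le_rnorm _); case: (u m); case: (u n).
exists (a +i* b)%C => e e0; have e20 : 0 < e / 2 by lra.
have [N NP] := aP _ e20; have [N' NP'] := bP _ e20.
exists (maxn N N') => n; rewrite geq_max => /andP[/NP h1 /NP' h2].
apply: le_lt_trans (rnormC_le _) _; rewrite (splitr e).
by apply: ltrD; [move: h1|move: h2]; case: (u n).
Qed.

Lemma seq_limit_conj (u : nat -> C) (l : C) :
  seq_limit u l -> seq_limit (fun n => (u n)^* : C) (l^* : C).
Proof.
move=> ul e /ul[N NP]; exists N => n /NP.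
by rewrite -rmorphB /rnorm norm_conjC.
Qed.

Lemma seq_limit_real_le (a : nat -> R) (l : C) (c : R) :
  seq_limit (fun n => (a n)%:C%C : C) l -> (forall n, a n <= c) ->
  complex.Re l <= c.
Proof.
move=> al ac; apply/ler_addgt0Pl => e /al[N /(_ _ (leqnn N)) h].
have := le_lt_trans (Re_le_rnorm _) h; case: l {al h} => x y /=.
rewrite ltr_norml => /andP[_]; have := ac N; lra.
Qed.

Lemma seq_limit_real_ge (a : nat -> R) (l : C) (c : R) (N0 : nat) :
  seq_limit (fun n => (a n)%:C%C : C) l -> (forall n, (N0 <= n)%N -> c <= a n) ->
  c <= complex.Re l.
Proof.
move=> al ac; apply/ler_addgt0Pl => e /al[N /(_ _ (leq_maxl N N0)) h].
have := le_lt_trans (Re_le_rnorm _) h; case: l {al h} => x y /=.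
rewrite ltr_norml => /andP[+ _]; have := ac _ (leq_maxr N N0); lra.
Qed.

Lemma seq_limit_real_Im (a : nat -> R) (l : C) :
  seq_limit (fun n => (a n)%:C%C : C) l -> complex.Im l = 0.
Proof.
move=> al; apply/eqP; rewrite -normr_le0; apply/ler_addgt0Pl => e /al[N h].
have := le_lt_trans (Im_le_rnorm _) (h _ (leqnn N)).
by case: l {al h} => x y /=; rewrite subr0 addr0 => /ltW.
Qed.

End ComplexLimits.

Section PreHilbert.
Variables (R : realType) (V : lmodType R[i]) (ip : V -> V -> R[i]).
Hypothesis ipl : forall z, linear_for *%R (ip ^~ z).
Hypothesis ipC : forall x y, ip x y = (ip y x)^*.
Hypothesis ip_ge0 : forall x, 0 <= ip x x.
Hypothesis ip_eq0 : forall x, ip x x = 0 -> x = 0.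

Let ipDl x y z : ip (x + y) z = ip x z + ip y z.
Proof. by have := ipl z 1 x y; rewrite scale1r mul1r. Qed.

Let ip0l z : ip 0 z = 0.
Proof.
by have := ipl z (-1) 0 0; rewrite scaler0 addr0 mulN1r addNr.
Qed.

Let ipZl k x z : ip (k *: x) z = k * ip x z.
Proof. by have := ipl z k x 0; rewrite addr0 ip0l addr0. Qed.

Let ipDr x y z : ip x (y + z) = ip x y + ip x z.
Proof. by rewrite ipC ipDl rmorphD/= -!ipC. Qed.

Let ipZr k x y : ip x (k *: y) = k^* * ip x y.
Proof. by rewrite ipC ipZl rmorphM/= -ipC. Qed.

Definition ip_norm x : R[i] := sqrtC (ip x x).

Lemma ip_norm2 x : ip_norm x ^+ 2 = ip x x.
Proof. exact: sqrtCK. Qed.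

Lemma ip_norm_ge0 x : 0 <= ip_norm x.
Proof. by rewrite sqrtC_ge0. Qed.

Lemma ip_normZ k x : ip_norm (k *: x) = `|k| * ip_norm x.
Proof.
apply/eqP; rewrite -(@eqrXn2 _ 2)// ?mulr_ge0 ?ip_norm_ge0//.
by rewrite exprMn !ip_norm2 ipZl ipZr mulrA -normCK.
Qed.

Lemma ip_norm_eq0 x : ip_norm x = 0 -> x = 0.
Proof. by move=> h; apply: ip_eq0; rewrite -ip_norm2 h expr0n. Qed.

Lemma ip_cauchy_schwarz x y : `|ip x y| <= ip_norm x * ip_norm y.
Proof.
have [y0|y0] := eqVneq (ip y y) 0.
  by rewrite (ip_eq0 y0) ipC ip0l rmorph0 normr0 mulr_ge0 ?ip_norm_ge0.
have yp : 0 < ip y y by rewrite lt_def y0 ip_ge0.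
rewrite -(@ler_pXn2r _ 2)// ?nnegrE ?mulr_ge0 ?ip_norm_ge0//.
rewrite exprMn !ip_norm2 -ler_pdivrMr//.
have := ip_ge0 (x + - (ip x y / ip y y) *: y).
rewrite ipDl !ipDr !ipZl !ipZr rmorphN/= rmorphM/= -ipC fmorphV/= -ipC.
rewrite normCK -(ipC y x) => h.
rewrite -subr_ge0; apply: le_trans h _.
rewrite le_eqVlt; apply/orP; left; apply/eqP; field.
exact: y0.
Qed.

Lemma ip_normD x y : ip_norm (x + y) <= ip_norm x + ip_norm y.
Proof.
rewrite -(@ler_pXn2r _ 2)// ?nnegrE ?addr_ge0 ?ip_norm_ge0//.
rewrite ip_norm2 sqrrD !ip_norm2 ipDl !ipDr.
have -> : ip x x + ip x y + (ip y x + ip y y) = ip x x + (ip x y + ip y x) + ip y y.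
  by rewrite !addrA.
rewrite lerD2r lerD2l mulr2n.
have h : ip x y + ip y x \is Num.real.
  by apply/CrealP; rewrite rmorphD/= -!ipC addrC.
apply: le_trans (real_ler_norm h) _; apply: le_trans (ler_normD _ _) _.
apply: lerD; first exact: ip_cauchy_schwarz.
by rewrite mulrC; exact: ip_cauchy_schwarz.
Qed.

End PreHilbert.

(** * Square summable sequences in a Hilbert space *)

Section PartialEnergy.
Variables (R : realType) (K : hilbertType R).
Implicit Types (f g : nat -> K).

Definition energy f N : R := \sum_(k < N) rnorm (f k) ^+ 2.

Lemma energyS f N : energy f N.+1 = energy f N + rnorm (f N) ^+ 2.
Proof. by rewrite /energy big_ord_recr. Qed.

Lemma energy0 f : energy f 0 = 0.
Proof. by rewrite /energy big_ord0. Qed.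

Lemma energy_ge0 f N : 0 <= energy f N.
Proof. by apply: sumr_ge0 => k _; exact: sqr_ge0. Qed.

Lemma energy_mono f M N : (M <= N)%N -> energy f M <= energy f N.
Proof.
elim: N => [|N IH]; first by rewrite leqn0 => /eqP ->.
rewrite leq_eqVlt => /orP[/eqP ->//|/IH h]; apply: le_trans h _.
by rewrite energyS lerDl sqr_ge0.
Qed.

Lemma energy_term f N : rnorm (f N) ^+ 2 <= energy f N.+1.
Proof. by rewrite energyS lerDr energy_ge0. Qed.

Lemma energy_add f M N :
  energy f (M + N) = energy f M + energy (fun k => f (M + k)%N) N.
Proof.
elim: N => [|N IH]; first by rewrite addn0 energy0 addr0.
by rewrite addnS !energyS IH addrA.
Qed.

Lemma energy_le f g N : (forall k, (k < N)%N -> rnorm (f k) <= rnorm (g k)) ->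
  energy f N <= energy g N.
Proof.
move=> h; apply: ler_sum => k _; rewrite ler_pXn2r ?nnegrE ?rnorm_ge0//.
exact: h.
Qed.

Lemma rnormD_sq (x y : K) :
  rnorm (x + y) ^+ 2 <= 2 * rnorm x ^+ 2 + 2 * rnorm y ^+ 2.
Proof.
have h := rnormD x y; have h0 := rnorm_ge0 (x + y).
apply: (@le_trans _ _ ((rnorm x + rnorm y) ^+ 2)).
  by rewrite ler_pXn2r ?nnegrE ?addr_ge0 ?rnorm_ge0.
have := sqr_ge0 (rnorm x - rnorm y); rewrite sqrrB sqrrD !mulr2n; lra.
Qed.

Lemma energyD f g N :
  energy (fun k => f k + g k) N <= 2 * energy f N + 2 * energy g N.
Proof.
rewrite /energy !mulr_sumr -big_split/=; apply: ler_sum => k _.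
exact: rnormD_sq.
Qed.

Lemma energyZ (c : R[i]) f N :
  energy (fun k => c *: f k) N = complex.Re `|c| ^+ 2 * energy f N.
Proof. by rewrite /energy mulr_sumr; apply: eq_bigr => k _; rewrite rnormZ exprMn. Qed.

Definition partial_inner f g N : R[i]^o := \sum_(k < N) inner (f k) (g k).

Lemma partial_innerS f g N :
  partial_inner f g N.+1 = partial_inner f g N + inner (f N) (g N).
Proof. by rewrite /partial_inner big_ord_recr. Qed.

Lemma partial_inner_self f N : partial_inner f f N = (energy f N)%:C%C.
Proof.
rewrite /partial_inner /energy rmorph_sum; apply: eq_bigr => k _.
by rewrite rmorphXn/= -rnormE normr2E.
Qed.

Lemma partial_inner_tail f g M N : (M <= N)%N ->
  rnorm (partial_inner f g N - partial_inner f g M) <=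
  (energy f N - energy f M) + (energy g N - energy g M).
Proof.
elim: N => [|N IH].
  by rewrite leqn0 => /eqP ->; rewrite !subrr rnorm_zero addr0.
rewrite leq_eqVlt => /orP[/eqP ->|/IH h]; first by rewrite !subrr rnorm_zero addr0.
rewrite partial_innerS !energyS (addrAC (partial_inner f g N)).
apply: le_trans (rnormD _ _) _.
have h2 : rnorm (inner (f N) (g N) : R[i]^o) <= rnorm (f N) ^+ 2 + rnorm (g N) ^+ 2.
  have : rnorm (inner (f N) (g N) : R[i]^o) <= rnorm (f N) * rnorm (g N).
    by rewrite -lecR rmorphM/= -!rnormE; exact: cauchy_schwarz.
  by move/le_trans; apply; have := rnorm_ge0 (f N); have := rnorm_ge0 (g N); nra.
by move: h h2; lra.
Qed.

Lemma energy_cauchy f (B : R) : (forall N, energy f N <= B) ->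
  forall e : R, 0 < e -> exists N, forall m n, (N <= n)%N -> (n <= m)%N ->
    energy f m - energy f n < e.
Proof.
move=> fB e e0; have hs : has_sup [set energy f N | N in [set: nat]].
  by split; [exists (energy f 0), 0%N|exists B => _ [N _ <-]].
have [_ [N _ <-] h] := sup_adherent e0 hs.
exists N => m n Nn nm.
have : energy f m <= sup [set energy f N | N in [set: nat]].
  by apply: ub_le_sup; [by case: hs|by exists m].
have := energy_mono f Nn; move: h; lra.
Qed.

End PartialEnergy.

Section SquareSummable.
Variables (R : realType) (K : hilbertType R).

Record ell2 := Ell2 { ell2_fun :> nat -> K;
  ell2_bounded : exists B : R, forall N, energy ell2_fun N <= B }.
Implicit Types f g h : ell2.

Lemma ell2P f g : f =1 g -> f = g.
Proof.
case: f g => [f fP] [g gP] /= /funext fg; move: fP gP; rewrite fg => fP gP.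
by congr Ell2; exact: Prop_irrelevance.
Qed.

HB.instance Definition _ := gen_eqMixin ell2.
HB.instance Definition _ := gen_choiceMixin ell2.

Fact ell2_zero_bounded : exists B : R, forall N, energy (fun=> 0 : K) N <= B.
Proof.
exists 0 => N; rewrite /energy big1// => k _.
by rewrite rnorm_zero expr0n.
Qed.
Definition ell2_zero := Ell2 ell2_zero_bounded.

Fact ell2_add_bounded f g :
  exists B : R, forall N, energy (fun k => f k + g k) N <= B.
Proof.
have [B fB] := ell2_bounded f; have [C gC] := ell2_bounded g.
exists (2 * B + 2 * C) => N; apply: le_trans (energyD _ _ _) _.
by have := fB N; have := gC N; lra.
Qed.
Definition ell2_add f g := Ell2 (ell2_add_bounded f g).

Fact ell2_scale_bounded (c : R[i]) f :
  exists B : R, forall N, energy (fun k => c *: f k) N <= B.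
Proof.
have [B fB] := ell2_bounded f; exists (complex.Re `|c| ^+ 2 * B) => N.
by rewrite energyZ ler_wpM2l ?sqr_ge0.
Qed.
Definition ell2_scale c f := Ell2 (ell2_scale_bounded c f).

Fact ell2_addA : associative ell2_add.
Proof. by move=> f g h; apply: ell2P => k /=; rewrite addrA. Qed.
Fact ell2_addC : commutative ell2_add.
Proof. by move=> f g; apply: ell2P => k /=; rewrite addrC. Qed.
Fact ell2_add0 : left_id ell2_zero ell2_add.
Proof. by move=> f; apply: ell2P => k /=; rewrite add0r. Qed.
Fact ell2_addN : left_inverse ell2_zero (ell2_scale (-1)) ell2_add.
Proof. by move=> f; apply: ell2P => k /=; rewrite scaleN1r addNr. Qed.

HB.instance Definition _ :=
  GRing.isZmodule.Build ell2 ell2_addA ell2_addC ell2_add0 ell2_addN.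

Fact ell2_scaleA k l f : ell2_scale k (ell2_scale l f) = ell2_scale (k * l) f.
Proof. by apply: ell2P => j /=; rewrite scalerA. Qed.
Fact ell2_scale1 : left_id 1 ell2_scale.
Proof. by move=> f; apply: ell2P => j /=; rewrite scale1r. Qed.
Fact ell2_scaleDr : right_distributive ell2_scale +%R.
Proof. by move=> k f g; apply: ell2P => j /=; rewrite scalerDr. Qed.
Fact ell2_scaleDl f : {morph ell2_scale^~ f : k l / k + l}.
Proof. by move=> k l; apply: ell2P => j /=; rewrite scalerDl. Qed.

HB.instance Definition _ := GRing.Zmodule_isLmodule.Build R[i] ell2
  ell2_scaleA ell2_scale1 ell2_scaleDr ell2_scaleDl.

Lemma ell2_addE f g k : (f + g) k = f k + g k. Proof. by []. Qed.
Lemma ell2_scaleE c f k : (c *: f) k = c *: f k. Proof. by []. Qed.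
Lemma ell2_subE f g k : (f - g) k = f k - g k.
Proof. by rewrite ell2_addE -[(- g) k]/(-1 *: g k) scaleN1r. Qed.

(** The tails of the series of the <f k, g k> are bounded by those of the
    energies of f and g.  As inner products are limits, linearity and the
    computation of adjoints below reduce to finite sums by uniqueness of limits. *)
Lemma ell2_inner_ex f g : exists l : R[i]^o, seq_limit (partial_inner f g) l.
Proof.
apply: complex_complete => e e0; have e20 : 0 < e / 2 by lra.
have [B fB] := ell2_bounded f; have [C gC] := ell2_bounded g.
have [N NP] := energy_cauchy fB e20; have [N' NP'] := energy_cauchy gC e20.
have main m n : (maxn N N' <= n)%N -> (n <= m)%N ->
    rnorm (partial_inner f g m - partial_inner f g n) < e.
  rewrite geq_max => /andP[n1 n2] nm.
  apply: le_lt_trans (partial_inner_tail f g nm) _; rewrite (splitr e).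
  by apply: ltrD; [exact: NP|exact: NP'].
exists (maxn N N') => m n hm hn; have [nm|/ltnW mn] := leqP n m; first exact: main.
by rewrite rnormB; exact: main.
Qed.

Definition ell2_inner f g : R[i] := projT1 (cid (ell2_inner_ex f g)).

Lemma ell2_innerP f g : seq_limit (partial_inner f g) (ell2_inner f g : R[i]^o).
Proof. by rewrite /ell2_inner; case: cid. Qed.

Lemma ell2_inner_eq f g (l : R[i]^o) :
  seq_limit (partial_inner f g) l -> ell2_inner f g = l.
Proof. exact: seq_limit_unique (ell2_innerP f g). Qed.

Fact ell2_inner_linearl h : linear_for *%R (ell2_inner ^~ h).
Proof.
move=> c f g; apply: ell2_inner_eq.
apply: eq_seq_limit (seq_limit_linear c (ell2_innerP f h) (ell2_innerP g h)) => N.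
rewrite /partial_inner scaler_sumr -big_split/=; apply: eq_bigr => k _.
by rewrite innerDl innerZl.
Qed.

Fact ell2_innerC f g : ell2_inner f g = (ell2_inner g f)^*.
Proof.
apply: ell2_inner_eq.
apply: eq_seq_limit (seq_limit_conj (ell2_innerP g f)) => N.
by rewrite /partial_inner rmorph_sum/=; apply: eq_bigr => k _; rewrite -innerC.
Qed.

Let energy_limit f :
  seq_limit (fun N => (energy f N)%:C%C : R[i]^o) (ell2_inner f f : R[i]^o).
Proof. exact: eq_seq_limit (partial_inner_self f) (ell2_innerP f f). Qed.

Definition total_energy f : R := complex.Re (ell2_inner f f).

Lemma ell2_innerE f : ell2_inner f f = (total_energy f)%:C%C.
Proof.
have := seq_limit_real_Im (energy_limit f); rewrite /total_energy.
by case: (ell2_inner f f) => a b /= ->.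
Qed.

Lemma energy_total f N : energy f N <= total_energy f.
Proof.
apply: (seq_limit_real_ge (N0 := N) (energy_limit f)) => M; exact: energy_mono.
Qed.

Lemma total_energy_le f (B : R) : (forall N, energy f N <= B) -> total_energy f <= B.
Proof. exact: seq_limit_real_le (energy_limit f). Qed.

Lemma total_energy_ge0 f : 0 <= total_energy f.
Proof. by apply: le_trans (energy_total f 0); rewrite energy0. Qed.

Fact ell2_inner_ge0 f : 0 <= ell2_inner f f.
Proof. by rewrite ell2_innerE ler0c total_energy_ge0. Qed.

Fact ell2_inner_eq0 f : ell2_inner f f = 0 -> f = 0.
Proof.
rewrite ell2_innerE => /(@complexI R) h; apply: ell2P => k; apply: rnorm_eq0.
apply/eqP; rewrite -sqrf_eq0 eq_le sqr_ge0 andbT -h.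
exact: le_trans (energy_term f k) (energy_total f k.+1).
Qed.

HB.instance Definition _ := Lmodule_isNormed.Build R[i] ell2
  (ip_normD ell2_inner_linearl ell2_innerC ell2_inner_ge0 ell2_inner_eq0)
  (ip_normZ ell2_inner_linearl ell2_innerC ell2_inner_ge0)
  (ip_norm_eq0 ell2_inner_eq0).

Fact ell2_normr2E f : `|f| ^+ 2 = ell2_inner f f.
Proof. exact: ip_norm2. Qed.

Lemma ell2_rnorm2 f : rnorm f ^+ 2 = total_energy f.
Proof.
by apply: (@complexI R); rewrite rmorphXn/= -rnormE ell2_normr2E ell2_innerE.
Qed.

Lemma ell2_term_le f k : rnorm (f k) <= rnorm f.
Proof.
rewrite -(@ler_pXn2r _ 2)// ?nnegrE ?rnorm_ge0// ell2_rnorm2.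
exact: le_trans (energy_term f k) (energy_total f k.+1).
Qed.

Lemma ell2_rnorm_le f (c : R) : 0 <= c -> (forall N, energy f N <= c ^+ 2) ->
  rnorm f <= c.
Proof.
move=> c0 h; rewrite -(@ler_pXn2r _ 2)// ?nnegrE ?rnorm_ge0// ell2_rnorm2.
exact: total_energy_le.
Qed.

Fact ell2_cauchy_cvg (F : set_system ell2) : ProperFilter F -> cauchy F -> cvg F.
Proof.
apply: seq_complete_cvg => u uc.
have /choice[l lP] k : exists x, seq_limit (fun n => u n k) x.
  apply: complete_seq => e /uc[N NP]; exists N => m n Nm Nn.
  by rewrite -ell2_subE; apply: le_lt_trans (ell2_term_le _ _) (NP m n Nm Nn).
have small N (d : R) : 0 < d -> exists n0, forall n, (n0 <= n)%N ->
    energy (fun k => l k - u n k) N < d.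
  elim: N d => [|N IH] d d0; first by exists 0%N => n _; rewrite energy0.
  have d2 : 0 < d / 2 by lra.
  have [n0 n0P] := IH _ d2.
  have d3 : 0 < Num.sqrt (d / 2) by rewrite sqrtr_gt0.
  have [n1 n1P] := lP N _ d3.
  exists (maxn n0 n1) => n; rewrite geq_max => /andP[/n0P h0 /n1P h1].
  rewrite energyS (splitr d); apply: ltrD => //.
  by rewrite -(sqr_sqrtr (ltW d2)) ltr_pXn2r ?nnegrE ?rnorm_ge0 ?sqrtr_ge0.
have close (e : R) : 0 < e -> exists n0, forall n N, (n0 <= n)%N ->
    energy (fun k => l k - u n k) N <= e ^+ 2.
  move=> e0; have e20 : 0 < e / 2 by lra.
  have [n0 n0P] := uc _ e20; exists n0 => n N n0n.
  have d0 : 0 < (e / 2) ^+ 2 by exact: exprn_gt0.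
  have [n1 n1P] := small N _ d0.
  pose m := maxn n0 n1; have hm := n1P m (leq_maxr _ _).
  (* m is chosen after N, so that the first N coordinates of u m are near those
     of the pointwise limit. *)
  have -> : (fun k => l k - u n k) = (fun k => (l k - u m k) + (u m - u n) k).
    by apply/funext => k; rewrite ell2_subE addrA subrK.
  apply: le_trans (energyD _ _ _) _.
  have h1 : energy (u m - u n) N <= (e / 2) ^+ 2.
    apply: le_trans (energy_total _ _) _; rewrite -ell2_rnorm2.
    rewrite ler_pXn2r ?nnegrE ?rnorm_ge0 ?(ltW e20)//; apply: ltW.
    by apply: n0P => //; exact: leq_maxl.
  have -> : e ^+ 2 = 2 * (e / 2) ^+ 2 + 2 * (e / 2) ^+ 2 by field.
  by apply: lerD; rewrite ler_pM2l// ltW.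
have lB : exists B : R, forall N, energy l N <= B.
  have [n0 n0P] := close _ ltr01; have [B uB] := ell2_bounded (u n0).
  exists (2 * 1 ^+ 2 + 2 * B) => N.
  have -> : l = (fun k => (l k - u n0 k) + u n0 k).
    by apply/funext => k; rewrite subrK.
  apply: le_trans (energyD _ _ _) _; apply: lerD; rewrite ler_pM2l//.
  exact: n0P.
exists (Ell2 lB) => e e0; have e20 : 0 < e / 2 by lra.
have [n0 n0P] := close _ e20; exists n0 => n n0n.
apply: (@le_lt_trans _ _ (e / 2)); last by lra.
apply: ell2_rnorm_le; first exact: ltW.
move=> N; have -> : ell2_fun (Ell2 lB - u n) = (fun k => l k - u n k).
  by apply/funext => k; rewrite ell2_subE.
exact: n0P.
Qed.

HB.instance Definition _ := Uniform_isComplete.Build ell2 ell2_cauchy_cvg.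

Fact finite_bounded (s : seq K) : exists B : R, forall N, energy (nth 0 s) N <= B.
Proof.
exists (energy (nth 0 s) (size s)) => N.
have [/energy_mono//|/ltnW/subnKC <-] := leqP N (size s).
rewrite energy_add gerDl /energy big1// => k _.
by rewrite nth_default ?leq_addr// rnorm_zero expr0n.
Qed.
Definition ell2_finite s := Ell2 (finite_bounded s).

(** The finitely supported sequences with values in a countable dense set are
    countable and dense. *)
Fact ell2_separable : exists2 D : set ell2, countable D & dense D.
Proof.
have [D cD dD] := @separable_subproof R K.
have [i0 iD] : exists i : K -> nat, forall x y, D x -> D y -> i x = i y -> x = y.
  have /countable_injP[i iP] := cD.
  by exists i => x y Dx Dy; apply: iP; rewrite inE.
have /choice[d dP] m : exists x, forall y, D y -> i0 y = m -> x = y.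
  have [[y Dy im]|h] := pselect (exists2 y, D y & i0 y = m).
    by exists y => z Dz iz; apply: iD => //; rewrite im.
  by exists 0 => y Dy im; case: h; exists y.
have dense_d (x : K) (e : R) : 0 < e -> exists m, rnorm (x - d m) < e.
  move=> e0; have [||y [/= xy Dy]] := dD (ball x e%:C%C).
  - by exists x; apply: ballxx; rewrite ltcR.
  - by apply: ball_open; rewrite ltcR.
  exists (i0 y); rewrite (dP _ y)//.
  by move: xy; rewrite -ball_normE /ball_/= rnormE ltcR.
exists ((fun s : seq nat => ell2_finite (map d s)) @` [set: seq nat]).
  apply: (@sub_countable _ _ _ [set: seq nat]); first exact: card_image_le.
  exact: countableP.
move=> O [f Of] oO.
have /nbhs_ballP[e /= /gt0_complexE[e0 eE] sub] : nbhs f O by exact: open_nbhs_nbhs.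
set r := complex.Re e in eE e0; have r20 : 0 < (r / 2) ^+ 2 by apply: exprn_gt0; lra.
have r22 : 0 < (r / 2) ^+ 2 / 2 by lra.
have [B fB] := ell2_bounded f.
have [N NP] := energy_cauchy fB r22.
have head M (c : R) : 0 < c -> exists s : seq nat, size s = M /\
    energy (fun k => f k - nth 0 (map d s) k) M < c.
  elim: M c => [|M IH] c c0; first by exists [::]; rewrite energy0.
  have c20 : 0 < c / 2 by lra.
  have [s [sM sP]] := IH _ c20.
  have c3 : 0 < Num.sqrt (c / 2) by rewrite sqrtr_gt0.
  have [m mP] := dense_d (f M) _ c3.
  exists (rcons s m); rewrite size_rcons sM; split=> //.
  rewrite energyS (splitr c); apply: ler_ltD.
    apply: le_trans (ltW sP); apply: energy_le => k kM.
    by rewrite map_rcons nth_rcons size_map sM kM.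
  rewrite map_rcons nth_rcons size_map sM ltnn eqxx.
  by rewrite -(sqr_sqrtr (ltW c20)) ltr_pXn2r ?nnegrE ?rnorm_ge0 ?sqrtr_ge0.
have [s [sN sP]] := head N _ r22.
exists (ell2_finite (map d s)); split; last by exists s.
apply: sub; rewrite -ball_normE /ball_/= rnormE eE ltcR.
apply: (@le_lt_trans _ _ (r / 2)); last by lra.
apply: ell2_rnorm_le; first by lra.
move=> M; have -> : ell2_fun (f - ell2_finite (map d s)) =
    (fun k => f k - nth 0 (map d s) k) by apply/funext => k; rewrite ell2_subE.
apply: le_trans (energy_mono _ (leq_addl N M)) _.
rewrite energy_add [X in _ <= X]splitr; apply: lerD; first exact: ltW.
apply: le_trans (ltW (NP (N + M)%N N (leqnn _) (leq_addr _ _))).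
rewrite energy_add addrC addKr; apply: energy_le => k _.
by rewrite nth_default ?subr0// size_map sN leq_addr.
Qed.

HB.instance Definition _ := isHilbert.Build R ell2
  ell2_inner_linearl ell2_innerC ell2_normr2E ell2_separable.

Lemma inner_limit f g : seq_limit (partial_inner f g) (inner f g : R[i]^o).
Proof. exact: ell2_innerP. Qed.

Section Contractions.
Variable F : (nat -> K) -> nat -> K.
Hypothesis Flin : forall (c : R[i]) f g k,
  F (fun j => c *: f j + g j) k = c *: F f k + F g k.
Hypothesis Fle : forall (f : nat -> K) N, energy (F f) N <= energy f N.

Fact ell2_map_bounded f : exists B : R, forall N, energy (F f) N <= B.
Proof. by have [B fB] := ell2_bounded f; exists B => N; exact: le_trans (Fle f N) (fB N). Qed.

Let G f := Ell2 (ell2_map_bounded f).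

Fact ell2_op_linear : linear G.
Proof. by move=> c f g; apply: ell2P => k /=; exact: Flin. Qed.

Fact ell2_op_bounded : exists M : R, forall f, `|G f| <= M%:C%C * `|f|.
Proof.
exists 1 => f; rewrite mul1r !rnormE lecR.
apply: ell2_rnorm_le => [|N]; first exact: rnorm_ge0.
rewrite ell2_rnorm2; apply: le_trans (Fle f N) _; exact: energy_total.
Qed.

(** A coordinatewise definition F that does not increase partial energies
    yields a bounded operator: diagonal operators and the shift are of this kind. *)
Definition ell2_op : bop ell2 := Bop ell2_op_linear ell2_op_bounded.

End Contractions.

End SquareSummable.

(** * Adjoining a shift *)

Section Contractive.
Variables (R : realType) (H : hilbertType R).
Implicit Types T : bop H.

Definition contractive T := forall x, rnorm (T x) <= rnorm x.

Lemma isometry_rnorm T x : is_isometry T -> rnorm (T x) = rnorm x.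
Proof.
move=> hT; apply/eqP; rewrite -(@eqrXn2 _ 2)// ?rnorm_ge0//; apply/eqP.
apply: (@complexI R); rewrite !rmorphXn/= -!rnormE !normr2E.
exact: isometry_inner.
Qed.

Lemma isometry_contractive T : is_isometry T -> contractive T /\ contractive (star T).
Proof.
move=> hT; split=> x; first by rewrite isometry_rnorm.
have [x0|x0] := eqVneq (rnorm (star T x)) 0; first by rewrite x0 rnorm_ge0.
have xp : 0 < rnorm (star T x) by rewrite lt_def x0 rnorm_ge0.
rewrite -(ler_pM2l xp) -expr2 -{2}(isometry_rnorm (star T x) hT).
rewrite -lecR rmorphXn rmorphM/= -!rnormE normr2E -inner_starl.
have -> : inner (T (star T x)) x = `|inner (T (star T x)) x|.
  by rewrite ger0_norm// inner_starl -normr2E exprn_ge0.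
exact: cauchy_schwarz.
Qed.

Lemma isometry_mul T S : is_isometry T -> is_isometry S -> is_isometry (mul T S).
Proof.
move=> hT hS; apply: bopP => x.
by rewrite starM -[LHS]/(star S (star T (T (S x)))) !isometryP.
Qed.

Lemma is_unitary_isometry T : is_unitary T -> is_isometry T.
Proof. by case. Qed.

End Contractive.

Section Diagonal.
Variables (R : realType) (K : hilbertType R).
Local Notation E := (ell2 K).
Implicit Types (T : nat -> bop K) (f g : E).

Fact diag_linear T (c : R[i]) (f g : nat -> K) k :
  T k (c *: f k + g k) = c *: T k (f k) + T k (g k).
Proof. exact: bop_linear. Qed.

Fact diag_le T : (forall k, contractive (T k)) -> forall (f : nat -> K) N,
  energy (fun k => T k (f k)) N <= energy f N.
Proof. by move=> hT f N; apply: energy_le => k _; exact: hT. Qed.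

Definition diag T : bop E :=
  if pselect (forall k, contractive (T k)) is left hT
  then ell2_op (F := fun (f : nat -> K) k => T k (f k)) (@diag_linear T) (diag_le hT)
  else 0.

Lemma diagE T f k : (forall k, contractive (T k)) -> diag T f k = T k (f k).
Proof. by move=> hT; rewrite /diag; case: pselect. Qed.

Lemma diag_star T : (forall k, contractive (T k)) ->
    (forall k, contractive (star (T k))) ->
  star (diag T) = diag (fun k => star (T k)).
Proof.
move=> hT hT'; apply: bop_star_eq => f g.
apply: (seq_limit_unique (inner_limit _ _)).
apply: eq_seq_limit (inner_limit _ _) => N.
by apply: eq_bigr => k _; rewrite !diagE// inner_starl.
Qed.

Definition shift_seq (f : nat -> K) k : K := if k is k'.+1 then f k' else 0.

Fact shift_linear (c : R[i]) (f g : nat -> K) k :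
  shift_seq (fun j => c *: f j + g j) k = c *: shift_seq f k + shift_seq g k.
Proof. by case: k => [|k] //=; rewrite scaler0 addr0. Qed.

Fact shift_le (f : nat -> K) N : energy (shift_seq f) N <= energy f N.
Proof.
case: N => [|N]; first by rewrite !energy0.
apply: le_trans (energy_mono f (leqnSn N)).
rewrite -add1n energy_add /energy big_ord1 /= rnorm_zero expr0n add0r.
by apply: ler_sum => k _.
Qed.

Definition shift : bop E := ell2_op shift_linear shift_le.

Fact ell2_unshift_bounded f :
  exists B : R, forall N, energy (fun k => f k.+1 : K) N <= B.
Proof.
have [B fB] := ell2_bounded f; exists B => N; apply: le_trans (fB N.+1).
rewrite -add1n energy_add addrC -[X in X <= _]addr0.
by apply: lerD; [exact: energy_le|exact: energy_ge0].
Qed.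

Definition unshift_fun f : E := Ell2 (ell2_unshift_bounded f).

Fact unshift_fun_linear : linear unshift_fun.
Proof. by move=> c f g; apply: ell2P. Qed.

Fact unshift_fun_bounded : exists M : R, forall f, `|unshift_fun f| <= M%:C%C * `|f|.
Proof.
exists 1 => f; rewrite mul1r !rnormE lecR.
apply: ell2_rnorm_le => [|N]; first exact: rnorm_ge0.
rewrite ell2_rnorm2; apply: le_trans (energy_total f N.+1).
rewrite -add1n energy_add addrC -[X in X <= _]addr0.
by apply: lerD; [exact: energy_le|exact: energy_ge0].
Qed.

Definition unshift : bop E := Bop unshift_fun_linear unshift_fun_bounded.

Lemma shift0 f : shift f 0%N = 0. Proof. by []. Qed.
Lemma shiftS f k : shift f k.+1 = f k. Proof. by []. Qed.
Lemma unshiftE f k : unshift f k = f k.+1. Proof. by []. Qed.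

Lemma shift_star : star shift = unshift.
Proof.
apply: bop_star_eq => f g.
apply: (seq_limit_unique (inner_limit _ _)); apply: seq_limit_shift.
apply: eq_seq_limit (inner_limit _ _) => N.
rewrite /partial_inner big_ord_recl shift0 inner0l add0r.
by apply: eq_bigr => k _.
Qed.

Lemma shift_is_shift : is_shift shift.
Proof.
split; first by apply: bopP => f; rewrite shift_star; apply: ell2P.
apply/seteqP; split=> [f fP|_ -> m _]; last first.
  by exists 0 => //; elim: m => [|m IH] //; rewrite iterS IH bop0.
apply: ell2P => k; have [g _ <-] := fP k.+1 I.
have h m (j : nat) : (j < m)%N -> iter m shift g j = 0.
  by elim: m j => // m IH [|j] jm; rewrite iterS ?shift0 ?shiftS ?IH.
exact: h.
Qed.

Definition single (x : K) : E := ell2_finite [:: x].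

Lemma single0 x : single x 0%N = x. Proof. by []. Qed.
Lemma singleS x k : single x k.+1 = 0. Proof. by rewrite /= nth_nil. Qed.

Lemma single_isometric : isometric_map single.
Proof.
split=> [c x y|x y].
  apply: ell2P => -[|k]; rewrite ?ell2_addE ?ell2_scaleE ?single0 ?singleS//.
  by rewrite scaler0 addr0.
apply: (seq_limit_unique (inner_limit _ _)) => e e0; exists 1%N => -[|N]// _.
rewrite /partial_inner big_ord_recl big1 => [|k _].
  by rewrite addr0 subrr rnorm_zero.
by rewrite singleS inner0l.
Qed.

Lemma range_single : range single = [set f | star shift f = 0].
Proof.
rewrite shift_star; apply/seteqP; split=> [_ [x _ <-]|f f0].
  by apply: ell2P => k; rewrite unshiftE singleS.
exists (f 0%N) => //; apply: ell2P => -[|k]; first by [].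
by rewrite singleS -unshiftE f0.
Qed.

End Diagonal.

Section ShiftExtension.
Variables (R : realType) (n : nat) (K : hilbertType R).
Variables (D : {set 'I_n}) (U : 'I_n -> 'I_n -> bop K) (V : 'I_n -> bop K).
Variable j : 'I_n.
Hypotheses (ts : twisted_system D U V) (jD : j \notin D).
Local Notation E := (ell2 K).

(** The power U i j ^ k, where V j is the shift to be adjoined. *)
Definition twist i k : bop K := iter k (mul (U i j)) one.

Lemma twistS i k x : twist i k.+1 x = U i j (twist i k x). Proof. by []. Qed.

Let Dj i : i \in D -> i != j.
Proof. by move=> iD; apply: contraNneq jD => <-. Qed.

Lemma twist_unitary_pow i k : i \in D -> is_unitary (twist i k).
Proof.
move=> iD; have ij := Dj iD.
elim: k => [|k IH]; first by split; rewrite cstar_one mul1.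
have [h1 h2] := unitaryP IH; rewrite -[twist i k.+1]/(mul (U i j) (twist i k)).
apply: unitary_intro => x; rewrite starM.
  by rewrite -[LHS]/(star (twist i k) (star (U i j) (U i j (twist i k x)))) (UsU ts).
by rewrite -[LHS]/(U i j (twist i k (star (twist i k) (star (U i j) x)))) h2 (UUs ts).
Qed.

Lemma twist_comm (S : bop K) i k x : i \in D ->
    (forall y, U i j (S y) = S (U i j y)) ->
  twist i k (S x) = S (twist i k x) /\
  star (twist i k) (S x) = S (star (twist i k) x).
Proof.
move=> iD hS; have h y : twist i k (S y) = S (twist i k y).
  by elim: k => [|k IH] //; rewrite !twistS IH hS.
split=> //; have [h1 h2] := unitaryP (twist_unitary_pow k iD).
by rewrite -{1}(h2 x) -h h1.
Qed.

Definition entry i k : bop K := mul (twist i k) (V i).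

Lemma entryE i k x : entry i k x = twist i k (V i x). Proof. by []. Qed.

Lemma entry_isometry i k : i \in D -> is_isometry (entry i k).
Proof.
move=> iD; apply: isometry_mul; last exact: (ts_isometry ts).
exact/is_unitary_isometry/twist_unitary_pow.
Qed.

Lemma entry_starE i k x : star (entry i k) x = star (V i) (star (twist i k) x).
Proof. by rewrite /entry starM. Qed.

Definition ext_U a b : bop E := diag (fun=> U a b).

(** V i acts on the k-th coordinate as U i j ^ k V i.  The relation
    V i V j = U i j V j V i with the shift V j imposes this form: the k-th
    coordinate must gain a factor U i j each time that the shift raises k. *)
Definition ext_V i : bop E := if i == j then shift K else diag (entry i).

Let Uc a b : a != b -> contractive (U a b) /\ contractive (star (U a b)).
Proof.
move=> ab; apply: isometry_contractive; apply: is_unitary_isometry.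
exact: (ts_unitary ts).
Qed.

Lemma ext_UE a b (f : E) k : a != b -> ext_U a b f k = U a b (f k).
Proof. by move=> /Uc[h _]; rewrite diagE. Qed.

Lemma ext_UsE a b (f : E) k : a != b -> star (ext_U a b) f k = star (U a b) (f k).
Proof. by move=> /Uc[h h']; rewrite diag_star// diagE. Qed.

Lemma ext_Vj : ext_V j = shift K.
Proof. by rewrite /ext_V eqxx. Qed.

Lemma ext_VE i (f : E) k : i \in D -> ext_V i f k = entry i k (f k).
Proof.
move=> iD; rewrite /ext_V (negPf (Dj iD)) diagE// => k'.
by have [] := isometry_contractive (entry_isometry k' iD).
Qed.

Lemma ext_VsE i (f : E) k : i \in D -> star (ext_V i) f k = star (entry i k) (f k).
Proof.
move=> iD; have h k' := isometry_contractive (entry_isometry k' iD).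
by rewrite /ext_V (negPf (Dj iD)) diag_star ?diagE// => k'; have [] := h k'.
Qed.

Lemma ext_system : twisted_system (j |: D) ext_U ext_V.
Proof.
have isoV i : i \in j |: D -> is_isometry (ext_V i).
  rewrite in_setU1 => /orP[/eqP ->|iD]; first by rewrite ext_Vj; have [] := shift_is_shift K.
  apply: bopP => f; apply: ell2P => k.
  rewrite -[LHS]/(star (ext_V i) (ext_V i f) k) ext_VsE// ext_VE//.
  by rewrite isometryP//; exact: entry_isometry.
split=> //.
- move=> a b ab; apply: unitary_intro => f; apply: ell2P => k.
    by rewrite ext_UsE// ext_UE// (UsU ts).
  by rewrite ext_UE// ext_UsE// (UUs ts).
- move=> a b ab; apply: bopP => f; apply: ell2P => k.
  by rewrite ext_UsE// ext_UE 1?eq_sym// (Ustar ts).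
- move=> a b c d ab cd; apply: bopP => f; apply: ell2P => k.
  rewrite -[LHS]/(ext_U a b (ext_U c d f) k) -[RHS]/(ext_U c d (ext_U a b f) k).
  by rewrite !ext_UE// (UU ts).
- move=> a b; rewrite !in_setU1 => /orP[/eqP ->|aD] /orP[/eqP ->|bD] ab.
  + by rewrite eqxx in ab.
  + apply: bopP => f; apply: ell2P => k.
    rewrite -[LHS]/(star (ext_V j) (ext_V b f) k).
    rewrite -[RHS]/(star (ext_U j b) (ext_V b (star (ext_V j) f)) k).
    rewrite ext_UsE// ext_VE// ext_Vj shift_star !unshiftE ext_VE// !entryE.
    by rewrite (Ustar ts _ ab).
  + apply: bopP => f; apply: ell2P => k.
    rewrite -[LHS]/(star (ext_V a) (ext_V j f) k).
    rewrite -[RHS]/(star (ext_U a j) (ext_V j (star (ext_V a) f)) k).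
    rewrite ext_UsE// ext_VsE// ext_Vj; case: k => [|k].
      by rewrite !shift0 !bop0.
    rewrite !shiftS ext_VsE// !entry_starE; have ja : j != a by rewrite eq_sym.
    rewrite (Ustar ts)// (UVs ts)//; congr (star (V a) _).
    have [_ e] := @twist_comm (U j a) a k (f k) aD (fun y => UU ts y ab ja).
    rewrite -[twist a k.+1]/(mul (U a j) (twist a k)) starM.
    rewrite -[LHS]/(star (twist a k) (star (U a j) (f k))).
    by rewrite (Ustar ts _ ab) e.
  + apply: bopP => f; apply: ell2P => k.
    rewrite -[LHS]/(star (ext_V a) (ext_V b f) k).
    rewrite -[RHS]/(star (ext_U a b) (ext_V b (star (ext_V a) f)) k).
    rewrite ext_VsE// ext_VE// ext_UsE// ext_VE// ext_VsE// !entryE !entry_starE.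
    set x := f k; have aj := Dj aD; have bj := Dj bD; have ba : b != a by rewrite eq_sym.
    have [_ e1] := @twist_comm (V b) a k x aD (fun y => UV ts y bD aj).
    have e0 y : twist b k (star (twist a k) y) = star (twist a k) (twist b k y).
      by have [_ ->] := @twist_comm (twist b k) a k y aD
           (fun y => esym (@twist_comm (U a j) b k y bD (fun z => UU ts z bj aj)).1).
    have e2 y := (@twist_comm (star (V a)) b k y bD (fun y => UVs ts y aD bj)).1.
    have e3 y := (@twist_comm (U b a) b k y bD (fun y => UU ts y bj ba)).1.
    by rewrite -e0 e1 -e2 (VsVj ts)// e3 (Ustar ts).
- move=> a b c; rewrite in_setU1 => /orP[/eqP ->|cD] ab.
    apply: bopP => f; apply: ell2P => k.
    rewrite -[LHS]/(ext_V j (ext_U a b f) k) -[RHS]/(ext_U a b (ext_V j f) k).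
    rewrite ext_UE// ext_Vj; case: k => [|k]; first by rewrite !shift0 bop0.
    by rewrite !shiftS ext_UE.
  apply: bopP => f; apply: ell2P => k.
  rewrite -[LHS]/(ext_V c (ext_U a b f) k) -[RHS]/(ext_U a b (ext_V c f) k).
  rewrite ext_VE// !ext_UE// ext_VE// !entryE -(UV ts)//.
  by have [-> _] := @twist_comm (U a b) c k (V c (f k)) cD (fun y => UU ts y (Dj cD) ab).
Qed.

Lemma ext_unitary i : i \in D -> is_unitary (V i) -> is_unitary (ext_V i).
Proof.
move=> iD /unitaryP[_ h].
apply: unitary_intro => f; apply: ell2P => k.
  rewrite ext_VsE// ext_VE// isometryP//; exact: entry_isometry.
rewrite ext_VE// ext_VsE// entryE entry_starE h.
by have [_ ->] := unitaryP (twist_unitary_pow k iD).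
Qed.

Lemma ext_shift i : i \in D -> is_shift (V i) -> is_shift (ext_V i).
Proof.
move=> iD [_ sh]; split; first by apply: (ts_isometry ext_system); rewrite in_setU1 iD orbT.
apply/seteqP; split=> [f fP|_ -> m _]; last first.
  by exists 0 => //; elim: m => [|m IH] //; rewrite iterS IH bop0.
apply: ell2P => k.
suff : (\bigcap_(m in [set: nat]) range (iter m (V i))) (f k) by rewrite sh.
move=> m _; have [g _ <-] := fP m I; clear fP.
have tw (m' : nat) x : range (iter m' (V i)) x -> range (iter m' (V i)) (twist i k x).
  move=> [y _ <-]; exists (twist i k y) => //; elim: m' => [|m' IH] //=.
  have [-> _] := @twist_comm (V i) i k (iter m' (V i) y) iD (fun y => UV ts y iD (Dj iD)).
  by rewrite IH.
elim: m => [|m IH]; first by exists (g k).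
rewrite [iter m.+1 (ext_V i) g]/= ext_VE// entryE; apply: tw.
by have [y _ <-] := IH; exists y.
Qed.

Lemma single_V i : i \in D -> intertwines (@single R K) (V i) (ext_V i) /\
  intertwines (@single R K) (star (V i)) (star (ext_V i)).
Proof.
move=> iD; split=> x; apply: ell2P => -[|k].
- by rewrite ext_VE.
- by rewrite ext_VE// !singleS bop0.
- by rewrite ext_VsE// !single0 entry_starE /twist /= cstar_one.
- by rewrite ext_VsE// !singleS bop0.
Qed.

Lemma single_U a b : a != b -> intertwines (@single R K) (U a b) (ext_U a b).
Proof.
move=> ab x; apply: ell2P => -[|k]; rewrite ext_UE//.
by rewrite !singleS bop0.
Qed.

End ShiftExtension.

(** * From tori to twisted isometries *)

Section Dilation.
Variables (R : realType) (n : nat).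

(** J embeds K in H as the wandering space of the adjoined shifts.  The last
    field is for the induction on A: the shifts adjoined first have to remain
    shifts when others are adjoined. *)
Record dilation (A : {set 'I_n}) (K : hilbertType R) (U : 'I_n -> 'I_n -> bop K)
    (V : 'I_n -> bop K) (H : hilbertType R) (U' : 'I_n -> 'I_n -> bop H)
    (V' : 'I_n -> bop H) (J : K -> H) : Prop := Dilation {
  dil_system : twisted_system (finset.setTfor _) U' V';
  dil_isometric : isometric_map J;
  dil_range : range J = wandering_space A V';
  dil_V : forall i, i \notin A -> intertwines J (V i) (V' i);
  dil_Vs : forall i, i \notin A -> intertwines J (star (V i)) (star (V' i));
  dil_U : forall a b, a != b -> intertwines J (U a b) (U' a b);
  dil_new_shift : forall i, i \in A -> is_shift (V' i);
  dil_unitary : forall i, i \notin A -> is_unitary (V i) -> is_unitary (V' i);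
  dil_shift : forall i, i \notin A -> is_shift (V i) -> is_shift (V' i) }.

(** For j in A, the sequences in K form a system where V j is a shift, and to which
    the induction applies with A minus j.  The wandering vectors for A are those
    for A minus j that come from the kernel of the adjoint of that shift, which is
    the copy of K in the sequences. *)
Lemma dilation_exists (A : {set 'I_n}) (K : hilbertType R)
    (U : 'I_n -> 'I_n -> bop K) (V : 'I_n -> bop K) :
    twisted_system (~: A)%SET U V ->
  exists H U' V' J, @dilation A K U V H U' V' J.
Proof.
have [m] := ubnP #|A|; elim: m A K U V => // m IH A K U V cA ts.
have [A0|[j jA]] := set_0Vmem A.
  exists K, U, V, id; rewrite A0 finset.setC0 in ts *; split=> //.
  - by apply/seteqP; split=> [x _ i|x _]; [rewrite inE|exists x].
  - by move=> i; rewrite inE.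
pose B := (A :\ j)%SET.
have BE : (~: B)%SET = (j |: ~: A)%SET by rewrite finset.setCD finset.setUC.
have jD : j \notin (~: A)%SET by rewrite inE negbK.
have cB : (#|B| < m)%N by rewrite (cardsD1 j A) jA in cA.
have ts1 := ext_system ts jD; rewrite -BE in ts1.
have [H [U' [V' [J d]]]] := IH B (ell2 K) _ _ cB ts1.
have jB : j \notin B by rewrite !inE eqxx.
have nB i : i \notin A -> i \notin B by apply: contra; rewrite inE => /andP[].
have iD i : i \notin A -> i \in (~: A)%SET by rewrite inE.
have iS := single_isometric K; have iJ := dil_isometric d.
have sJ x : star (V' j) (J x) = J (star (ext_V U V j j) x) by rewrite (dil_Vs d).
exists H, U', V', (J \o @single R K); split.
- exact: dil_system d.
- exact: isometric_comp.
- apply/seteqP; split=> [_ [x _ <-] i iA|x Wx].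
    have [->|ij] := eqVneq i j.
      rewrite /= sJ ext_Vj.
      have : [set f | star (shift K) f = 0] (single x) by rewrite -range_single; exists x.
      by move=> /= ->; apply: inner_self_eq0; rewrite iJ.2 inner0l.
    have : wandering_space B V' (J (single x)) by rewrite -(dil_range d); exists (single x).
    by apply; rewrite !inE ij.
  have : wandering_space B V' x by move=> i; rewrite inE => /andP[_]; exact: Wx.
  rewrite -(dil_range d) => -[f _ fx].
  have : [set f | star (shift K) f = 0] f.
    apply: (isometric_inj iJ); have := sJ f; rewrite ext_Vj => <-.
    by rewrite fx Wx//; apply/esym/inner_self_eq0; rewrite iJ.2 inner0l.
  by rewrite -range_single => -[y _ yf]; exists y => //=; rewrite yf.
- by move=> i iA x /=; rewrite (single_V ts jD (iD i iA)).1 (dil_V d (nB i iA)).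
- by move=> i iA x /=; rewrite (single_V ts jD (iD i iA)).2 (dil_Vs d (nB i iA)).
- by move=> a b ab x /=; rewrite (single_U ts ab) (dil_U d ab).
- move=> i iA; have [->|ij] := eqVneq i j.
    by apply: (dil_shift d jB); rewrite ext_Vj; exact: shift_is_shift.
  by apply: (dil_new_shift d); rewrite !inE ij.
- move=> i iA u; apply: (dil_unitary d (nB i iA)).
  exact: (ext_unitary ts jD (iD i iA) u).
- move=> i iA u; apply: (dil_shift d (nB i iA)).
  exact: (ext_shift ts jD (iD i iA) u).
Qed.

End Dilation.

Section Surjectivity.
Variables (R : realType) (n : nat).
Variable T : forall A : {set 'I_n}, twisted_torus R A.

(** As V i is unitary, V i V j = U i j V j V i can be turned into the relation
    between V i^* and V j. *)
Lemma torus_system (A : {set 'I_n}) (q : irrep [set: T A]) :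
  twisted_system (~: A)%SET (fun a b => q (torus_w (T A) a b))
    (fun i => q (torus_u (T A) i)).
Proof.
have fh := irrep_hom q; have r := torus_rel (T A).
have un a : is_unitary a -> is_unitary (q a).
  move=> [h1 h2]; split; rewrite -(hom_star fh)// -(hom_mul fh)// ?h1 ?h2.
    exact: (hom_one fh).
  exact: (hom_one fh).
have cm a b : commutes a b -> commutes (q a) (q b).
  by move=> h; rewrite /commutes -!(hom_mul fh)// h.
have nA i : i \in (~: A)%SET -> i \notin A by rewrite inE.
split.
- by move=> i j ij; apply/un/(torus_w_unitary r).
- by move=> i j ij; rewrite (torus_w_star r ij) (hom_star fh).
- by move=> i j k l ij kl; apply/cm/(torus_w_w r).
- by move=> i /nA iA; have [] := un _ (torus_u_unitary r iA).
- move=> i j /nA iA /nA jA ij; apply: bopP => x.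
  have [ui1 ui2] := unitaryP (un _ (torus_u_unitary r iA)).
  have [uw1 uw2] := unitaryP (un _ (torus_w_unitary r ij)).
  have uw y : q (torus_u (T A) i) (q (torus_w (T A) i j) y) =
              q (torus_w (T A) i j) (q (torus_u (T A) i) y).
    by have /(congr1 (fun S : bop _ => S y)) := cm _ _ (torus_u_w r iA ij).
  have uu y : q (torus_u (T A) i) (q (torus_u (T A) j) y) =
      q (torus_w (T A) i j) (q (torus_u (T A) j) (q (torus_u (T A) i) y)).
    have /(congr1 (fun a => q a y)) := torus_u_u r iA jA ij.
    by rewrite !(hom_mul fh).
  rewrite -[LHS]/(star (q (torus_u (T A) i)) (q (torus_u (T A) j) x)).
  rewrite -[RHS]/(star (q (torus_w (T A) i j))
     (q (torus_u (T A) j) (star (q (torus_u (T A) i)) x))).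
  apply: (can_inj uw1); rewrite uw2; apply: (can_inj ui1).
  by rewrite uw ui2 uu ui2.
- by move=> i j k /nA kA ij; apply/cm/(torus_u_w r).
Qed.

(** A nonzero reducing subspace meets the wandering space in a nonzero vector
    (wandering_nonzero), and its trace there reduces the torus representation, which
    is irreducible: so it contains the wandering space.  Two orthogonal reducing subspaces cannot both
    contain it, so the orthogonal complement is 0. *)
Lemma dilation_irreducible (A : {set 'I_n}) (q : irrep [set: T A])
    (H : hilbertType R) (U' : 'I_n -> 'I_n -> bop H) V' (J : irrep_space q -> H) :
    dilation A (fun a b => q (torus_w (T A) a b)) (fun i => q (torus_u (T A) i)) U' V' J ->
  jointly_irreducible V'.
Proof.
move=> d M cM Mred; have ts := dil_system d; have iJ := dil_isometric d.
have J0 : J 0 = 0 by apply: inner_self_eq0; rewrite iJ.2 inner0l.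
have key (N : set H) : closed_subspace N -> (forall i, reduces N (V' i)) ->
    (exists2 x, N x & x != 0) -> wandering_space A V' `<=` N.
  move=> cN Nred [x Nx x0].
  have [||y [Ny y0 Wy]] := wandering_nonzero ts (finset.subsetT A) (dil_new_shift d) _ _ Nx x0.
  - exact: (subspaceB cN).
  - by move=> i _; exact: Nred.
  have cQ : closed_subspace [set z | N (J z)].
    apply: (@closed_subspace_preimage_lipschitz R _ _ J 1) => //; first exact: iJ.1.
    move=> z; rewrite mul1r -lecR -!rnormE.
    by rewrite -(@ler_pXn2r _ 2)// ?nnegrE// !normr2E iJ.2.
  have NU i j x' : i != j -> N x' -> N (U' i j x').
    move=> ij Nx'; rewrite (twisted_UE ts ij).
    exact: (Nred i _ (Nred j _ (Nred i _ (Nred j _ Nx').1).1).2).2.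
  have Qred a : reduces [set z | N (J z)] (q a).
    apply: (torus_reduces (irrep_hom q) cQ) => [i iA z /= Nz|i j ij z /= Nz].
      have [h1 h2] := Nred i _ Nz.
      by rewrite (dil_V d iA) (dil_Vs d iA).
    have ji : j != i by rewrite eq_sym.
    rewrite (dil_U d ij); split; first exact: NU.
    rewrite -(hom_star (irrep_hom q))// -(torus_w_star (torus_rel (T A)) ij).
    by rewrite (dil_U d ji); exact: NU.
  have [z _ zy] : range J y by rewrite (dil_range d).
  have [Q0|QT] := irrep_irreducible cQ (fun a _ => Qred a).
    have : [set z | N (J z)] z by rewrite /= zy.
    by rewrite Q0 /= => z0; rewrite -zy z0 J0 eqxx in y0.
  rewrite -(dil_range d) => _ [w _ <-].
  by have : [set z | N (J z)] w by rewrite QT.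
have [M0|M0] := pselect (exists2 x, M x & x != 0); last first.
  left; apply/seteqP; split=> [x Mx|_ ->]; last exact: subspace0 cM.
  by apply: contrapT => /eqP x0; apply: M0; exists x.
have cT : closed_subspace [set: H] by split=> //; exact: closedT.
right; apply: (perp_complement cM cT) => // x _ xM.
apply: contrapT => /eqP x0.
pose N := [set y | forall z, M z -> inner y z = 0].
have WN : wandering_space A V' `<=` N.
  apply: key; first exact: closed_subspace_perp.
    move=> i y Ny; split=> z Mz.
      by rewrite inner_starl; apply: Ny; have [] := Mred i _ Mz.
    by rewrite inner_starl starK; apply: Ny; have [] := Mred i _ Mz.
  by exists x.
have WM := key _ cM Mred M0.
have [z z0] := irrep_nonzero q.
have Wz : wandering_space A V' (J z) by rewrite -(dil_range d); exists z.
move: z0 => /eqP; apply; apply: inner_self_eq0; rewrite -iJ.2.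
by apply: (WN _ Wz); exact: WM.
Qed.

Fact id_star_hom (H : hilbertType R) (S : set (bop H)) : star_hom S (fun a : bop H => a).
Proof. by []. Qed.

(** The representation is the inclusion of the C*-algebra generated by the
    dilation. *)
Lemma twisted_of_torus (q : torus_irrep T) :
  exists p : twisted_irrep R n, wandering_data p q.
Proof.
case: q => A q; have ts := torus_system q.
have [H [U' [V' [J d]]]] := dilation_exists ts.
have ts' := dil_system d; have iJ := dil_isometric d.
have tw : twisted_isometry U' V'.
  split; first exact: ts_unitary ts'.
  - exact: ts_star ts'.
  - exact: ts_commute ts'.
  - by move=> i; exact: (ts_isometry ts').
  - by move=> i j ij; exact: (ts_rel ts').
  - by move=> i j k ij; exact: (ts_central ts').
have H0 : exists x : H, x != 0.
  have [z z0] := irrep_nonzero q; exists (J z); apply: contraNneq z0 => e.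
  by apply/eqP/inner_self_eq0; rewrite -iJ.2 e inner0l.
have irr : irreducible (cstar_generated (range V')) (fun a : bop H => a).
  move=> M cM Mred; apply: (dilation_irreducible d cM) => i; apply: Mred.
  by apply: generated_in; exists i.
exists (TwistedIrrep tw (Irrep (@id_star_hom H _) H0 irr)); split=> /=.
- exact: dil_new_shift d.
- move=> i iA; apply: (dil_unitary d iA).
  have fh := irrep_hom q; have [h1 h2] := torus_u_unitary (torus_rel (T A)) iA.
  by split; rewrite -(hom_star fh)// -(hom_mul fh)// ?h1 ?h2 (hom_one fh).
- exists J; split=> //; first exact: dil_range d.
    exact: dil_V d.
  exact: dil_U d.
Qed.

End Surjectivity.

(** * Bijections between sets of classes *)

Section Classes.
Variables (X Y : Type) (eX : X -> X -> Prop) (eY : Y -> Y -> Prop).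
Variable D : X -> Y -> Prop.
Hypotheses (eXs : forall x, eX x x) (eXsym : forall x y, eX x y -> eX y x)
  (eXt : forall x y z, eX x y -> eX y z -> eX x z).
Hypotheses (eYs : forall x, eY x x) (eYsym : forall x y, eY x y -> eY y x)
  (eYt : forall x y z, eY x y -> eY y z -> eY x z).
Hypothesis Dcompat : forall x x' y y', eX x x' -> eY y y' -> D x y -> D x' y'.
Hypothesis Dtot : forall x, exists y, D x y.
Hypothesis Dsurj : forall y, exists x, D x y.
Hypothesis Dfun : forall x y y', D x y -> D x y' -> eY y y'.
Hypothesis Dinj : forall x x' y, D x y -> D x' y -> eX x x'.

Lemma class_set_eq (Z : Type) (e : Z -> Z -> Prop) (C C' : class_set e) :
  proj1_sig C = proj1_sig C' -> C = C'.
Proof.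
case: C C' => [C p] [C' q] /= E; subst C'; congr exist; exact: Prop_irrelevance.
Qed.

Lemma class_ofP (Z : Type) (e : Z -> Z -> Prop) : (forall x, e x x) ->
  (forall x y, e x y -> e y x) -> (forall x y z, e x y -> e y z -> e x z) ->
  forall x y, class_of e x = class_of e y <-> e x y.
Proof.
move=> er es et x y; split.
  by move=> /(congr1 (@proj1_sig _ _)) /= ->; apply: er.
move=> xy; apply: class_set_eq; apply: funext => z; apply: propext.
by split=> h; [exact: et (es _ _ xy) h|exact: et xy h].
Qed.

Lemma class_of_surj (Z : Type) (e : Z -> Z -> Prop) (C : class_set e) :
  exists x, C = class_of e x.
Proof. by case: (proj2_sig C) => x E; exists x; apply: class_set_eq. Qed.

(** Representatives are chosen on both sides; compatibility makes the class of the
    image independent of the choice. *)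
Lemma class_bijection : exists Phi : class_set eX -> class_set eY, bijective Phi /\
  forall x y, Phi (class_of eX x) = class_of eY y <-> D x y.
Proof.
have /choice[Phi PhiP] (C : class_set eX) :
   exists C' : class_set eY, forall x y, C = class_of eX x -> D x y -> C' = class_of eY y.
  have [x ->] := class_of_surj C; have [y Dxy] := Dtot x.
  exists (class_of eY y) => x' y' /(class_ofP eXs eXsym eXt) xx' Dx'.
  by apply/(class_ofP eYs eYsym eYt); apply: Dfun Dxy _; apply: Dcompat (eXsym xx') (eYs _) Dx'.
have /choice[Psi PsiP] (C : class_set eY) :
   exists C' : class_set eX, forall x y, C = class_of eY y -> D x y -> C' = class_of eX x.
  have [y ->] := class_of_surj C; have [x Dxy] := Dsurj y.
  exists (class_of eX x) => x' y' /(class_ofP eYs eYsym eYt) xx' Dx'.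
  by apply/(class_ofP eXs eXsym eXt); apply: Dinj Dxy _; apply: Dcompat (eXs _) (eYsym xx') Dx'.
exists Phi; split.
  exists Psi => C.
    have [x ->] := class_of_surj C; have [y Dxy] := Dtot x.
    by rewrite (PhiP _ _ _ erefl Dxy) (PsiP _ _ _ erefl Dxy).
  have [y ->] := class_of_surj C; have [x Dxy] := Dsurj y.
  by rewrite (PsiP _ _ _ erefl Dxy) (PhiP _ _ _ erefl Dxy).
move=> x y; split; last exact: PhiP.
have [y' Dxy'] := Dtot x.
rewrite (PhiP _ _ _ erefl Dxy') => /(class_ofP eYs eYsym eYt) yy'.
exact: Dcompat (eXs _) yy' Dxy'.
Qed.
End Classes.

Theorem corollary7p6 (R : realType) (n : nat) (hn : (2 <= n)%N)
    (T : forall A : {set 'I_n}, twisted_torus R A) :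
  exists Phi : class_set (@twisted_equiv R n) -> class_set (@torus_equiv R n T),
    bijective Phi /\
    forall (p : twisted_irrep R n) (q : torus_irrep T),
      Phi (class_of (@twisted_equiv R n) p) = class_of (@torus_equiv R n T) q
      <-> wandering_data p q.
Proof.
apply: class_bijection.
- exact: twisted_equiv_refl.
- exact: twisted_equiv_sym.
- exact: twisted_equiv_trans.
- exact: torus_equiv_refl.
- exact: torus_equiv_sym.
- exact: torus_equiv_trans.
- exact: wandering_data_equiv.
- exact: torus_of_twisted.
- exact: twisted_of_torus.
- exact: wandering_data_functional.
- exact: wandering_data_injective.
Qed.
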